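(* Assume the standing assumptions on the data listed in the context. There exists a constant $C>0$, not depending on the discretization $\mathcal{D}$, such that every solution of the finite volume scheme described in the context satisfies $$\sum_{n=0}^{N-1}\delta t\sum_{K\in\mathcal{T}}\sum_{L\in N(K)}\tau_{K|L}\big(\delta^{n+1}_{K|L}(\mathcal{B}(s_l))\big)^2\le C,$$ $$\sum_{n=0}^{N-1}\delta t\sum_{K\in\mathcal{T}}\sum_{L\in N(K)}\tau_{K|L}M^{n+1}_{l,K|L}\big(\delta^{n+1}_{K|L}(\bar p(s_l))\big)^2\le C,$$ $$\sum_{n=0}^{N-1}\delta t\sum_{K\in\mathcal{T}}\sum_{L\in N(K)}\tau_{K|L}M^{n+1}_{g,K|L}\big(\delta^{n+1}_{K|L}(\tilde p(s_l))\big)^2\le C.$$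
   Context: **Data and standing assumptions.** $T>0$; $\Omega\subset\mathbb{R}^\ell$ ($\ell\ge1$) is a bounded connected polygonal open set; $Q_T=(0,T)\times\Omega$; $\partial\Omega=\Gamma_l\cup\Gamma_{imp}$ with $\Gamma_l$ of positive measure; $\mathbf{g}\in\mathbb{R}^\ell$ is a constant vector. Phases are $\alpha\in\{l,g\}$, with saturations $s_l+s_g=1$. Boundary conditions: $p_l=p_g=0$ on $(0,T)\times\Gamma_l$; zero normal flux of each phase on $(0,T)\times\Gamma_{imp}$. Initial data $p^0_\alpha\in L^2(\Omega)$, $0\le s^0_\alpha\le1$ a.e., $s^0_l+s^0_g=1$, $p_c(s^0_l)=p^0_g-p^0_l$. Injected saturations $s^I_\alpha(t,x)\in[0,1]$ are given, $s^I_l+s^I_g=1$. (1) $\phi$ is measurable and $\phi_0\le\phi(x)\le\phi_1$ a.e. in $\Omega$ with positive constants $\phi_0,\phi_1$. (2) $M_l,M_g\in C^0([0,1],\mathbb{R}^+)$ are non-decreasing, $M_\alpha(0)=0$, and there is $m_0>0$ with $M_l(s)+M_g(1-s)\ge m_0$ for all $s\in[0,1]$; $M_\alpha$ is extended outside $[0,1]$ by constants, continuously. (3) $f_P,f_I\in L^2(Q_T)$, $f_P,f_I\ge0$ a.e. (4) $\rho_\alpha\in C^1(\mathbb{R})$ is increasing and $0<\rho_m\le\rho_\alpha(p_\alpha)\le\rho_M$ for constants $\rho_m,\rho_M$. (5) $p_c\in C^1([0,1];\mathbb{R}^+)$ is decreasing, $p_c(1)=0$, and $|p_c'|\ge\underline{p_c}>0$.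 (6) With $M(s)=M_l(s)+M_g(1-s)$, the function $\gamma(s)=-\frac{M_l(s)M_g(1-s)}{M(s)}p_c'(s)$ belongs to $C^1([0,1];\mathbb{R}^+)$, $\gamma>0$ on $(0,1)$, $\gamma(0)=\gamma(1)=0$; with $\mathcal{B}(s)=\int_0^s\gamma(z)\,dz$, the inverse $\mathcal{B}^{-1}$ is Hölder of order $\theta\in(0,1]$ on $[0,\mathcal{B}(1)]$. **Discretization.** An admissible mesh $\mathcal{T}$ of $\Omega$ is a finite set of disjoint open bounded polygonal convex control volumes $K$, the closure of whose union is $\overline\Omega$, with centers $x_K\in K$. $\mathcal{E}$ is the set of pairs $(K,L)$, $K\neq L$, such that $\sigma_{K|L}=\overline K\cap\overline L$ has positive $(\ell-1)$-dimensional measure $|\sigma_{K|L}|$; $N(K)=\{L:(K,L)\in\mathcal{E}\}$; $\partial K=(\overline K\cap\partial\Omega)\cup\bigcup_{L\in N(K)}\sigma_{K|L}$; the line through $x_K,x_L$ is orthogonal to $\sigma_{K|L}$; $d_{K|L}=|x_K-x_L|$; $\tau_{K|L}=|\sigma_{K|L}|/d_{K|L}$; $\eta_{K|L}$ is the unit normal to $\sigma_{K|L}$ outward to $K$; $|K|$ is the measure of $K$. Regularity: for a fixed $\xi>0$, $\sum_{L\in N(K)}|\sigma_{K|L}|d_{K|L}\le\xi|K|$ for all $K$. Each exterior face lies in $\Gamma_l$ or in $\Gamma_{imp}$. Time grid: $t^n=n\,\delta t$, $n=0,\dots,N+1$, $t^{N+1}=T$. A discretization $\mathcal{D}$ consists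 of a mesh and a time grid. Boundary convention: in the scheme and in all sums of fluxes or differences, $N(K)$ also includes each exterior face $\sigma\subset\Gamma_l$ of $K$ as a fictitious neighbour, with $d_{K,\sigma}$ the distance from $x_K$ to the hyperplane containing $\sigma$ in place of $d_{K|L}$, and values $p_{l,\sigma}=p_{g,\sigma}=0$, $s_{l,\sigma}=1$, $s_{g,\sigma}=0$; faces in $\Gamma_{imp}$ carry no flux. **Scheme.** $\delta^{n+1}_{K|L}(u)=u^{n+1}_L-u^{n+1}_K$, and $\delta^{n+1}_{K|L}(f(u))=f(u^{n+1}_L)-f(u^{n+1}_K)$; $c^+=\max(c,0)$, $c^-=\max(-c,0)$; $G_\alpha(a,b,c)=-M_\alpha(b)c^++M_\alpha(a)c^-$. $\phi_K$ is the mean of $\phi$ on $K$; $f^{n+1}_{P,K},f^{n+1}_{I,K},(s^I_{\alpha,K})^{n+1}$ are means over $(t^n,t^{n+1})\times K$. The interface density is given by $\frac1{\rho^{n+1}_{\alpha,K|L}}=\frac{1}{p^{n+1}_{\alpha,L}-p^{n+1}_{\alpha,K}}\int_{p^{n+1}_{\alpha,K}}^{p^{n+1}_{\alpha,L}}\frac{d\zeta}{\rho_\alpha(\zeta)}$ if $p^{n+1}_{\alpha,K}\ne p^{n+1}_{\alpha,L}$, and $1/\rho_\alpha(p^{n+1}_{\alpha,K})$ otherwise. Gravity flux: $F^{n+1}_{\alpha,K}=\sum_{L\in N(K)}|\sigma_{K|L}|(\rho^{n+1}_{\alpha,K|L})^2\big(M_\alpha(s^{n+1}_{\alpha,K})(\mathbf{g}\cdot\eta_{K|L})^+-M_\alpha(s^{n+1}_{\alpha,L})(\mathbf{g}\cdot\eta_{K|L})^-\big)$.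 The scheme is: $p^0_{\alpha,K},s^0_{\alpha,K}$ are the means of $p^0_\alpha,s^0_\alpha$ on $K$, and for all $K\in\mathcal{T}$, $n=0,\dots,N$, $\alpha=l,g$, $$|K|\phi_K\frac{\rho_\alpha(p^{n+1}_{\alpha,K})s^{n+1}_{\alpha,K}-\rho_\alpha(p^n_{\alpha,K})s^n_{\alpha,K}}{\delta t}+\sum_{L\in N(K)}\tau_{K|L}\rho^{n+1}_{\alpha,K|L}G_\alpha(s^{n+1}_{\alpha,K},s^{n+1}_{\alpha,L};\delta^{n+1}_{K|L}(p_\alpha))+F^{n+1}_{\alpha,K}$$ $$+|K|\rho_\alpha(p^{n+1}_{\alpha,K})s^{n+1}_{\alpha,K}f^{n+1}_{P,K}=|K|\rho_\alpha(p^{n+1}_{\alpha,K})(s^I_{\alpha,K})^{n+1}f^{n+1}_{I,K},$$ $$s^{n+1}_{l,K}+s^{n+1}_{g,K}=1,\qquad p_c(s^{n+1}_{l,K})=p^{n+1}_{g,K}-p^{n+1}_{l,K},$$ where in the last relation $p_c$ is extended to a continuous strictly decreasing bijection of $\mathbb{R}$. (Solutions of the scheme have saturations in $[0,1]$.) **Upwind mobilities and artificial pressures.** $M^{n+1}_{\alpha,K|L}=M_\alpha(s^{n+1}_{\alpha,K})$ if $\delta^{n+1}_{K|L}(p_\alpha)\le0$, and $M^{n+1}_{\alpha,K|L}=M_\alpha(s^{n+1}_{\alpha,L})$ otherwise. $\bar p(s)=\int_0^s\frac{M_g(1-z)}{M(z)}p_c'(z)\,dz$ and $\tilde p(s)=-\int_0^s\frac{M_l(z)}{M(z)}p_c'(z)\,dz$.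 *)

(* Defs.v *)
From HB Require Import structures.
From mathcomp Require Import all_boot all_order all_algebra.
From mathcomp Require Import all_classical all_reals all_analysis.

Set Implicit Arguments.
Unset Strict Implicit.
Unset Printing Implicit Defensive.
Import Order.TTheory GRing.Theory Num.Theory.
Import numFieldNormedType.Exports.
Local Open Scope classical_set_scope.
Local Open Scope ring_scope.

Definition measure_rV_display : measure_display.
Proof. exact: default_measure_display. Qed.

Section measurable_rV.
Context (R : realType) (n : nat).

(* The sigma-algebra generated by the coordinates, i.e. the Borel one. *)
Let coors (i : 'I_n) (x : 'rV[R]_n) : R := x 0 i.

Let rV_set0 : g_sigma_preimage coors set0.
Proof. exact: sigma_algebra0. Qed.

Let rV_setC A : g_sigma_preimage coors A -> g_sigma_preimage coors (~` A).
Proof. exact: sigma_algebraC. Qed.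

Let rV_bigcup (F : _^nat) : (forall i, g_sigma_preimage coors (F i)) ->
  g_sigma_preimage coors (\bigcup_i (F i)).
Proof. exact: sigma_algebra_bigcup. Qed.

HB.instance Definition _ := @isMeasurable.Build measure_rV_display
  'rV[R]_n (g_sigma_preimage coors) rV_set0 rV_setC rV_bigcup.

Lemma measurable_coord (i : 'I_n) :
  measurable_fun [set: 'rV[R]_n] (fun x : 'rV[R]_n => x 0 i).
Proof.
move=> _ Y mY; rewrite setTI; apply: sub_sigma_algebra => /=.
rewrite -bigcup_seq/=; exists i => /=; first by rewrite mem_index_enum.
by exists Y => //; rewrite setTI.
Qed.

Lemma measurable_fun_rV d (T : measurableType d) (f : T -> 'rV[R]_n) :
  (forall i, measurable_fun [set: T] (fun t => f t 0 i)) ->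
  measurable_fun [set: T] f.
Proof.
move=> mf; apply: (measurability
  (\big[setU/set0]_(i < n) preimage_set_system setT (coors i) measurable)) => //.
move=> _ [B + <-]; rewrite -bigcup_seq => -[i _ [C mC <-]].
by have := mf i measurableT C mC; rewrite !setTI.
Qed.

End measurable_rV.

Section lebesgue_rV.
Context (R : realType).

Definition cons_rV n (xy : R * 'rV[R]_n) : 'rV[R]_n.+1 :=
  row_mx (\row_(i < 1) xy.1) xy.2.

Definition uncons_rV n (x : 'rV[R]_n.+1) : R * 'rV[R]_n :=
  (x 0 0, \row_i x 0 (lift ord0 i)).

Lemma cons_rVK n : cancel (@cons_rV n) (@uncons_rV n).
Proof.
case=> a v; rewrite /uncons_rV /cons_rV /=; congr pair.
  by rewrite mxE; case: splitP => // j _; rewrite mxE.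
apply/rowP => i; rewrite !mxE; case: splitP => [j|j] /=.
  by rewrite /bump/= add1n; case: j => -[].
by rewrite /bump/= !add1n => -[ij]; congr (v _ _); exact/val_inj.
Qed.

Lemma measurable_cons_rV n : measurable_fun setT (@cons_rV n).
Proof.
apply: measurable_fun_rV => i.
rewrite (_ : (fun _ => _) = if unlift ord0 i is Some j
    then (fun x : 'rV[R]_n => x 0 j) \o snd else fst); last first.
  apply/funext => t; rewrite mxE; case: splitP => [j ij|j ij].
    rewrite mxE; case: unliftP => // k ik; move: ij.
    by rewrite ik /=; case: j => -[].
  case: unliftP => [k ik|i0]; last by move: ij; rewrite i0.
  move: ij; rewrite ik /= /bump/= !add1n => -[kj].
  by congr (t.2 _ _); exact/val_inj.
case: (unlift ord0 i) => [j|]; last exact: measurable_fst.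
by apply: measurableT_comp => //; exact: measurable_coord.
Qed.

Lemma measurable_uncons_rV n : measurable_fun setT (@uncons_rV n).
Proof.
apply/measurable_fun_pairP; split; first exact: measurable_coord.
apply: measurable_fun_rV => i.
rewrite (_ : (fun _ => _) = fun x : 'rV[R]_n.+1 => x 0 (lift ord0 i)).
  exact: measurable_coord.
by apply/funext => t; rewrite /= mxE.
Qed.

Section step.
Context n (m : {sigma_finite_measure set 'rV[R]_n -> \bar R}).

Definition lebesgue_rV_step : set 'rV[R]_n.+1 -> \bar R :=
  pushforward (lebesgue_measure \x m)%E (@cons_rV n).

Let step0 : lebesgue_rV_step set0 = 0%E.
Proof. by rewrite /lebesgue_rV_step /pushforward preimage_set0 measure0. Qed.

Let step_ge0 A : (0 <= lebesgue_rV_step A)%E.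
Proof. by rewrite /lebesgue_rV_step /pushforward measure_ge0. Qed.

Let step_sigma_additive : semi_sigma_additive lebesgue_rV_step.
Proof.
have mc A : measurable A -> measurable (@cons_rV n @^-1` A).
  by move=> mA; rewrite -[X in measurable X]setTI; exact: measurable_cons_rV.
move=> F mF tF mUF; rewrite /lebesgue_rV_step /pushforward preimage_bigcup.
apply: measure_semi_sigma_additive.
- by move=> i; exact: mc.
- apply/trivIsetP => /= i j _ _ ij; rewrite -preimage_setI.
  by move/trivIsetP : tF => /(_ _ _ _ _ ij) ->//; rewrite preimage_set0.
- by rewrite -preimage_bigcup; exact: mc.
Qed.

HB.instance Definition _ := isMeasure.Build _ _ _ lebesgue_rV_step
  step0 step_ge0 step_sigma_additive.

Let step_sigma_finite : sigma_finite setT lebesgue_rV_step.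
Proof.
have /sigma_finiteP[F [TF ndF Foo]] := sigma_finiteT (@lebesgue_measure R).
have /sigma_finiteP[G [TG ndG Goo]] := sigma_finiteT m.
exists (fun k => @uncons_rV n @^-1` (F k `*` G k)).
  apply/esym; rewrite -subTset => x _.
  have [i _ Fi] : (\bigcup_k F k) (uncons_rV x).1 by rewrite -TF.
  have [j _ Gj] : (\bigcup_k G k) (uncons_rV x).2 by rewrite -TG.
  exists (maxn i j) => //; split => /=.
  - by move: Fi; exact/subsetPset/ndF/leq_maxl.
  - by move: Gj; exact/subsetPset/ndG/leq_maxr.
move=> k; have [mFk Fk] := Foo k; have [mGk Gk] := Goo k.
have mFG : measurable (F k `*` G k) by exact: measurableX.
split; first by rewrite -[X in measurable X]setTI; exact: measurable_uncons_rV.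
rewrite /lebesgue_rV_step /pushforward -comp_preimage.
rewrite (_ : _ \o _ = id) ?preimage_id; last first.
  by apply/funext => t /=; rewrite cons_rVK.
by rewrite product_measure1E// lte_mul_pinfty// ge0_fin_numE.
Qed.

HB.instance Definition _ := Measure_isSigmaFinite.Build _ _ _ lebesgue_rV_step
  step_sigma_finite.

End step.

(* Lebesgue measure on R^n: the n-fold product of the one on R. *)
Fixpoint lebesgue_rV n : {sigma_finite_measure set 'rV[R]_n -> \bar R} :=
  if n is k.+1 then lebesgue_rV_step (lebesgue_rV k) else \d_(0 : 'rV[R]_0).

Lemma lebesgue_rV_box n (a b : 'rV[R]_n) : (forall i, a 0 i <= b 0 i) ->
  @lebesgue_rV n [set x | forall i, a 0 i <= x 0 i <= b 0 i] =
  (\prod_i (b 0 i - a 0 i))%:E.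
Proof.
elim: n a b => [|n IH] a b ab.
  by rewrite big_ord0 /= diracE mem_set// => -[].
rewrite /= /lebesgue_rV_step /pushforward.
have -> : @cons_rV n @^-1` [set x | forall i, a 0 i <= x 0 i <= b 0 i] =
  `[a 0 0, b 0 0] `*` [set x : 'rV[R]_n |
    forall i, (uncons_rV a).2 0 i <= x 0 i <= (uncons_rV b).2 0 i].
  have K1 x v : @cons_rV n (x, v) 0 0 = x
    by exact: (congr1 fst (cons_rVK (x,v))).
  have K2 x v (i : 'I_n) : @cons_rV n (x, v) 0 (lift ord0 i) = v 0 i.
    by have := congr1 (fun z : R * 'rV[R]_n => z.2 0 i) (cons_rVK (x, v));
       rewrite /= mxE.
  apply/seteqP; split => -[x v] /=.
    move=> h; split; first by have := h 0; rewrite K1 in_itv.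
    by move=> i; have := h (lift ord0 i); rewrite K2 !mxE.
  move=> [h1 h2] i; case: (unliftP ord0 i) => [j|] ->.
    by rewrite K2; have := h2 j; rewrite !mxE.
  by rewrite K1; move: h1; rewrite in_itv.
rewrite product_measure1E//=; last first.
  rewrite (_ : [set x : 'rV[R]_n | _] =
    \bigcap_(i in [set: 'I_n]) ((fun x : 'rV[R]_n => x 0 i) @^-1`
      `[a 0 (lift ord0 i), b 0 (lift ord0 i)])).
    apply: fin_bigcap_measurable => [|i _]; first exact: finite_finset.
    rewrite -[X in measurable X]setTI.
    exact: measurable_coord.
  apply/seteqP; split => x /= h i; first by move=> _;
    have := h i; rewrite !mxE /= in_itv.
  by have := h i I; rewrite !mxE /= in_itv.
rewrite IH; last by move=> i; rewrite !mxE.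
rewrite lebesgue_measure_itv/= lte_fin big_ord_recl EFinM.
congr (_ * _)%E; last by congr EFin; apply: eq_bigr => i _; rewrite !mxE.
by have := ab 0; rewrite le_eqVlt => /orP[/eqP->|->]//; rewrite ltxx subrr.
Qed.

End lebesgue_rV.
Arguments lebesgue_rV {R} n.

Section geometry.
Context (R : realType) (l : nat).
Implicit Types (A K : set 'rV[R]_l) (x y : 'rV[R]_l).

Definition dotv x y : R := \sum_(i < l) x 0 i * y 0 i.

(* The library norm of 'rV[R]_l is the sup norm. *)
Definition enorm x : R := Num.sqrt (dotv x x).

Definition frontier A : set 'rV[R]_l := closure A `\` A°.

Definition hyperplane (eta : 'rV[R]_l) (b : R) : set 'rV[R]_l :=
  [set x | dotv eta x = b].

Definition dist_to x A : R := inf [set enorm (x - y) | y in A].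

(* The (l-1)-dimensional measure of a subset A of a hyperplane with unit
   normal eta, as the l-dimensional measure of the right prism of height 1
   over A; for l = 1 it counts points. *)
Definition flat_measure (eta : 'rV[R]_l) A : \bar R :=
  lebesgue_rV l
    [set x | exists y (t : R), [/\ A y, 0 <= t <= 1 & x = y + t *: eta]].

(* Positive (l-1)-dimensional measure, for a subset A of a finite union of
   hyperplanes. *)
Definition pos_measure A : Prop := exists (eta : 'rV[R]_l) (b : R),
  enorm eta = 1 /\ (0 < flat_measure eta (A `&` hyperplane eta b))%E.

(* Bounded or not; an element (a, b) of the list is the half-space a.x <= b. *)
Definition closed_polyhedron (hs : seq ('rV[R]_l * R)) : set 'rV[R]_l :=
  [set x | forall h, h \in hs -> dotv h.1 x <= h.2].

Definition polygonal_open A : Prop :=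
  exists ps : seq (seq ('rV[R]_l * R)),
    A = [set x | exists2 hs, hs \in ps & closed_polyhedron hs x]°.

Definition polygonal_open_convex A : Prop :=
  exists hs : seq ('rV[R]_l * R),
    A = [set x | forall h, h \in hs -> dotv h.1 x < h.2].

(* sigma lies in the hyperplane eta.x = b, and eta points out of K. *)
Definition outward_unit_normal K (sigma : set 'rV[R]_l) (eta : 'rV[R]_l)
    (b : R) : Prop :=
  [/\ enorm eta = 1, sigma `<=` hyperplane eta b &
      K `<=` [set x | dotv eta x <= b]].

End geometry.

Section real_functions.
Context (R : realType).

(* f' is the derivative of f, one-sided at 0 and 1, and f is C^1 on [0, 1]. *)
Definition C1_unit_itv (f f' : R -> R) : Prop :=
  [/\ {within `[0, 1], continuous f}, {within `[0, 1], continuous f'} &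
      forall x : R, 0 < x < 1 -> is_derive x 1 f (f' x)].

Definition oint (f : R -> R) (a b : R) : R :=
  if a <= b then \int[lebesgue_measure]_(x in `[a, b]) f x
  else - \int[lebesgue_measure]_(x in `[b, a]) f x.

Definition mean d (X : measurableType d) (mu : {measure set X -> \bar R})
    (D : set X) (f : X -> R) : R :=
  (fine (mu D))^-1 * \int[mu]_(x in D) f x.

Definition square_integrable d (X : measurableType d)
    (mu : {measure set X -> \bar R}) (D : set X) (f : X -> R) : Prop :=
  (f \_ D) \in Lfun mu 2%:E.

End real_functions.

Inductive phase := liq | gas.

Section model.
Context (R : realType) (l : nat).

(* Functions on [0, 1] are given on R; mob is its extension by constants and pc
   its extension to a bijection of R. dpc is the derivative of pc on [0, 1]. *)
Record model_data := ModelData {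
  T_end : R;
  Omega : set 'rV[R]_l;
  Gamma_l : set 'rV[R]_l;
  Gamma_imp : set 'rV[R]_l;
  grav : 'rV[R]_l;
  phi : 'rV[R]_l -> R;
  mob : phase -> R -> R;
  rho : phase -> R -> R;
  pc : R -> R;
  dpc : R -> R;
  p0 : phase -> 'rV[R]_l -> R;
  s0 : phase -> 'rV[R]_l -> R;
  sI : phase -> R * 'rV[R]_l -> R;
  fP : R * 'rV[R]_l -> R;
  fI : R * 'rV[R]_l -> R
}.

Variable d : model_data.

Definition space_time :
    {measure set (measurableTypeR R * 'rV[R]_l) -> \bar R} :=
  (lebesgue_measure \x lebesgue_rV l)%E.

Definition Q_T : set (R * 'rV[R]_l) := `]0, T_end d[ `*` Omega d.

Definition mob_tot (s : R) : R := mob d liq s + mob d gas (1 - s).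

Definition gamma (s : R) : R :=
  - (mob d liq s * mob d gas (1 - s) / mob_tot s * dpc d s).

Definition calB (s : R) : R := oint gamma 0 s.

Definition pbar (s : R) : R :=
  oint (fun z => mob d gas (1 - z) / mob_tot z * dpc d z) 0 s.

Definition ptilde (s : R) : R :=
  - oint (fun z => mob d liq z / mob_tot z * dpc d z) 0 s.

Record standing_assumptions : Prop := StandingAssumptions {
  T_end_gt0 : 0 < T_end d;
  Omega_bounded : bounded_set (Omega d);
  Omega_connected : connected (Omega d);
  Omega_polygonal : polygonal_open (Omega d);
  Gamma_cover : frontier (Omega d) = Gamma_l d `|` Gamma_imp d;
  Gamma_l_measurable : measurable (Gamma_l d);
  Gamma_imp_measurable : measurable (Gamma_imp d);
  Gamma_l_pos : pos_measure (Gamma_l d);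
  Gamma_overlap : ~ pos_measure (Gamma_l d `&` Gamma_imp d);

  p0_L2 : forall a, square_integrable (lebesgue_rV l) (Omega d) (p0 d a);
  s0_measurable : forall a, measurable_fun (Omega d) (s0 d a);
  s0_range : forall a,
    {ae lebesgue_rV l, forall x, Omega d x -> 0 <= s0 d a x <= 1};
  s0_sum : {ae lebesgue_rV l, forall x, Omega d x ->
    s0 d liq x + s0 d gas x = 1};
  s0_pc : {ae lebesgue_rV l, forall x, Omega d x ->
    pc d (s0 d liq x) = p0 d gas x - p0 d liq x};
  sI_measurable : forall a, measurable_fun Q_T (sI d a);
  sI_range : forall a, {ae space_time, forall z, Q_T z -> 0 <= sI d a z <= 1};
  sI_sum : {ae space_time, forall z, Q_T z -> sI d liq z + sI d gas z = 1};

  phi_measurable : measurable_fun (Omega d) (phi d);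
  phi_range : exists phi0 phi1 : R, [/\ 0 < phi0, 0 < phi1 &
    {ae lebesgue_rV l, forall x, Omega d x -> phi0 <= phi d x <= phi1}];

  mob_continuous : forall a, {within `[0, 1], continuous (mob d a)};
  mob_ge0 : forall a (s : R), 0 <= s <= 1 -> 0 <= mob d a s;
  mob_nondecreasing : forall a (r s : R),
    0 <= r -> r <= s -> s <= 1 -> mob d a r <= mob d a s;
  mob_0 : forall a, mob d a 0 = 0;
  mob_total : exists2 m0 : R, 0 < m0 & forall s : R, 0 <= s <= 1 -> m0 <= mob_tot s;
  mob_ext_left : forall a (s : R), s <= 0 -> mob d a s = mob d a 0;
  mob_ext_right : forall a (s : R), 1 <= s -> mob d a s = mob d a 1;

  fP_L2 : square_integrable space_time Q_T (fP d);
  fI_L2 : square_integrable space_time Q_T (fI d);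
  fP_ge0 : {ae space_time, forall z, Q_T z -> 0 <= fP d z};
  fI_ge0 : {ae space_time, forall z, Q_T z -> 0 <= fI d z};

  rho_derivable : forall a (x : R), derivable (rho d a) x 1;
  rho_C1 : forall a, continuous (derive1 (rho d a));
  rho_increasing : forall a, {homo rho d a : x y / x < y};
  rho_range : exists rho_m rho_M : R, 0 < rho_m /\
    forall a (x : R), rho_m <= rho d a x <= rho_M;

  pc_C1 : C1_unit_itv (pc d) (dpc d);
  pc_ge0 : forall s : R, 0 <= s <= 1 -> 0 <= pc d s;
  pc_1 : pc d 1 = 0;
  pc_steep : exists2 c : R, 0 < c & forall s : R, 0 <= s <= 1 -> c <= `|dpc d s|;
  pc_continuous : continuous (pc d);
  pc_decreasing : {homo pc d : x y / x < y >-> y < x};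
  pc_bijective : bijective (pc d);

  gamma_C1 : exists dgamma, C1_unit_itv gamma dgamma;
  gamma_gt0 : forall s : R, 0 < s < 1 -> 0 < gamma s;
  gamma_0 : gamma 0 = 0;
  gamma_1 : gamma 1 = 0;
  calB_inv_hoelder : exists (Binv : R -> R) (theta c : R), [/\
    forall s : R, 0 <= s <= 1 -> Binv (calB s) = s,
    forall b : R, 0 <= b <= calB 1 -> 0 <= Binv b <= 1 /\ calB (Binv b) = b,
    0 < theta <= 1 &
    forall a b : R, 0 <= a <= calB 1 -> 0 <= b <= calB 1 ->
      `|Binv a - Binv b| <= c * `|a - b| `^ theta]
}.

(* face_normal K L is the unit normal to the interface outward to K. An exterior
   face e lies in the hyperplane ext_normal e . x = ext_offset e. *)
Record mesh := Mesh {
  cv : finType;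
  cell : cv -> set 'rV[R]_l;
  center : cv -> 'rV[R]_l;
  face_normal : cv -> cv -> 'rV[R]_l;
  ext : finType;
  ext_cell : ext -> cv;
  ext_face : ext -> set 'rV[R]_l;
  ext_normal : ext -> 'rV[R]_l;
  ext_offset : ext -> R
}.

Section mesh.
Variable m : mesh.
Implicit Types (K L : cv m) (e : ext m).

Definition interface K L : set 'rV[R]_l :=
  closure (cell K) `&` closure (cell L).

Definition adjacent K L : bool := (K != L) && `[< pos_measure (interface K L) >].

Definition volume K : R := fine (lebesgue_rV l (cell K)).

Record admissible : Prop := Admissible {
  cell_bounded : forall K, bounded_set (cell K);
  cell_polygonal : forall K, polygonal_open_convex (cell K);
  cell_disjoint : forall K L, K != L -> cell K `&` cell L = set0;
  cell_cover : closure (\bigcup_(K in [set: cv m]) cell K) = closure (Omega d);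
  center_in : forall K, cell K (center K);
  normal_outward : forall K L, adjacent K L ->
    exists b : R, outward_unit_normal (cell K) (interface K L) (face_normal K L) b;
  orthogonality : forall K L, adjacent K L ->
    exists c : R, center L - center K = c *: face_normal K L;
  cell_frontier : forall K, frontier (cell K) =
    (closure (cell K) `&` frontier (Omega d)) `|`
    \bigcup_(L in [set L | adjacent K L]) interface K L;
  ext_face_measurable : forall e, measurable (ext_face e);
  ext_face_pos : forall e, pos_measure (ext_face e);
  ext_face_sub : forall e, ext_face e `<=`
    closure (cell (ext_cell e)) `&` frontier (Omega d);
  ext_face_normal : forall e, outward_unit_normal (cell (ext_cell e))
    (ext_face e) (ext_normal e) (ext_offset e);
  ext_face_overlap : forall e e', e != e' -> ext_cell e = ext_cell e' ->
    ~ pos_measure (ext_face e `&` ext_face e');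
  ext_face_cover : forall K, ~ pos_measure
    ((closure (cell K) `&` frontier (Omega d)) `\`
     \bigcup_(e in [set e | ext_cell e = K]) ext_face e);
  ext_face_split : forall e,
    ext_face e `<=` Gamma_l d \/ ext_face e `<=` Gamma_imp d
}.

(* Neighbours in the extended sense: inl L is a control volume, inr e a
   fictitious neighbour across the exterior face e. *)
Definition nb : Type := (cv m + ext m)%type.
Implicit Types x : nb.

Definition is_nb K x : bool :=
  match x with
  | inl L => adjacent K L
  | inr e => (ext_cell e == K) && `[< ext_face e `<=` Gamma_l d >]
  end.

Definition nb_normal K x : 'rV[R]_l :=
  match x with inl L => face_normal K L | inr e => ext_normal e end.

Definition nb_area K x : R :=
  match x with
  | inl L => fine (flat_measure (face_normal K L) (interface K L))
  | inr e => fine (flat_measure (ext_normal e) (ext_face e))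
  end.

Definition nb_dist K x : R :=
  match x with
  | inl L => enorm (center K - center L)
  | inr e => dist_to (center K) (hyperplane (ext_normal e) (ext_offset e))
  end.

Definition tau K x : R := nb_area K x / nb_dist K x.

(* The value at a neighbour of the discrete function u, with value ub on the
   exterior faces in Gamma_l. *)
Definition nb_val (u : cv m -> R) (ub : R) x : R :=
  match x with inl L => u L | inr _ => ub end.

(* The sum ranges over control volumes only. *)
Definition mesh_regular (xi : R) : Prop := forall K,
  \sum_(L | adjacent K L) nb_area K (inl L) * nb_dist K (inl L)
    <= xi * volume K.

End mesh.

Definition p_bnd (a : phase) : R := 0.
Definition s_bnd (a : phase) : R := if a is liq then 1 else 0.

(* 1 / (mean of 1 / rho between a and b) *)
Definition rho_mean (al : phase) (a b : R) : R :=
  if a == b then rho d al a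
  else ((b - a)^-1 * oint (fun z => (rho d al z)^-1) a b)^-1.

Definition pos_part (c : R) : R := Num.max c 0.
Definition neg_part (c : R) : R := Num.max (- c) 0.

Definition upwind_flux (al : phase) (a b c : R) : R :=
  - mob d al b * pos_part c + mob d al a * neg_part c.

Section scheme.
Variables (m : mesh) (N : nat).

(* The time grid has N + 1 steps. *)
Definition dt : R := T_end d / N.+1%:R.
Definition tn (n : nat) : R := n%:R * dt.

Variables p s : phase -> nat -> cv m -> R.
Implicit Types (K : cv m) (L : nb m) (al : phase) (n : nat).

Definition p_nb al n L : R := nb_val (p al n) (p_bnd al) L.
Definition s_nb al n L : R := nb_val (s al n) (s_bnd al) L.

Definition phiK K : R := mean (lebesgue_rV l) (cell K) (phi d).

(* The mean over (t^n, t^{n+1}) x K. *)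
Definition slab_mean (f : R * 'rV[R]_l -> R) n K : R :=
  mean space_time (`]tn n, tn n.+1[ `*` cell K) f.

Definition rhoKL al n K L : R := rho_mean al (p al n K) (p_nb al n L).

Definition gravity_flux al n K : R :=
  \sum_(L | is_nb K L) nb_area K L * rhoKL al n K L ^+ 2 *
    (mob d al (s al n K) * pos_part (dotv (grav d) (nb_normal K L))
     - mob d al (s_nb al n L) * neg_part (dotv (grav d) (nb_normal K L))).

Definition mass_balance al n K : Prop :=
  volume K * phiK K *
      ((rho d al (p al n.+1 K) * s al n.+1 K - rho d al (p al n K) * s al n K)
        / dt)
  + \sum_(L | is_nb K L) tau K L * rhoKL al n.+1 K L *
      upwind_flux al (s al n.+1 K) (s_nb al n.+1 L) (p_nb al n.+1 L - p al n.+1 K)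
  + gravity_flux al n.+1 K
  + volume K * rho d al (p al n.+1 K) * s al n.+1 K * slab_mean (fP d) n K
  = volume K * rho d al (p al n.+1 K) * slab_mean (sI d al) n K
    * slab_mean (fI d) n K.

Record is_solution : Prop := IsSolution {
  init_p : forall al K, p al 0 K = mean (lebesgue_rV l) (cell K) (p0 d al);
  init_s : forall al K, s al 0 K = mean (lebesgue_rV l) (cell K) (s0 d al);
  scheme_mass : forall al n K, (n <= N)%N -> mass_balance al n K;
  scheme_sum : forall n K, (n <= N)%N -> s liq n.+1 K + s gas n.+1 K = 1;
  scheme_pc : forall n K, (n <= N)%N ->
    pc d (s liq n.+1 K) = p gas n.+1 K - p liq n.+1 K
}.

Definition upwind_mob al n K L : R :=
  if p_nb al n L - p al n K <= 0 then mob d al (s al n K)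
  else mob d al (s_nb al n L).

(* delta^{n}_{K|L}(f(s_l)) *)
Definition delta_sl (f : R -> R) n K L : R :=
  f (s_nb liq n L) - f (s liq n K).

End scheme.
End model.

(* Main.v *)
Require Import Defs.
From HB Require Import structures.
From mathcomp Require Import all_boot all_order all_algebra.
From mathcomp Require Import all_classical all_reals all_analysis.
From mathcomp Require Import measurable_realfun ring lra.
(* Here center and adjacent are the notions for meshes. *)
Import Defs.
Import Order.TTheory GRing.Theory Num.Theory.
Import numFieldNormedType.Exports.
Set Implicit Arguments.
Unset Strict Implicit.
Unset Printing Implicit Defensive.
Local Open Scope classical_set_scope.
Local Open Scope ring_scope.

(** The estimates follow from one energy estimate. The mass balance of each phase
    is multiplied by the enthalpy of its pressure, a primitive of 1 / rho, and
    summed over the cells, the phases and the time steps. Because of the choice of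
    the interface density, the diffusion terms become the dissipation, that is, the
    sum of tau * (M_l * (jump of p_l)^2 + M_g * (jump of p_g)^2) with upwind
    mobilities (diffusion_energy). The accumulation terms bound the increment of an
    energy that is bounded from below (cell_energy_increment), because the enthalpies
    and the primitive of pc are concave and because saturations stay in [0, 1]
    (sat_ge0). Three further ingredients are needed.

    On each face, the dissipation controls the squares of the jumps of calB, of the
    global pressure p_l + pbar(s_l), and of pbar and ptilde weighted by the upwind
    mobilities, as well as the pressure jumps weighted by the larger of the two
    mobilities (edge_estimate). This is a case distinction on the signs of the
    pressure jumps: as pc is decreasing, a phase whose pressure jump is the larger one
    is upwinded with the larger of its two mobilities.

    Gravity is bounded, after summation by parts, by a fraction of the dissipation
    and by the sum of area times distance over all faces. The latter is bounded by
    mesh regularity and by the total area of the exterior faces, which depends on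
    Omega only (exterior_area_bound).

    The source terms contain the pressures themselves. These are the global pressure
    up to bounded functions of the saturation, and the global pressure vanishes on
    Gamma_l, so that a discrete Poincare inequality (poincare_L2) bounds it by the
    dissipation. This inequality must be uniform over all admissible meshes with the
    same bound on area times distance. It is derived, by applying it to squares, from
    an L1 inequality with the total variation on the right (poincare_variation),
    which holds on every admissible mesh. For the latter, a value is compared with
    another along a segment: the jumps of the faces crossed bound the difference, and
    the starting points of the translates of a segment that cross a given face fill a
    volume bounded by the area of the face (crossing_estimate). Segments that leave
    Omega through Gamma_l give the inequality on a small set
    (controlled_exit_set), from which it spreads over convex subsets
    (controlled_spread) and, by connectedness, over Omega (controlled_Omega). *)

(** * Lebesgue measure on row vectors: translations *)

Section preliminaries.
Context (R : realType).

Lemma measurable_preim d1 d2 (T1 : measurableType d1) (T2 : measurableType d2)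
    (f : T1 -> T2) (A : set T2) :
  measurable_fun setT f -> measurable A -> measurable (f @^-1` A).
Proof. by move=> mf mA; rewrite -[X in measurable X]setTI; exact: mf. Qed.

Lemma lebesgue_measure_translate (c : R) (A : set (measurableTypeR R)) :
  measurable A -> lebesgue_measure ((fun x => x + c) @^-1` A) = lebesgue_measure A.
Proof.
move=> mA.
have mc : measurable_fun [set: measurableTypeR R]
    ((fun x => x + c) : measurableTypeR R -> measurableTypeR R).
  exact: measurable_funD.
apply/esym; apply: (@lebesgue_measure_unique _ (pushforward lebesgue_measure
  ((fun x => x + c) : measurableTypeR R -> measurableTypeR R))) => //.
move=> _ [[a b] _ <-] /=; rewrite /pushforward.
rewrite (_ : _ @^-1` _ = `](a - c), (b - c)]%classic); last first.
  by apply/seteqP; split=> x /=; rewrite !in_itv/= ltrBlDr lerBrDr.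
by rewrite !lebesgue_measure_itv/= !lte_fin ltrD2r -!EFinB; case: ifP => // _; congr EFin; ring.
Qed.

Lemma measurable_add_rV n (v : 'rV[R]_n) :
  measurable_fun [set: 'rV[R]_n] (fun x => x + v).
Proof.
apply: measurable_fun_rV => i.
rewrite (_ : (fun _ => _) = (fun x : 'rV[R]_n => x 0 i + v 0 i)).
  by apply: measurable_funD => //; exact: measurable_coord.
by apply/funext => x; rewrite mxE.
Qed.

(** By induction on n: a translated product measure agrees with the product
    measure on rectangles, so that uniqueness reduces the claim to dimension
    one. *)
Lemma lebesgue_rV_translate n (v : 'rV[R]_n) (A : set 'rV[R]_n) :
  measurable A -> lebesgue_rV n ((fun x => x + v) @^-1` A) = lebesgue_rV n A.
Proof.
elim: n v A => [|n IH] v A mA.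
  rewrite (_ : _ @^-1` _ = A)//; apply/seteqP.
  by split => x /=; rewrite (_ : x + v = x)//; apply/rowP => -[].
rewrite /= /lebesgue_rV_step /pushforward.
pose t (xy : measurableTypeR R * 'rV[R]_n) : measurableTypeR R * 'rV[R]_n := (xy.1 + v 0 0, xy.2 + (uncons_rV v).2).
have mt : measurable_fun setT t.
  apply/measurable_fun_pairP; split => /=.
    by apply: measurable_funD => //; exact: measurable_fst.
  exact: (measurableT_comp (measurable_add_rV (uncons_rV v).2) measurable_snd).
have consD xy : cons_rV xy + v = cons_rV (t xy).
  rewrite -[v in LHS](_ : cons_rV (uncons_rV v) = v); last first.
    apply/rowP => i; rewrite mxE; case: splitP => j ij; rewrite !mxE.
      by congr (v _ _); apply/val_inj; rewrite /= ij; case: j {ij} => -[].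
    by congr (v _ _); apply/val_inj; rewrite /= ij.
  by apply/rowP => i; rewrite !mxE; case: splitP => j ij; rewrite !mxE.
rewrite (_ : _ @^-1` _ = t @^-1` (cons_rV (n := n) @^-1` A)); last first.
  by apply/seteqP; split => xy /=; rewrite consD.
have mB : measurable (cons_rV (n := n) @^-1` A).
  exact: measurable_preim (@measurable_cons_rV _ _) mA.
apply/esym; apply: (@product_measure_unique _ _ (measurableTypeR R) 'rV[R]_n R
  lebesgue_measure (lebesgue_rV n)
  (pushforward (lebesgue_measure \x lebesgue_rV n)%E t) _ _ mB).
move=> X Y mX mY; rewrite /pushforward.
transitivity ((lebesgue_measure \x lebesgue_rV n)%E
  (((fun x => x + v 0 0) @^-1` X) `*` ((fun x => x + (uncons_rV v).2) @^-1` Y))) => //.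
rewrite product_measure1E//=; last 2 first.
- apply: (@measurable_preim _ _ (measurableTypeR R) (measurableTypeR R)) => //.
  exact: measurable_funD.
- exact: measurable_preim (@measurable_add_rV _ _) mY.
by rewrite lebesgue_measure_translate// IH.
Qed.

End preliminaries.

(** * Tonelli's theorem and affine changes of variables *)

Section tonelli.
Context (R : realType).

Lemma tonelli_sections d1 d2 (T1 : measurableType d1) (T2 : measurableType d2)
    (m1 : {sigma_finite_measure set T1 -> \bar R})
    (m2 : {sigma_finite_measure set T2 -> \bar R}) (P : set (T1 * T2)) :
  measurable P ->
  (\int[m1]_x m2 [set y | P (x, y)] = \int[m2]_y m1 [set x | P (x, y)])%E.
Proof.
move=> mP; have := indic_fubini_tonelli m1 m2 mP.
rewrite indic_fubini_tonelli_FE// indic_fubini_tonelli_GE// => tonelli.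
transitivity (\int[m1]_x (m2 \o xsection P) x)%E.
  by apply: eq_integral => x _ /=; congr (m2 _); apply/seteqP; split=> y;
    rewrite /xsection/= inE.
rewrite tonelli; apply: eq_integral => y _ /=; congr (m1 _).
by apply/seteqP; split=> x; rewrite /ysection/= inE.
Qed.

Lemma integral_indic_cst d (T : measurableType d) (m : {measure set T -> \bar R})
    (A : set T) (c : \bar R) (f : T -> \bar R) : (0 <= c)%E -> measurable A ->
  (forall x, A x -> f x = c) -> (forall x, ~ A x -> f x = 0%E) ->
  (\int[m]_x f x = m A * c)%E.
Proof.
move=> c0 mA fA fNA.
rewrite (eq_integral (fun x => (\1_A x)%:E * c)%E); last first.
  move=> x _; rewrite indicE; have [/set_mem Ax|/negP/= nAx] := boolP (x \in A).
    by rewrite mul1e fA.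
  by rewrite mul0e fNA// => /mem_set.
rewrite ge0_integralZr ?integral_indic ?setIT//; exact: measurableT_comp.
Qed.

Lemma measurable_addv n d (T : measurableType d) (f g : T -> 'rV[R]_n) :
  measurable_fun setT f -> measurable_fun setT g ->
  measurable_fun setT (fun t => f t + g t).
Proof.
move=> mf mg; apply: measurable_fun_rV => i.
rewrite (_ : (fun _ => _) = (fun t => f t 0 i + g t 0 i)); last first.
  by apply/funext => t; rewrite mxE.
by apply: measurable_funD; apply: (measurableT_comp (measurable_coord (n := n) i)).
Qed.

Lemma measurable_oppv n : measurable_fun setT (fun x : 'rV[R]_n => - x).
Proof.
apply: measurable_fun_rV => i.
rewrite (_ : (fun _ => _) = (fun t : 'rV[R]_n => - (t 0 i))); last first.
  by apply/funext => t; rewrite mxE.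
by apply: measurableT_comp => //; exact: measurable_coord.
Qed.

Lemma measurable_scalev n d (T : measurableType d) (f : T -> R) (v : 'rV[R]_n) :
  measurable_fun setT f -> measurable_fun setT (fun t => f t *: v).
Proof.
move=> mf; apply: measurable_fun_rV => i.
rewrite (_ : (fun _ => _) = (fun t => f t * v 0 i)); last first.
  by apply/funext => t; rewrite mxE.
exact: measurable_funM.
Qed.

Lemma measurable_dotv n (a : 'rV[R]_n) : measurable_fun setT (dotv a).
Proof.
rewrite /dotv; apply: measurable_sum => i.
by apply: measurable_funM => //; exact: measurable_coord.
Qed.

Let lam n := @lebesgue_rV R n.

(** The pairs (x, h) with f x in X and f x + h in Y are measured in both
    orders: for a fixed x the admissible h form a translate of Y. *)
Lemma lebesgue_rV_shift_tonelli n (f : 'rV[R]_n -> 'rV[R]_n) (X Y : set 'rV[R]_n) :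
  measurable_fun setT f -> measurable X -> measurable Y ->
  (\int[lam n]_h lam n [set x | X (f x) /\ Y (f x + h)%R] =
   lam n (f @^-1` X) * lam n Y)%E.
Proof.
move=> mf mX mY.
have mP : measurable [set xh : 'rV[R]_n * 'rV[R]_n | X (f xh.1) /\ Y (f xh.1 + xh.2)].
  apply: (measurableI [set xh | X (f xh.1)] [set xh | Y (f xh.1 + xh.2)]).
    exact: measurable_preim (measurableT_comp mf measurable_fst) mX.
  apply: (measurable_preim (f := fun xh : 'rV[R]_n * 'rV[R]_n => f xh.1 + xh.2)) mY.
  apply: measurable_addv; last exact: measurable_snd.
  exact: (measurableT_comp mf measurable_fst).
rewrite -(tonelli_sections (lam n) (lam n) mP)/=.
apply: integral_indic_cst => //.
- exact: measurable_preim mf mX.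
- move=> x /= Xx; rewrite -(@lebesgue_rV_translate R n (f x) Y)//; congr (lam n _).
  by apply/seteqP; split => h /=; rewrite addrC => // -[].
- by move=> x /= nX; rewrite (_ : [set _ | _] = set0)// -subset0 => h [].
Qed.

(** Here f is an affine bijection and g is the inverse of its linear part. The
    substitution of x + g (- h) for x exchanges the roles of X and Y in
    lebesgue_rV_shift_tonelli, up to the sign of h. This replaces the change of
    variables by determinants. *)
Lemma lebesgue_rV_preimage_opp n (f g : 'rV[R]_n -> 'rV[R]_n) (X Y : set 'rV[R]_n) :
  measurable_fun setT f -> (forall x h, f (x + g h) = f x + h) ->
  measurable X -> measurable Y ->
  (lam n (f @^-1` X) * lam n Y = lam n (f @^-1` Y) * lam n (-%R @^-1` X))%E.
Proof.
move=> mf fg mX mY; rewrite -lebesgue_rV_shift_tonelli//.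
have mNX : measurable (-%R @^-1` X) by exact: measurable_preim (@measurable_oppv n) mX.
have mY' h : measurable [set x | X (f x) /\ Y (f x + h)].
  apply: (measurableI (f @^-1` X)); first exact: measurable_preim mf mX.
  apply: (measurable_preim (f := fun x => f x + h)) mY.
  by apply: measurable_addv => //; exact: measurable_cst.
transitivity (\int[lam n]_h lam n [set x | Y (f x) /\ X (f x - h)%R])%E.
  apply: eq_integral => h _.
  rewrite -(@lebesgue_rV_translate R n (g (- h)))//; congr (lam n _).
  apply/seteqP; split => x /=; rewrite fg.
    by rewrite subrK => -[].
  by rewrite subrK => -[].
have mP : measurable [set xh : 'rV[R]_n * 'rV[R]_n | Y (f xh.1) /\ X (f xh.1 - xh.2)].
  apply: (measurableI [set xh | Y (f xh.1)] [set xh | X (f xh.1 - xh.2)]).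
    exact: measurable_preim (measurableT_comp mf measurable_fst) mY.
  apply: (measurable_preim (f := fun xh : 'rV[R]_n * 'rV[R]_n => f xh.1 - xh.2)) mX.
  apply: measurable_addv.
    exact: (measurableT_comp mf measurable_fst).
  exact: (measurableT_comp (@measurable_oppv n) measurable_snd).
rewrite -(tonelli_sections (lam n) (lam n) mP)/=.
apply: integral_indic_cst => //.
- exact: measurable_preim mf mY.
- move=> x /= Yx; rewrite -(@lebesgue_rV_translate R n (- f x) (-%R @^-1` X))//.
  congr (lam n _).
  by apply/seteqP; split => h /=; rewrite opprD opprK addrC => // -[].
- by move=> x /= nX; rewrite (_ : [set _ | _] = set0)// -subset0 => h [].
Qed.

End tonelli.

(** * Dot products, cubes and null sets *)

Section dot_product.
Context (R : realType) (n : nat).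
Implicit Types (a x y eta v : 'rV[R]_n) (S X : set 'rV[R]_n).

Lemma dotvC x y : dotv x y = dotv y x.
Proof. by apply: eq_bigr => i _; rewrite mulrC. Qed.

Lemma dotvDr a x y : dotv a (x + y) = dotv a x + dotv a y.
Proof. by rewrite -big_split/=; apply: eq_bigr => i _; rewrite mxE mulrDr. Qed.

Lemma dotvZr a (t : R) x : dotv a (t *: x) = t * dotv a x.
Proof. by rewrite mulr_sumr; apply: eq_bigr => i _; rewrite mxE mulrCA. Qed.

Lemma dotvNr a x : dotv a (- x) = - dotv a x.
Proof. by rewrite -scaleN1r dotvZr mulN1r. Qed.

Lemma dotvBr a x y : dotv a (x - y) = dotv a x - dotv a y.
Proof. by rewrite dotvDr dotvNr. Qed.

Lemma dotv0r a : dotv a 0 = 0.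
Proof. by rewrite -(scale0r 0) dotvZr mul0r. Qed.

Lemma dotvZl a (t : R) x : dotv (t *: a) x = t * dotv a x.
Proof. by rewrite dotvC dotvZr dotvC. Qed.

Lemma dotvBl a y x : dotv (a - y) x = dotv a x - dotv y x.
Proof. by rewrite dotvC dotvBr !(dotvC x). Qed.

Lemma dotvNl a x : dotv (- a) x = - dotv a x.
Proof. by rewrite dotvC dotvNr dotvC. Qed.

Lemma dotv0l x : dotv 0 x = 0.
Proof. by rewrite dotvC dotv0r. Qed.

Lemma dotvv_ge0 x : 0 <= dotv x x.
Proof. by apply: sumr_ge0 => i _; rewrite -expr2 sqr_ge0. Qed.

Lemma dotvv_eq0 x : (dotv x x == 0) = (x == 0).
Proof.
apply/idP/eqP => [|->]; last by rewrite dotv0r.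
rewrite psumr_eq0 => [/allP x0|i _]; last by rewrite -expr2 sqr_ge0.
apply/rowP => i; rewrite mxE; apply/eqP.
by rewrite -[_ == _]orbb -mulf_eq0; apply: x0; rewrite mem_index_enum.
Qed.

Lemma dotvv_gt0 x : x != 0 -> 0 < dotv x x.
Proof. by rewrite -dotvv_eq0 => x0; rewrite lt_def x0 dotvv_ge0. Qed.

Lemma enorm1 eta : enorm eta = 1 -> dotv eta eta = 1.
Proof. by move=> h; rewrite -(sqr_sqrtr (dotvv_ge0 eta)) -/(enorm eta) h expr1n. Qed.

Lemma dotv_le_enorm eta x : enorm eta = 1 -> `|dotv eta x| <= enorm x.
Proof.
move=> /enorm1 e1; rewrite -sqrtr_sqr ler_sqrt ?dotvv_ge0//.
have := dotvv_ge0 (x - dotv eta x *: eta).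
rewrite dotvBr !dotvBl !dotvZr !dotvZl e1 (dotvC x eta) expr2; lra.
Qed.

Lemma enorm_ge0 x : 0 <= enorm x.
Proof. exact: sqrtr_ge0. Qed.

Lemma unit_coord_le1 eta i : enorm eta = 1 -> `|eta 0 i| <= 1.
Proof.
move=> /enorm1 e1; rewrite -(@ler_pXn2r _ 2)// ?nnegrE// expr1n -e1 /dotv.
rewrite real_normK ?num_real// (bigD1 i)//= expr2 lerDl.
by apply: sumr_ge0 => j _; rewrite -expr2 sqr_ge0.
Qed.

Lemma dotv_norm_le (A B : R) x y : (forall i, `|x 0 i| <= A) ->
  (forall i, `|y 0 i| <= B) -> `|dotv x y| <= n%:R * (A * B).
Proof.
move=> xA yB; rewrite (le_trans (ler_norm_sum _ _ _))//.
rewrite (le_trans (ler_sum _ (_ : forall i, true -> _ <= A * B)))//.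
  by move=> i _; rewrite normrM ler_pM.
by rewrite sumr_const card_ord mulr_natl.
Qed.

Lemma enorm_bound (A : R) x : (forall i, `|x 0 i| <= A) ->
  enorm x <= Num.sqrt (n%:R * (A * A)).
Proof.
move=> xA; rewrite /enorm ler_sqrt; last first.
  by rewrite mulr_ge0// -expr2 sqr_ge0.
by rewrite (le_trans (ler_norm _))// dotv_norm_le.
Qed.

End dot_product.

Section measure_rV.
Context (R : realType) (n : nat).
Implicit Types (a x y eta v c : 'rV[R]_n) (S X : set 'rV[R]_n).
Let lam := @lebesgue_rV R n.

Definition cube c (r : R) : set 'rV[R]_n :=
  [set x | forall i, c 0 i - r <= x 0 i <= c 0 i + r].

Lemma measurable_all (P : 'I_n -> set 'rV[R]_n) : (forall i, measurable (P i)) ->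
  measurable [set x | forall i, P i x].
Proof.
move=> mP; rewrite (_ : [set _ | _] = \bigcap_(i in [set: 'I_n]) P i).
  by apply: fin_bigcap_measurable => //; exact: finite_finset.
by apply/seteqP; split => x /= h i => [_|]; apply: h.
Qed.

Lemma measurable_cube c r : measurable (cube c r).
Proof.
apply: measurable_all => i.
rewrite [X in measurable X](_ : _ = (fun x : 'rV[R]_n => x 0 i) @^-1`
    `[c 0 i - r, c 0 i + r]%classic).
  by apply: measurable_preim (measurable_coord i) _; exact: measurable_itv.
by apply/seteqP; split => x /=; rewrite in_itv.
Qed.

Lemma lebesgue_cube c r : 0 <= r -> lam (cube c r) = ((2 * r) ^+ n)%:E.
Proof.
move=> r0; transitivity (lam [set x | forall i, (c - const_mx r) 0 i <= x 0 i
    <= (c + const_mx r) 0 i]).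
  congr (lam _); apply/seteqP; split => x /= h i; have := h i; by rewrite !mxE.
rewrite [LHS]lebesgue_rV_box => [|i]; last by rewrite !mxE; lra.
congr EFin; rewrite (eq_bigr (fun=> 2 * r)) ?prodr_const ?card_ord// => i _.
by rewrite !mxE; ring.
Qed.

Lemma lebesgue_cube_half : lam (cube 0 (2^-1)) = 1%E.
Proof. by rewrite lebesgue_cube ?invr_ge0// divff ?expr1n. Qed.

Lemma lebesgue_rV_opp X : measurable X -> lam (-%R @^-1` X) = lam X.
Proof.
move=> mX; have := @lebesgue_rV_preimage_opp R n id id X (cube 0 2^-1).
rewrite preimage_id lebesgue_cube_half mule1 mul1e => -> //.
exact: measurable_cube.
Qed.

(** The factor is the inverse of the Jacobian of f, read off on the unit
    cube. *)
Lemma lebesgue_rV_affine (f g : 'rV[R]_n -> 'rV[R]_n) X :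
  measurable_fun setT f -> (forall x h, f (x + g h) = f x + h) ->
  measurable X ->
  lam (f @^-1` X) = (lam (f @^-1` cube 0 2^-1) * lam X)%E.
Proof.
move=> mf fg mX; have := lebesgue_rV_preimage_opp mf fg mX (measurable_cube 0 2^-1).
by rewrite lebesgue_cube_half mule1 lebesgue_rV_opp.
Qed.

Lemma lebesgue_rV_setT_gt0 : (0 < lam setT)%E.
Proof.
have : (lam (cube 0 2^-1) <= lam setT)%E.
  by apply: le_measure; rewrite ?inE//; exact: measurable_cube.
by apply: lt_le_trans; rewrite lebesgue_cube_half.
Qed.

(** Tonelli's theorem on the pairs (x, s) with x + s v in X: the sections in s
    have at most one point, and the sections in x all have the measure of X,
    integrated over a line of infinite length. *)
Lemma lebesgue_rV_line_null v X : measurable X ->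
  (forall x s t, X (x + s *: v) -> X (x + t *: v) -> s = t) -> lam X = 0%E.
Proof.
move=> mX Xv.
have mP : measurable [set xs : 'rV[R]_n * measurableTypeR R | X (xs.1 + xs.2 *: v)].
  apply: (measurable_preim
    (f := fun xs : 'rV[R]_n * measurableTypeR R => xs.1 + xs.2 *: v)) mX.
  apply: measurable_addv; first exact: measurable_fst.
  by apply: measurable_scalev; exact: measurable_snd.
have := tonelli_sections lam (@lebesgue_measure R) mP.
rewrite integral0_eq => [|x _ /=]; last first.
  have [[s Xs]|/forallNP nX] := pselect (exists s, X (x + s *: v)).
    rewrite (_ : [set _ | _] = [set s]) ?lebesgue_measure_set1//.
    by apply/seteqP; split => [t /= Xt|t /= -> //]; exact: Xv Xt Xs.
  by rewrite (_ : [set _ | _] = set0)// -subset0 => s /= /nX.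
under eq_integral do rewrite (lebesgue_rV_translate (_ *: v) mX).
rewrite integral_cst//=; have [->//|] := eqVneq (lam X) 0%E.
move=> X0 /esym/eqP; rewrite mule_eq0 (negbTE X0)/=.
by rewrite -set_itvNyy lebesgue_measure_itv.
Qed.

Lemma measurable_hyperplane a b : measurable (hyperplane a b).
Proof.
rewrite (_ : hyperplane a b = dotv a @^-1` [set b])//.
exact: measurable_preim (@measurable_dotv _ _ a) _.
Qed.

Lemma hyperplane_null a b : a != 0 -> lam (hyperplane a b) = 0%E.
Proof.
move=> a0; apply: (@lebesgue_rV_line_null a); first exact: measurable_hyperplane.
move=> x s t; rewrite /hyperplane/= !dotvDr !dotvZr => <- /addrI.
by move/(mulIf _) => ->//; rewrite gt_eqF// dotvv_gt0.
Qed.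

Lemma sub_null X Y : measurable X -> measurable Y -> X `<=` Y ->
  lam Y = 0%E -> lam X = 0%E.
Proof. by move=> mX mY XY Y0; apply: (subset_measure0 mX mY XY). Qed.

End measure_rV.

(** * Prisms and the area of flat sets *)

Section prism.
Context (R : realType) (n : nat).
Implicit Types (a x y eta v c : 'rV[R]_n) (S X : set 'rV[R]_n) (b : R).
Let lam := @lebesgue_rV R n.

(** For a unit normal v, the volume of prism S v is the area of S; other
    directions occur because segments cross S obliquely. *)
Definition prism S v : set 'rV[R]_n :=
  [set x | exists y (t : R), [/\ S y, 0 <= t <= 1 & x = y + t *: v]].

Lemma flat_measureE eta S : flat_measure eta S = lam (prism S eta).
Proof. by []. Qed.

Lemma prism_subset S S' v : S `<=` S' -> prism S v `<=` prism S' v.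
Proof. by move=> SS' x [y [t [Sy t01 ->]]]; exists y, t; split => //; exact: SS'. Qed.

Lemma prismE S v eta b : S `<=` hyperplane eta b -> dotv eta v != 0 ->
  let tau x := (dotv eta x - b) / dotv eta v in
  prism S v = [set x | 0 <= tau x <= 1 /\ S (x - tau x *: v)].
Proof.
move=> Sb ev0 tau; apply/seteqP; split => x.
  move=> [y [t [Sy t01 ->]]] /=.
  have -> : tau (y + t *: v) = t.
    by rewrite /tau dotvDr dotvZr (Sb _ Sy) addrAC subrr add0r mulfK.
  by rewrite addrK.
by move=> [t01 Sx]; exists (x - tau x *: v), (tau x); rewrite subrK.
Qed.

Lemma measurable_prism S v eta b : S `<=` hyperplane eta b -> dotv eta v != 0 ->
  measurable S -> measurable (prism S v).
Proof.
move=> Sb ev0 mS; rewrite (prismE Sb ev0).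
set tau := fun x : 'rV[R]_n => (dotv eta x - b) / dotv eta v.
have mtau : measurable_fun setT tau.
  apply: measurable_funM => //; apply: measurable_funB => //.
  exact: measurable_dotv.
apply: (measurableI (tau @^-1` [set` `[0, 1]]) [set x | S (x - tau x *: v)]).
  exact: measurable_preim mtau (measurable_itv _).
apply: (measurable_preim (f := fun x => x - tau x *: v)) mS.
apply: measurable_addv; first exact: measurable_id.
rewrite (_ : (fun _ => _) = (fun x => (- tau x) *: v)); last first.
  by apply/funext => x; rewrite scaleNr.
by apply: measurable_scalev; exact: measurableT_comp.
Qed.

Lemma measurable_flat_prism S eta b : enorm eta = 1 -> S `<=` hyperplane eta b ->
  measurable S -> measurable (prism S eta).
Proof.
by move=> e1 Sb; apply: (measurable_prism Sb); rewrite enorm1// oner_eq0.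
Qed.

(** Fixes the hyperplane of S and maps prism S v onto prism S eta. *)
Let shear eta v b x := x + ((dotv eta x - b) / dotv eta v) *: (eta - v).

Let shear_add eta v b x h : enorm eta = 1 -> dotv eta v != 0 ->
  shear eta v b (x + (h + dotv eta h *: (v - eta))) = shear eta v b x + h.
Proof.
move=> /enorm1 e1 ev0; rewrite /shear.
have -> : (dotv eta (x + (h + dotv eta h *: (v - eta))) - b) / dotv eta v =
   (dotv eta x - b) / dotv eta v + dotv eta h.
  by rewrite !dotvDr dotvZr dotvBr e1; field.
by rewrite scalerDl -[v - eta]opprB scalerN; apply/rowP => i; rewrite !mxE; ring.
Qed.

Let measurable_shear eta v b : measurable_fun setT (shear eta v b).
Proof.
apply: measurable_addv; first exact: measurable_id.
apply: measurable_scalev; apply: measurable_funM => //.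
by apply: measurable_funB => //; exact: measurable_dotv.
Qed.

Let prism_shear S eta v b : enorm eta = 1 -> S `<=` hyperplane eta b ->
  dotv eta v != 0 -> prism S v = shear eta v b @^-1` prism S eta.
Proof.
move=> e1 Sb ev0; have ee := enorm1 e1.
rewrite (prismE Sb ev0) (prismE Sb) ?ee ?oner_eq0//.
have tauE x : (dotv eta (shear eta v b x) - b) / 1 = (dotv eta x - b) / dotv eta v.
  by rewrite /shear dotvDr dotvZr dotvBr ee; field.
have shE x (t := (dotv eta x - b) / dotv eta v) :
    shear eta v b x - t *: eta = x - t *: v.
  by rewrite /shear -/t; apply/rowP => i; rewrite !mxE; ring.
by apply/seteqP; split => x /=; rewrite tauE shE.
Qed.

Let prism_jacobian S eta v b : enorm eta = 1 -> S `<=` hyperplane eta b ->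
  dotv eta v != 0 -> measurable S ->
  lam (prism S v) = (lam (shear eta v b @^-1` cube 0 2^-1) * flat_measure eta S)%E.
Proof.
move=> e1 Sb ev0 mS; rewrite flat_measureE (prism_shear e1 Sb ev0).
apply: (lebesgue_rV_affine (g := fun h => h + dotv eta h *: (v - eta))).
- exact: measurable_shear.
- by move=> x h; rewrite shear_add.
- exact: measurable_flat_prism e1 Sb mS.
Qed.

(** The shear distorts volumes at most by the volume of a cube containing the
    preimage of the unit cube. When v is parallel to the hyperplane of S, the
    shear does not exist, but the prism lies in that null hyperplane; this is
    why the bound is on a measurable set Z covering the prism. *)
Lemma prism_le_flat S eta v b (D : R) : 0 <= D -> enorm eta = 1 ->
  S `<=` hyperplane eta b -> measurable S -> (forall i, `|v 0 i| <= D) ->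
  exists Z, [/\ measurable Z, prism S v `<=` Z &
   (lam Z <= ((2 * (1 + n%:R * (D + 1))) ^+ n)%:E * flat_measure eta S)%E].
Proof.
move=> D0 e1 Sb mS vD.
have eta0 : eta != 0.
  apply/eqP => eta0; move: e1; rewrite /enorm eta0 dotv0l sqrtr0 => /esym/eqP.
  by rewrite oner_eq0.
have r0 : 0 <= 1 + n%:R * (D + 1) by rewrite addr_ge0// mulr_ge0// addr_ge0.
have [ev0|ev0] := eqVneq (dotv eta v) 0.
  exists (hyperplane eta b); split; first exact: measurable_hyperplane.
    move=> _ [y [t [Sy _ ->]]]; rewrite /hyperplane/= dotvDr dotvZr ev0 mulr0 addr0.
    exact: Sb.
  rewrite [lam _]hyperplane_null// mule_ge0 ?lee_fin ?exprn_ge0 ?mulr_ge0//.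
exists (prism S v); split => //; first exact: measurable_prism Sb ev0 mS.
rewrite (prism_jacobian e1 Sb)// flat_measureE lee_wpmul2r//.
set r := 1 + _; pose c := - b *: (v - eta).
rewrite -(lebesgue_cube c r0); apply: le_measure; rewrite ?inE.
- exact: measurable_preim (@measurable_shear _ _ _) (measurable_cube _ _).
- exact: measurable_cube.
move=> x /= /(_ _)Hz i; set z := shear eta v b x in Hz.
have xE : x = z + (dotv eta z - b) *: (v - eta).
  have ze : dotv eta z = b + (dotv eta x - b) / dotv eta v.
    by rewrite /z /shear dotvDr dotvZr dotvBr (enorm1 e1); field.
  rewrite ze /z /shear; set t := _ / _.
  by apply/rowP => k; rewrite !mxE; ring.
have zb k : `|z 0 k| <= 1.
  have := Hz k; rewrite [X in X - _]mxE [X in _ <= X + _]mxE => /andP[h1 h2]; rewrite ler_norml.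
  by apply/andP; split; lra.
rewrite -ler_distl.
rewrite (_ : x 0 i - c 0 i = z 0 i + dotv eta z * (v 0 i - eta 0 i)); last by rewrite xE /c !mxE; ring.
rewrite (le_trans (ler_normD _ _))// lerD// normrM.
rewrite -[n%:R]mulr1 ler_pM//.
  have := dotv_norm_le (fun k => unit_coord_le1 k e1) zb.
  by rewrite !mulr1.
by rewrite (le_trans (ler_normB _ _))// lerD// unit_coord_le1.
Qed.

(** The Jacobian of the shear is not zero, otherwise the preimage of the whole
    space would be null. *)
Lemma prism_gt0 S eta v b : enorm eta = 1 -> S `<=` hyperplane eta b ->
  dotv eta v != 0 -> measurable S -> (0 < flat_measure eta S)%E ->
  (0 < lam (prism S v))%E.
Proof.
move=> e1 Sb ev0 mS S0; rewrite (prism_jacobian e1 Sb)// mule_gt0//.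
have : lam (shear eta v b @^-1` setT) =
   (lam (shear eta v b @^-1` cube 0 2^-1) * lam setT)%E.
  apply: (lebesgue_rV_affine (g := fun h => h + dotv eta h *: (v - eta))) => //.
  by move=> x h; rewrite shear_add.
rewrite preimage_setT lt0e => lamT; rewrite measure_ge0 andbT; apply/eqP => l0.
by have := @lebesgue_rV_setT_gt0 R n; rewrite -/lam lamT l0 mul0e ltxx.
Qed.

Lemma flat_measure_le S S' eta b : enorm eta = 1 -> S' `<=` hyperplane eta b ->
  measurable S -> measurable S' -> S `<=` S' ->
  (flat_measure eta S <= flat_measure eta S')%E.
Proof.
move=> e1 Sb mS mS' SS'; rewrite !flat_measureE; apply: le_measure.
- by rewrite inE; apply: measurable_flat_prism e1 _ mS; exact: subset_trans Sb.
- by rewrite inE; apply: measurable_flat_prism e1 Sb mS'.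
- exact: prism_subset.
Qed.

(** The prisms over S in the directions eta and - eta are translates of each
    other. *)
Lemma flat_measureN S eta b : enorm eta = 1 -> S `<=` hyperplane eta b ->
  measurable S -> flat_measure (- eta) S = flat_measure eta S.
Proof.
move=> e1 Sb mS; rewrite !flat_measureE.
rewrite -(lebesgue_rV_translate eta (measurable_flat_prism e1 Sb mS)).
congr (lam _); apply/seteqP; split => x /=.
  move=> [y [t [Sy /andP[t0 t1] ->]]] /=; exists y, (1 - t); split => //.
    by apply/andP; split; lra.
  by apply/rowP => i; rewrite !mxE; ring.
move=> [y [t [Sy /andP[t0 t1] xE]]] /=; exists y, (1 - t); split => //.
  by apply/andP; split; lra.
have -> : x = y + t *: eta - eta by rewrite -xE addrK.
by apply/rowP => i; rewrite !mxE; ring.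
Qed.

End prism.

(** * Topology of row vectors *)

Section topology_rV.
Context (R : realType) (n : nat).
Implicit Types (a x y v c : 'rV[R]_n) (S X U : set 'rV[R]_n) (b : R).
Let lam := @lebesgue_rV R n.

Lemma nbhs_cube x U : nbhs x U <-> exists2 r : R, 0 < r & cube x r `<=` U.
Proof.
split.
  move=> /nbhs_ballP[e /= e0 eU]; exists (e / 2); first by rewrite divr_gt0.
  move=> y xy; apply: eU; split => // i j; rewrite !ord1.
  have /andP[h1 h2] := xy j.
  by rewrite /ball/= ltr_distl; apply/andP; split; lra.
move=> [r r0 rU]; apply/nbhs_ballP; exists r => //= y [_ xy]; apply: rU => i.
have := xy 0 i; rewrite /ball/= distrC ltr_distl => /andP[h1 h2].
by apply/andP; split; apply: ltW.
Qed.

Lemma open_cubeP U : open U <-> forall x, U x -> exists2 r : R, 0 < r & cube x r `<=` U.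
Proof.
rewrite openE; split => [oU x /oU/nbhs_cube//|oU x Ux].
by apply/nbhs_cube; exact: oU.
Qed.

Lemma cube_le x (r s : R) : r <= s -> cube x r `<=` cube x s.
Proof. by move=> rs y xy i; have /andP[h1 h2] := xy i; apply/andP; split; lra. Qed.

Lemma open_gt0 U : open U -> measurable U -> U !=set0 -> (0 < lam U)%E.
Proof.
move=> /open_cubeP oU mU [x /oU[r r0 rU]].
apply: (@lt_le_trans _ _ (lam (cube x r))).
  by rewrite [lam _]lebesgue_cube ?ltW// lte_fin exprn_gt0// mulr_gt0.
by apply: le_measure => //; rewrite inE//; exact: measurable_cube.
Qed.

Lemma rat_cube x (r : R) : 0 < r ->
  exists q : 'rV[rat]_n, cube (map_mx ratr q) r x.
Proof.
move=> r0; have /choice[q qP] : forall i : 'I_n, exists q : rat,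
    x 0 i - r <= ratr q <= x 0 i + r.
  move=> i; have [q] : exists q : rat, ratr q \in `](x 0 i - r), (x 0 i + r)[.
    by apply: rat_in_itvoo; lra.
  by rewrite in_itv/= => /andP[h1 h2]; exists q; rewrite !ltW.
exists (\row_i q i) => i; rewrite !mxE; have /andP[h1 h2] := qP i.
by apply/andP; split; lra.
Qed.

(** An open set is the union of the rational cubes with radius 1 / (k + 1) that
    it contains. *)
Lemma open_measurable_rV U : open U -> measurable U.
Proof.
move=> /open_cubeP oU.
pose C (qk : 'rV[rat]_n * nat) : set 'rV[R]_n :=
  cube (map_mx ratr qk.1) (qk.2.+1%:R^-1).
pose F qk := if `[< C qk `<=` U >] then C qk else set0.
rewrite (_ : U = \bigcup_qk F qk).
  apply: countable_bigcupT_measurable; first exact: countableP.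
  by move=> qk; rewrite /F; case: ifP => // _; exact: measurable_cube.
apply/seteqP; split => [x Ux|x [qk _]]; last first.
  by rewrite /F; case: ifPn => // /asboolP; exact.
have [r r0 rU] := oU x Ux.
have [k kr] : exists k : nat, k.+1%:R^-1 <= r / 2.
  have := near_infty_natSinv_lt (PosNum (divr_gt0 r0 (ltr0n R 2))) => /= -[k _ kr].
  by exists k; apply/ltW/kr => /=.
have [q qx] := @rat_cube x k.+1%:R^-1 (ltac:(by rewrite invr_gt0)).
exists (q, k) => //; rewrite /F; case: ifPn => // /asboolPn[].
move=> y qy; apply: rU => i; have := qx i; have := qy i => /=.
move: kr; move: (k.+1%:R^-1) (map_mx _ _ _ _) => e z ke.
by move=> /andP[h1 h2] /andP[h3 h4]; apply/andP; split; lra.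
Qed.

Lemma bounded_cube X : bounded_set X -> exists2 M : R, 0 < M & X `<=` cube 0 M.
Proof.
move=> [M0 [_ XM]]; exists (Num.max M0 0 + 1) => [|x Xx i].
  by rewrite ltr_wpDl// le_max lexx orbT.
have /XM/(_ x Xx) : M0 < Num.max M0 0 + 1 by rewrite ltr_pwDr// le_max lexx.
rewrite /Num.Def.normr/= mx_normrE => xM.
rewrite mxE -ler_distl subr0; apply: le_trans xM.
exact: (le_bigmax _ (fun ij => `|x ij.1 ij.2|) (0, i)).
Qed.

Lemma dotv_continuous a : continuous (dotv a).
Proof.
move=> x; rewrite /dotv; elim: (index_enum _) => [|i s IHs].
  rewrite (_ : (fun _ => _) = cst 0); first exact: cst_continuous.
  by apply/funext => y; rewrite big_nil.
rewrite (_ : (fun _ => _) = (fun y => a 0 i * y 0 i) \+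
    (fun y => \sum_(j <- s) a 0 j * y 0 j)); last first.
  by apply/funext => y; rewrite big_cons.
apply: continuousD => //.
by apply: continuousM; [exact: cst_continuous|exact: coord_continuous].
Qed.

Lemma open_halfspace a b : open [set x | dotv a x < b].
Proof.
rewrite (_ : [set _ | _] = dotv a @^-1` [set t | t < b])//.
by apply: open_comp => [x _|]; [exact: dotv_continuous|exact: open_lt].
Qed.

Lemma closed_halfspace a b : closed [set x | dotv a x <= b].
Proof.
rewrite (_ : [set _ | _] = dotv a @^-1` [set t | t <= b])//.
by apply: preimage_closed; [move=> x _; exact: dotv_continuous|exact: closed_le].
Qed.

Lemma closed_hyperplane a b : closed (hyperplane a b).
Proof.
rewrite (_ : hyperplane a b = dotv a @^-1` [set t | t = b])//.
by apply: preimage_closed; [move=> x _; exact: dotv_continuous|exact: closed_eq].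
Qed.

Lemma closed_measurable_rV X : closed X -> measurable X.
Proof.
by move=> cX; rewrite -(setCK X); apply: measurableC; apply: open_measurable_rV; exact: closed_openC.
Qed.

End topology_rV.

(** * Convex polyhedra *)

Section polyhedra.
Context (R : realType) (n : nat).
Implicit Types (a x y z eta v c : 'rV[R]_n) (S X I : set 'rV[R]_n) (b : R).
Implicit Types (hs : seq ('rV[R]_n * R)) (h : 'rV[R]_n * R).
Let lam := @lebesgue_rV R n.

Definition open_polyhedron hs : set 'rV[R]_n :=
  [set x | forall h, h \in hs -> dotv h.1 x < h.2].

(** A constraint with zero normal then holds strictly everywhere, so that the
    polyhedron is bounded by hyperplanes only. *)
Definition nondegenerate hs := forall h, h \in hs -> h.1 = 0 -> 0 < h.2.

Definition hyperplane_union hs : set 'rV[R]_n :=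
  [set x | exists2 h, h \in hs & h.1 != 0 /\ dotv h.1 x = h.2].

Lemma open_polyhedron_nondegenerate hs : open_polyhedron hs !=set0 -> nondegenerate hs.
Proof. by move=> [x hx] h /hx + h0; rewrite h0 dotv0l. Qed.

Lemma open_polyhedron_cons h hs : open_polyhedron (h :: hs) =
  [set x | dotv h.1 x < h.2] `&` open_polyhedron hs.
Proof.
apply/seteqP; split => [x hx|x [hx hsx] k].
  split; first by apply: hx; rewrite mem_head.
  by move=> k khs; apply: hx; rewrite inE khs orbT.
by rewrite inE => /orP[/eqP ->//|/hsx].
Qed.

Lemma closed_polyhedron_cons h hs : closed_polyhedron (h :: hs) =
  [set x | dotv h.1 x <= h.2] `&` closed_polyhedron hs.
Proof.
apply/seteqP; split => [x hx|x [hx hsx] k].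
  split; first by apply: hx; rewrite mem_head.
  by move=> k khs; apply: hx; rewrite inE khs orbT.
by rewrite inE => /orP[/eqP ->//|/hsx].
Qed.

Lemma open_polyhedron_open hs : open (open_polyhedron hs).
Proof.
elim: hs => [|h hs IH].
  by rewrite (_ : open_polyhedron _ = setT); [exact: openT|rewrite -subTset].
by rewrite open_polyhedron_cons; apply: openI => //; exact: open_halfspace.
Qed.

Lemma closed_polyhedron_closed hs : closed (closed_polyhedron hs).
Proof.
elim: hs => [|h hs IH].
  by rewrite (_ : closed_polyhedron _ = setT); [exact: closedT|rewrite -subTset].
by rewrite closed_polyhedron_cons; apply: closedI => //; exact: closed_halfspace.
Qed.

Lemma open_polyhedronW hs : open_polyhedron hs `<=` closed_polyhedron hs.
Proof. by move=> x hx h /hx/ltW. Qed.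

Lemma open_polyhedron_mix hs x y (t : R) : closed_polyhedron hs y ->
  open_polyhedron hs x -> 0 < t -> t <= 1 ->
  open_polyhedron hs ((1 - t) *: y + t *: x).
Proof.
move=> hy hx t0 t1 h hhs; rewrite dotvDr !dotvZr.
have := hy h hhs; have := hx h hhs => hxh hyh.
apply: (@lt_le_trans _ _ ((1 - t) * h.2 + t * h.2)); last lra.
by rewrite ler_ltD// ?ler_wpM2l ?ltr_pM2l//; lra.
Qed.

Lemma closed_polyhedron_mix hs x y (t : R) : closed_polyhedron hs y ->
  closed_polyhedron hs x -> 0 <= t -> t <= 1 ->
  closed_polyhedron hs ((1 - t) *: y + t *: x).
Proof.
move=> hy hx t0 t1 h hhs; rewrite dotvDr !dotvZr.
have := hy h hhs; have := hx h hhs => hxh hyh.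
apply: (@le_trans _ _ ((1 - t) * h.2 + t * h.2)); last lra.
by rewrite lerD// ler_wpM2l//; lra.
Qed.

Lemma closure_open_polyhedron hs : open_polyhedron hs !=set0 ->
  closure (open_polyhedron hs) = closed_polyhedron hs.
Proof.
move=> [x hx]; apply/seteqP; split => [|y hy].
  rewrite [X in _ `<=` X](iffLR (closure_id _) (@closed_polyhedron_closed hs)).
  exact/closure_subset/open_polyhedronW.
move=> B /nbhs_cube[r r0 rB].
have [M M0 xM] : exists2 M : R, 0 < M & forall i, `|x 0 i - y 0 i| <= M.
  exists (\sum_i `|x 0 i - y 0 i| + 1) => [|i].
    by rewrite ltr_wpDl// sumr_ge0.
  by rewrite (bigD1 i)//= -addrA lerDl addr_ge0// sumr_ge0.
pose t := Num.min 1 (r / M).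
have t0 : 0 < t by rewrite lt_min ltr01 divr_gt0.
exists ((1 - t) *: y + t *: x); split.
  by apply: open_polyhedron_mix => //; rewrite ge_min lexx.
apply: rB => i; rewrite -ler_distl !mxE.
rewrite (_ : _ - _ = t * (x 0 i - y 0 i)); last by ring.
rewrite normrM gtr0_norm// (le_trans (ler_wpM2l (ltW t0) (xM i)))//.
by rewrite -ler_pdivlMr// ge_min lexx orbT.
Qed.

Lemma closed_hyperplane_union hs : closed (hyperplane_union hs).
Proof.
elim: hs => [|h hs IH].
  rewrite (_ : hyperplane_union _ = set0); first exact: closed0.
  by rewrite -subset0 => x [].
have [h0|h0] := eqVneq h.1 0.
  rewrite (_ : hyperplane_union _ = hyperplane_union hs)//; apply/seteqP; split.
    by move=> x [k]; rewrite inE => /orP[/eqP->|khs kx]; [rewrite h0 eqxx => -[]|exists k].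
  by move=> x [k khs kx]; exists k => //; rewrite inE khs orbT.
rewrite (_ : hyperplane_union _ = hyperplane h.1 h.2 `|` hyperplane_union hs).
  by apply: closedU => //; exact: closed_hyperplane.
apply/seteqP; split => x.
  by move=> [k]; rewrite inE => /orP[/eqP-> [_ kx]|khs kx]; [left|right; exists k].
by move=> [hx|[k khs kx]]; [exists h; rewrite ?mem_head|exists k; rewrite ?inE ?khs ?orbT].
Qed.

Lemma hyperplane_union_null hs : lam (hyperplane_union hs) = 0%E.
Proof.
elim: hs => [|h hs IH].
  rewrite (_ : hyperplane_union _ = set0); first exact: measure0.
  by rewrite -subset0 => x [].
have m1 : measurable (hyperplane_union hs).
  by apply: closed_measurable_rV; exact: closed_hyperplane_union.
have [h0|h0] := eqVneq h.1 0.
  rewrite (_ : hyperplane_union _ = hyperplane_union hs)//; apply/seteqP; split.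
    by move=> x [k]; rewrite inE => /orP[/eqP->|khs kx]; [rewrite h0 eqxx => -[]|exists k].
  by move=> x [k khs kx]; exists k => //; rewrite inE khs orbT.
apply: (@sub_null _ _ _ (hyperplane h.1 h.2 `|` hyperplane_union hs)).
- by apply: closed_measurable_rV; exact: closed_hyperplane_union.
- by apply: measurableU => //; exact: measurable_hyperplane.
- move=> x.
  by move=> [k]; rewrite inE => /orP[/eqP-> [_ kx]|khs kx]; [left|right; exists k].
- by rewrite null_set_setU//; [exact: measurable_hyperplane|exact: hyperplane_null].
Qed.

Lemma polyhedron_boundary hs : nondegenerate hs ->
  closed_polyhedron hs `\` open_polyhedron hs `<=` hyperplane_union hs.
Proof.
move=> nd x [cx ox]; apply: contrapT => nx; apply: ox => h hhs.
rewrite lt_neqAle cx// andbT; apply/eqP => xh; apply: nx; exists h => //.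
split=> //; apply/eqP => h0; have := nd h hhs h0.
by rewrite -xh h0 dotv0l ltxx.
Qed.

(** By averaging: the midpoint of two points of I satisfies strictly every
    constraint that one of them satisfies strictly. *)
Lemma common_strict_point hs I :
  (forall x y, I x -> I y -> I (2^-1 *: x + 2^-1 *: y)) -> I !=set0 ->
  I `<=` closed_polyhedron hs ->
  (forall h, h \in hs -> exists2 x, I x & dotv h.1 x < h.2) ->
  exists2 x, I x & open_polyhedron hs x.
Proof.
move=> cI [z Iz]; elim: hs => [|h hs IH] Ihs sI; first by exists z.
have [|k khs|x Ix xo] := IH; first by move: Ihs; rewrite closed_polyhedron_cons => + y Iy => /(_ y Iy)[].
  by apply: sI; rewrite inE khs orbT.
have [y Iy yh] := sI h (mem_head _ _).
exists (2^-1 *: x + 2^-1 *: y); first exact: cI.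
move=> k khs; rewrite dotvDr !dotvZr.
have xk := Ihs _ Ix _ khs; have yk := Ihs _ Iy _ khs.
move: khs xk yk; rewrite inE => /orP[/eqP->|/xo xk _ yk]; first by move=> xk _; lra.
by lra.
Qed.

(** If no constraint were tight on the whole intersection of the closures, some
    point of it would satisfy all constraints strictly, and the two open
    polyhedra would meet. *)
Lemma interface_in_hyperplane hs ks :
  open_polyhedron hs !=set0 -> open_polyhedron ks !=set0 ->
  open_polyhedron hs `&` open_polyhedron ks = set0 ->
  exists a b, a != 0 /\
    closed_polyhedron hs `&` closed_polyhedron ks `<=` hyperplane a b.
Proof.
move=> hs0 ks0 dis.
have ndh := open_polyhedron_nondegenerate hs0.
have ndk := open_polyhedron_nondegenerate ks0.
have nd : nondegenerate (hs ++ ks).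
  by move=> h; rewrite mem_cat => /orP[/ndh|/ndk].
have cE : closed_polyhedron hs `&` closed_polyhedron ks = closed_polyhedron (hs ++ ks).
  apply/seteqP; split => x /=.
    by move=> [h1 h2] h; rewrite mem_cat => /orP[/h1|/h2].
  by move=> h1; split => h hh; apply: h1; rewrite mem_cat hh ?orbT.
rewrite cE; set I := closed_polyhedron (hs ++ ks).
have [[h hh tight]|ntight] := pselect (exists2 h, h \in hs ++ ks & h.1 != 0 /\
    forall x, I x -> dotv h.1 x = h.2).
  by exists h.1, h.2; case: tight.
have [[x Ix]|I0] := pselect (I !=set0); last first.
  have [h hh h0] : exists2 h, h \in hs ++ ks & h.1 != 0.
    apply: contrapT => nh; apply: I0; exists 0 => h hh; rewrite dotv0r.
    have [h0|h0] := eqVneq h.1 0; first exact/ltW/nd.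
    by exfalso; apply: nh; exists h.
  by exists h.1, 0; split => // x Ix; exfalso; apply: I0; exists x.
exfalso; have [||||y _ yo] := @common_strict_point (hs ++ ks) I.
- move=> y z Iy Iz; rewrite (_ : 2^-1 *: y = (1 - 2^-1) *: y); last first.
    by congr (_ *: _); lra.
  by apply: closed_polyhedron_mix => //; lra.
- by exists x.
- by [].
- move=> h hh; have [h0|h0] := eqVneq h.1 0.
    by exists x => //; rewrite h0 dotv0l; apply: nd.
  apply: contrapT => nx; apply: ntight; exists h => //; split => // z Iz.
  apply/eqP; rewrite eq_le Iz// leNgt/=; apply/negP => zh; apply: nx.
  by exists z.
- suff : set0 y by [].
  by rewrite -dis; split => h hh; apply: yo; rewrite mem_cat hh ?orbT.
Qed.

Lemma strict_shift hs y eta : open_polyhedron hs y ->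
  exists2 e : R, 0 < e & forall t : R, 0 < t -> t < e -> open_polyhedron hs (y - t *: eta).
Proof.
move=> yo; have /open_cubeP/(_ y yo)[r r0 rU] := @open_polyhedron_open hs.
pose M := \sum_i `|eta 0 i| + 1.
have M0 : 0 < M by rewrite ltr_wpDl// sumr_ge0.
exists (r / M) => [|t t0 tr]; first by rewrite divr_gt0.
apply: rU => i; rewrite -ler_distl !mxE addrAC subrr add0r normrN normrM gtr0_norm//.
rewrite (le_trans (_ : _ <= t * M))//.
  apply: ler_wpM2l; first exact: ltW.
  by rewrite /M (bigD1 i)//= -addrA lerDl addr_ge0// sumr_ge0.
by rewrite -ler_pdivlMr// ltW.
Qed.

(** The prism over S lies in the hyperplane normal to the tangential part of a,
    which is null. *)
Lemma flat_measure_codim2 eta b a d S : enorm eta = 1 -> measurable S ->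
  S `<=` hyperplane eta b -> S `<=` hyperplane a d ->
  a != dotv a eta *: eta -> flat_measure eta S = 0%E.
Proof.
move=> e1 mS Sb Sa ae; rewrite flat_measureE.
apply: (@sub_null _ _ _ (hyperplane (a - dotv a eta *: eta) (d - dotv a eta * b))).
- exact: measurable_flat_prism e1 Sb mS.
- exact: measurable_hyperplane.
- move=> _ [y [t [Sy _ ->]]]; rewrite /hyperplane/= dotvBl !dotvDr !dotvZr !dotvZl.
  by rewrite (enorm1 e1) (Sa _ Sy) (Sb _ Sy); ring.
- by apply: hyperplane_null; rewrite subr_eq0.
Qed.

(** Suppose that the shared part I has positive area. Then any constraint that is
    tight on all of I is parallel to the hyperplane, and a point of I satisfies
    the others strictly. Moving this point slightly along - eta enters both
    cells, which are disjoint. *)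
Lemma same_side_null hs ks eta b : enorm eta = 1 ->
  open_polyhedron hs !=set0 -> open_polyhedron ks !=set0 ->
  open_polyhedron hs `&` open_polyhedron ks = set0 ->
  open_polyhedron hs `<=` [set x | dotv eta x <= b] ->
  open_polyhedron ks `<=` [set x | dotv eta x <= b] ->
  flat_measure eta (closed_polyhedron hs `&` closed_polyhedron ks `&`
    hyperplane eta b) = 0%E.
Proof.
move=> e1 hs0 ks0 dis hsb ksb; set I := _ `&` _.
have mI : measurable I.
  apply: measurableI; last exact: measurable_hyperplane.
  by apply: measurableI; apply: closed_measurable_rV; exact: closed_polyhedron_closed.
have Ib : I `<=` hyperplane eta b by move=> x [].
have nd : nondegenerate (hs ++ ks).
  by move=> h; rewrite mem_cat => /orP[] hh;
    exact: (open_polyhedron_nondegenerate _ hh).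
have [[h [hh h0 tight]]|ntight] := pselect (exists h, [/\ h \in hs ++ ks,
    h.1 != dotv h.1 eta *: eta & I `<=` hyperplane h.1 h.2]).
  exact: (flat_measure_codim2 e1 mI Ib tight h0).
have [[x Ix]|I0] := pselect (I !=set0); last first.
  rewrite flat_measureE (_ : prism _ _ = set0) ?measure0// -subset0.
  by move=> y [z [t [Iz _ _]]]; apply: I0; exists z.
exfalso.
(* The constraints that are not tight on all of I. *)
pose nt := [seq h <- hs ++ ks | ~~ `[< I `<=` hyperplane h.1 h.2 >]].
have Ic : I `<=` closed_polyhedron (hs ++ ks).
  by move=> y [[h1 h2] _] h; rewrite mem_cat => /orP[/h1|/h2].
have [||||y Iy yo] := @common_strict_point nt I.
- move=> y z [[y1 y2] y3] [[z1 z2] z3].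
  rewrite (_ : 2^-1 *: y = (1 - 2^-1) *: y); last by congr (_ *: _); lra.
  split; first by split; apply: closed_polyhedron_mix => //; lra.
  by rewrite /hyperplane/= dotvDr !dotvZr y3 z3; lra.
- by exists x.
- by move=> y Iy h; rewrite mem_filter => /andP[_ hh]; exact: Ic.
- move=> h; rewrite mem_filter => /andP[/asboolPn nh hh].
  apply: contrapT => nx; apply: nh => z Iz; rewrite /hyperplane/=.
  apply/eqP; rewrite eq_le (Ic z)//= leNgt; apply/negP => zh; apply: nx.
  by exists z.
have [e e0 eP] := strict_shift eta yo.
have yeo : open_polyhedron (hs ++ ks) (y - (e / 2) *: eta).
  move=> h hh; have [tight|ntt] := pselect (I `<=` hyperplane h.1 h.2); last first.
    apply: (eP (e / 2)); [by lra|by lra|rewrite mem_filter hh andbT].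
    exact/asboolPn.
  have hE : h.1 = dotv h.1 eta *: eta.
    by apply/eqP/negPn/negP => h0; apply: ntight; exists h; split.
  set t := dotv h.1 eta in hE.
  have h2E : h.2 = t * b by rewrite -(tight _ Ix) hE dotvZl (Ib _ Ix).
  have t0 : 0 < t.
    have [w [wh wb]] : exists w, dotv h.1 w < h.2 /\ dotv eta w <= b.
      move: hh; rewrite mem_cat => /orP[] hh.
        by case: hs0 => w wo; exists w; split; [exact: wo|exact: hsb].
      by case: ks0 => w wo; exists w; split; [exact: wo|exact: ksb].
    move: wh; rewrite h2E hE dotvZl => wh; rewrite ltNge; apply/negP => t0.
    by have := ler_wnM2l t0 wb; rewrite leNgt wh.
  rewrite h2E hE dotvZl dotvBr dotvZr (enorm1 e1) (Ib _ Iy).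
  by rewrite ltr_pM2l//; lra.
suff : set0 (y - (e / 2) *: eta) by [].
by rewrite -dis; split => h hh; apply: yeo; rewrite mem_cat hh ?orbT.
Qed.

End polyhedra.

(** * Geometry of an admissible mesh *)

Section flat_measure.
Context (R : realType) (n : nat).
Implicit Types (a eta : 'rV[R]_n) (S : set 'rV[R]_n) (b : R).

Lemma enorm_neq0 eta : enorm eta = 1 -> eta != 0.
Proof.
move=> e1; apply/eqP => eta0; move: e1; rewrite /enorm eta0 dotv0l sqrtr0 => /esym/eqP.
by rewrite oner_eq0.
Qed.

Lemma enormN (x : 'rV[R]_n) : enorm (- x) = enorm x.
Proof. by rewrite /enorm dotvNr dotvNl opprK. Qed.

Lemma normalize_hyperplane a b : a != 0 -> exists eta b',
  enorm eta = 1 /\ hyperplane a b = hyperplane eta b'.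
Proof.
move=> a0; have aa := dotvv_gt0 a0.
have s0 : 0 < enorm a by rewrite sqrtr_gt0.
exists ((enorm a)^-1 *: a), ((enorm a)^-1 * b); split.
  rewrite /enorm dotvZl dotvZr -/(enorm a) -(sqr_sqrtr (ltW aa)) -/(enorm a).
  by rewrite expr2 mulKf ?gt_eqF// mulVf ?gt_eqF// sqrtr1.
apply/seteqP; split => x; rewrite /hyperplane/= dotvZl; first by move=> ->.
by apply: mulfI; rewrite invr_eq0 gt_eqF.
Qed.

Lemma unit_colinear eta1 eta2 (c : R) : enorm eta1 = 1 -> enorm eta2 = 1 ->
  eta1 = c *: eta2 -> eta1 = eta2 \/ eta1 = - eta2.
Proof.
move=> /enorm1 e1 /enorm1 e2 e12; have : c * c = 1.
  by rewrite -e1 e12 dotvZl dotvZr e2 mulr1.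
move/eqP; rewrite -expr2 sqrf_eq1 => /orP[]/eqP cE; rewrite e12 cE.
  by left; rewrite scale1r.
by right; rewrite scaleN1r.
Qed.

(** The hyperplane in pos_measure is arbitrary, but a hyperplane transverse to
    the one containing S meets it in a set of zero area. *)
Lemma pos_measure_flat_gt0 eta b S : enorm eta = 1 -> measurable S ->
  S `<=` hyperplane eta b -> pos_measure S -> (0 < flat_measure eta S)%E.
Proof.
move=> e1 mS Sb [eta' [b' [e1' pos]]].
have mS' : measurable (S `&` hyperplane eta' b').
  by apply: measurableI => //; exact: measurable_hyperplane.
have [eE|ne] := eqVneq eta (dotv eta eta' *: eta'); last first.
  move: pos; rewrite (@flat_measure_codim2 _ _ eta' b' eta b) ?ltxx//.
  by move=> x [/Sb].
have [b'' Sb''] : exists b'', S `<=` hyperplane eta' b''.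
  have [ee|ee] := unit_colinear e1 e1' eE; first by exists b; rewrite -ee.
  exists (- b) => x /Sb; rewrite /hyperplane/= => <-.
  by rewrite ee dotvNl opprK.
have : (0 < flat_measure eta' S)%E.
  apply: lt_le_trans pos _; exact: (flat_measure_le e1' Sb'').
have [->//|->] := unit_colinear e1 e1' eE.
by rewrite (flat_measureN e1' Sb'').
Qed.

Lemma npos_measure_flat0 eta b S : enorm eta = 1 -> measurable S ->
  S `<=` hyperplane eta b -> ~ pos_measure S -> flat_measure eta S = 0%E.
Proof.
move=> e1 mS Sb np; apply/eqP; rewrite eq_le; apply/andP; split.
  rewrite leNgt; apply/negP => pos; apply: np; exists eta, b; split => //.
  by rewrite setIidl.
by rewrite flat_measureE measure_ge0.
Qed.

Lemma flat_measure_cube eta b S (M : R) : enorm eta = 1 -> measurable S ->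
  S `<=` hyperplane eta b -> 0 <= M -> S `<=` cube 0 M ->
  prism S eta `<=` cube 0 (M + 1) /\
  (flat_measure eta S <= ((2 * (M + 1)) ^+ n)%:E)%E.
Proof.
move=> e1 mS Sb M0 SM.
have sub : prism S eta `<=` cube 0 (M + 1).
  move=> _ [y [t [Sy /andP[t0 t1] ->]]] i; rewrite -ler_distl !mxE subr0.
  have : `|y 0 i| <= M by have := SM _ Sy i; rewrite -ler_distl mxE subr0.
  move=> yM; rewrite (le_trans (ler_normD _ _))// lerD//.
  by rewrite normrM ger0_norm// mulr_ile1// unit_coord_le1.
split => //.
have M1 : 0 <= M + 1 by lra.
rewrite -(lebesgue_cube 0 M1) flat_measureE; apply: le_measure; rewrite ?inE//.
  exact: measurable_flat_prism e1 Sb mS.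
exact: measurable_cube.
Qed.

Lemma flat_measure_fin eta b S (M : R) : enorm eta = 1 -> measurable S ->
  S `<=` hyperplane eta b -> S `<=` cube 0 M ->
  flat_measure eta S = (fine (flat_measure eta S))%:E.
Proof.
move=> e1 mS Sb SM; rewrite fineK// ge0_fin_numE ?flat_measureE ?measure_ge0//.
have M0 : 0 <= `|M| by [].
have [|_ le] := flat_measure_cube e1 mS Sb M0.
  by apply: (subset_trans SM); apply: cube_le; exact: ler_norm.
by rewrite -flat_measureE (le_lt_trans le)// ltry.
Qed.

End flat_measure.

Section mesh_geometry.
Context (R : realType) (l : nat) (d : model_data R l) (m : mesh R l).
Hypotheses (Hd : standing_assumptions d) (Hm : admissible d m).
Implicit Types (K L : cv m) (e : ext m).
Let lam := @lebesgue_rV R l.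

Lemma cell_polyhedron K : exists hs, cell K = open_polyhedron hs.
Proof. exact: cell_polygonal Hm K. Qed.

Lemma cell_neq0 K : cell K !=set0.
Proof. by exists (center K); exact: (center_in Hm). Qed.

Lemma cell_open K : open (cell K).
Proof. by have [hs ->] := cell_polyhedron K; exact: open_polyhedron_open. Qed.

Lemma cell_measurable K : measurable (cell K).
Proof. by apply: open_measurable_rV; exact: cell_open. Qed.

Lemma closure_cell_measurable K : measurable (closure (cell K)).
Proof. by apply: closed_measurable_rV; exact: closed_closure. Qed.

Lemma interface_measurable K L : measurable (interface K L).
Proof. by apply: measurableI; exact: closure_cell_measurable. Qed.

Lemma closure_cell_null K : exists Z, [/\ measurable Z, lam Z = 0%E &
  closure (cell K) `\` cell K `<=` Z].
Proof.
have := cell_neq0 K; have [hs ->] := cell_polyhedron K => h0.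
exists (hyperplane_union hs); split.
- by apply: closed_measurable_rV; exact: closed_hyperplane_union.
- exact: hyperplane_union_null.
- rewrite closure_open_polyhedron//; apply: polyhedron_boundary.
  exact: open_polyhedron_nondegenerate.
Qed.

Lemma closure_Omega : closure (Omega d) = \bigcup_(K in [set: cv m]) closure (cell K).
Proof.
rewrite -(cell_cover Hm); apply/seteqP; split; last first.
  by apply: bigcup_sub => K _; apply: closure_subset; exact: bigcup_sup.
have cl : closed (\bigcup_(K in [set: cv m]) closure (cell K)).
  apply: closed_bigcup => [|K _]; first exact: finite_finset.
  exact: closed_closure.
rewrite [X in _ `<=` X](iffLR (closure_id _) cl); apply: closure_subset.
by apply: subset_bigcup => K _; exact: subset_closure.
Qed.

(** Omega is the interior of a finite union of closed polyhedra, which contains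
    the closure of Omega. *)
Lemma Omega_regular X : open X -> X `<=` closure (Omega d) -> X `<=` Omega d.
Proof.
have [ps ->] := Omega_polygonal Hd => oX Xc.
set F := [set x | _] in Xc *.
have cF : closed F.
  rewrite (_ : F = \bigcup_(hs in [set` ps]) closed_polyhedron hs).
    apply: closed_bigcup => [|hs _]; first exact: finite_seq.
    exact: closed_polyhedron_closed.
  by apply/seteqP; split => x [hs]; exists hs.
rewrite -open_subsetE//; apply: (subset_trans Xc).
rewrite [X in _ `<=` X](iffLR (closure_id _) cF); apply: closure_subset.
exact: interior_subset.
Qed.

Lemma cell_sub_Omega K : cell K `<=` Omega d.
Proof.
apply: Omega_regular; first exact: cell_open.
by rewrite closure_Omega => x Kx; exists K => //; exact: subset_closure.
Qed.

Lemma interfaceC K L : interface K L = interface L K.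
Proof. by rewrite /interface setIC. Qed.

Lemma adjacentC K L : adjacent K L = adjacent L K.
Proof. by rewrite /adjacent eq_sym interfaceC. Qed.

Lemma adjacent_neq K L : adjacent K L -> K != L.
Proof. by case/andP. Qed.

Lemma adjacent_pos K L : adjacent K L -> pos_measure (interface K L).
Proof. by case/andP => _ /asboolP. Qed.

(** Disjoint convex cells touch along a piece of a hyperplane; without adjacency
    its area is zero. *)
Lemma nonadjacent_flat0 K L : K != L -> ~~ adjacent K L ->
  exists eta b, [/\ enorm eta = 1, interface K L `<=` hyperplane eta b &
    flat_measure eta (interface K L) = 0%E].
Proof.
move=> KL; rewrite /adjacent KL/= => /asboolPn np.
have [hs hsE] := cell_polyhedron K; have [ks ksE] := cell_polyhedron L.
have h0 := cell_neq0 K; have k0 := cell_neq0 L; have dis := cell_disjoint Hm KL.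
rewrite hsE in h0 dis; rewrite ksE in k0 dis.
have [a [b [a0 sub]]] := interface_in_hyperplane h0 k0 dis.
have [eta [b' [e1 bE]]] := normalize_hyperplane b a0.
have IS : interface K L `<=` hyperplane eta b'.
  by rewrite -bE /interface hsE ksE !closure_open_polyhedron.
exists eta, b'; split => //.
by apply: npos_measure_flat0 IS np => //; exact: interface_measurable.
Qed.

Lemma adjacent_flat_gt0 K L : adjacent K L ->
  (0 < flat_measure (face_normal K L) (interface K L))%E.
Proof.
move=> adj; have [b [e1 Ib _]] := normal_outward Hm adj.
by apply: (pos_measure_flat_gt0 e1 _ Ib) (adjacent_pos adj); exact: interface_measurable.
Qed.

Lemma face_normal_unit K L : adjacent K L -> enorm (face_normal K L) = 1.
Proof. by move=> /(normal_outward Hm)[b []]. Qed.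

Lemma center_neq K L : K != L -> center K != center L.
Proof.
move=> KL; apply/eqP => cc; have : (cell K `&` cell L) (center K).
  by split; [exact: (center_in Hm)|rewrite cc; exact: (center_in Hm)].
by rewrite (cell_disjoint Hm KL).
Qed.

(** Orthogonality makes both normals colinear with the line of the centers. They
    cannot be equal, since two disjoint cells on the same side of a hyperplane
    share no area of it (same_side_null). *)
Lemma face_normalN K L : adjacent K L -> face_normal L K = - face_normal K L.
Proof.
move=> adj; have adj' := adj; rewrite adjacentC in adj'.
have [b [e1 Ib Kb]] := normal_outward Hm adj.
have [b' [e1' Ib' Lb']] := normal_outward Hm adj'.
have [c cE] := orthogonality Hm adj; have [c' cE'] := orthogonality Hm adj'.
have c'0 : c' != 0.
  apply/eqP => c0; move: cE'; rewrite c0 scale0r => /eqP; rewrite subr_eq0.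
  by apply/negP; apply: center_neq; exact: adjacent_neq.
have eE : face_normal L K = (- c / c') *: face_normal K L.
  apply: (scalerI c'0); rewrite -cE' scalerA -[LHS]opprB cE.
  by rewrite -scaleNr; congr (_ *: _); field.
have [e_eq|//] := unit_colinear e1' e1 eE.
exfalso; have pos := adjacent_flat_gt0 adj.
have [hs hsE] := cell_polyhedron K; have [ks ksE] := cell_polyhedron L.
have [x Ix] : interface K L !=set0.
  apply: contrapT => I0; move: pos; rewrite flat_measureE.
  rewrite (_ : prism _ _ = set0) ?measure0 ?ltxx// -subset0.
  by move=> y [z [t [Iz _ _]]]; apply: I0; exists z.
have bb : b' = b.
  by rewrite -(Ib _ Ix) -(Ib' x)// ?e_eq// interfaceC.
have h0 := cell_neq0 K; have k0 := cell_neq0 L.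
have dis := cell_disjoint Hm (adjacent_neq adj).
move: Kb Lb' h0 k0 dis; rewrite hsE ksE e_eq bb => Kb Lb h0 k0 dis.
have := same_side_null e1 h0 k0 dis Kb Lb.
rewrite -!closure_open_polyhedron// -hsE -ksE -/(interface K L) setIidl//.
by move=> f0; move: pos; rewrite f0 ltxx.
Qed.

Lemma nb_area_ge0 K (x : nb m) : 0 <= nb_area K x.
Proof. by case: x => [L|e] /=; rewrite fine_ge0// flat_measureE measure_ge0. Qed.

Lemma nb_area_sym K L : adjacent K L -> nb_area K (inl L) = nb_area L (inl K).
Proof.
move=> adj /=; rewrite (face_normalN adj) interfaceC.
have [b [e1 Ib _]] := normal_outward Hm adj.
by rewrite (flat_measureN e1 (b := b))// interfaceC//; exact: interface_measurable.
Qed.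

Lemma nb_dist_sym K L : nb_dist K (inl L) = nb_dist L (inl K).
Proof. by rewrite /= -enormN opprB. Qed.

Lemma nb_dist_int_gt0 K L : K != L -> 0 < nb_dist K (inl L).
Proof.
move=> KL; rewrite /= /enorm sqrtr_gt0 dotvv_gt0// subr_eq0.
exact: center_neq.
Qed.

Lemma center_below e : dotv (ext_normal e) (center (ext_cell e)) < ext_offset e.
Proof.
have [e1 _ Kb] := ext_face_normal Hm e.
have /open_cubeP/(_ _ (center_in Hm _))[r r0 rK] := @cell_open (ext_cell e).
have [t t0 tr] : exists2 t : R, 0 < t & t <= r by exists r.
have : cell (ext_cell e) (center (ext_cell e) + t *: ext_normal e).
  apply: rK => i; rewrite -ler_distl !mxE addrAC subrr add0r normrM gtr0_norm//.
  apply: (le_trans _ tr); rewrite -[leRHS]mulr1; apply: ler_wpM2l; first exact: ltW.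
  exact: unit_coord_le1.
by move/Kb => /=; rewrite dotvDr dotvZr (enorm1 e1); lra.
Qed.

Lemma ext_face_neq0 e : ext_face e !=set0.
Proof.
have [eta [b [e1 pos]]] := ext_face_pos Hm e.
apply: contrapT => I0; move: pos; rewrite flat_measureE.
rewrite (_ : prism _ _ = set0) ?measure0 ?ltxx// -subset0.
by move=> y [z [t [[Iz _] _ _]]]; apply: I0; exists z.
Qed.

Lemma nb_dist_ext_gt0 e : 0 < nb_dist (ext_cell e) (inr e).
Proof.
have cb := center_below e; have [e1 Hb _] := ext_face_normal Hm e.
have [y ey] := ext_face_neq0 e.
rewrite /= /dist_to; apply: (@lt_le_trans _ _
  (ext_offset e - dotv (ext_normal e) (center (ext_cell e)))); first by lra.
apply: lb_le_inf.
  by exists (enorm (center (ext_cell e) - y)); exists y => //; exact: Hb.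
move=> _ [z zb <-]; rewrite -zb -dotvBr -[leRHS]enormN opprB.
by rewrite (le_trans (ler_norm _))// dotv_le_enorm.
Qed.

Lemma nb_dist_ext_le e (M : R) : closure (Omega d) `<=` cube 0 M ->
  nb_dist (ext_cell e) (inr e) <= Num.sqrt (l%:R * ((2 * M) * (2 * M))).
Proof.
move=> OM; have [e1 Hb _] := ext_face_normal Hm e.
have [y ey] := ext_face_neq0 e.
apply: (@le_trans _ _ (enorm (center (ext_cell e) - y))).
  rewrite /= /dist_to; apply: ge_inf; last by exists y => //; exact: Hb.
  by exists 0 => _ [z _ <-]; exact: enorm_ge0.
apply: enorm_bound => i.
have cO : closure (Omega d) (center (ext_cell e)).
  by apply: subset_closure; apply: cell_sub_Omega; exact: (center_in Hm).
have yO : closure (Omega d) y by have [_ []] := ext_face_sub Hm ey.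
have := OM _ cO i; have := OM _ yO i; rewrite !mxE => /andP[h1 h2] /andP[h3 h4].
by rewrite ler_norml; apply/andP; split; lra.
Qed.

End mesh_geometry.

(** * Volumes, and segments crossing a flat set *)

Section almost_disjoint.
Context d (T : measurableType d) (R : realType) (mu : {measure set T -> \bar R}).

Lemma measureU_null (A B : set T) : measurable A -> measurable B ->
  mu (A `&` B) = 0%E -> (mu (A `|` B) = mu A + mu B)%E.
Proof.
move=> mA mB AB0; rewrite (measureDI mu (measurableU _ _ mA mB) mA).
have -> : (A `|` B) `&` A = A by apply/seteqP; split => [x []//|x Ax]; split => //; left.
rewrite setDUl setDv set0U [mu B](measureDI mu mB mA).
by rewrite setIC in AB0; rewrite [X in (_ + (_ + X))%E]AB0 adde0 addeC.
Qed.

Lemma sum_almost_disjoint (I : eqType) (s : seq I) (A : I -> set T) (U : set T) :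
  uniq s -> (forall i, i \in s -> measurable (A i)) -> measurable U ->
  (forall i j, i \in s -> j \in s -> i != j -> mu (A i `&` A j) = 0%E) ->
  (forall i, i \in s -> A i `<=` U) ->
  (\sum_(i <- s) mu (A i) <= mu U)%E.
Proof.
move=> us mA mU A0 AU.
suff [-> mbig AbU] : [/\ (\sum_(i <- s) mu (A i) = mu (\big[setU/set0]_(i <- s) A i))%E,
    measurable (\big[setU/set0]_(i <- s) A i) & \big[setU/set0]_(i <- s) A i `<=` U].
  by apply: le_measure; rewrite ?inE.
elim: s us mA A0 AU => [_ _ _ _|i s IHs /andP[nis us] mA A0 AU].
  by rewrite !big_nil measure0; split => //; exact: measurable0.
have [||||sE smb sU] := IHs => //.
- by move=> j js; apply: mA; rewrite inE js orbT.
- by move=> j k js ks; apply: A0; rewrite inE ?js ?ks orbT.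
- by move=> j js; apply: AU; rewrite inE js orbT.
have mAi : measurable (A i) by apply: mA; rewrite mem_head.
rewrite !big_cons; split; last 2 first.
- exact: measurableU.
- by rewrite subUset; split => //; apply: AU; rewrite mem_head.
rewrite measureU_null// ?sE//.
have sA j : j \in s -> mu (A i `&` A j) = 0%E /\ measurable (A j).
  move=> js; split; last by apply: mA; rewrite inE js orbT.
  apply: A0; rewrite ?inE ?eqxx ?js ?orbT//.
  by apply: contraNneq nis => ->.
elim: s sA {IHs nis us mA A0 AU sE smb sU} => [_|j s IHs sA].
  by rewrite big_nil setI0 measure0.
have [Aj0 mAj] := sA j (mem_head _ _).
have sA' k : k \in s -> mu (A i `&` A k) = 0%E /\ measurable (A k).
  by move=> ks; apply: sA; rewrite inE ks orbT.
rewrite big_cons setIUr null_set_setU// ?IHs//; first exact: measurableI.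
apply: measurableI => //; rewrite big_seq.
by apply: bigsetU_measurable => k /sA'[].
Qed.

End almost_disjoint.

Section segments_meeting_a_set.
Context (R : realType) (l : nat).
Implicit Types (S : set 'rV[R]_l) (eta h : 'rV[R]_l) (b D : R).
Let lam := @lebesgue_rV R l.

Definition meets (S : set 'rV[R]_l) (h : 'rV[R]_l) : set 'rV[R]_l :=
  [set x | exists2 t : R, 0 <= t <= 1 & S (x + t *: h)].

Lemma meets_prism S h : meets S h `<=` prism S (- h).
Proof.
move=> x [t t01 Sx]; exists (x + t *: h), t; split => //.
by rewrite scalerN addrK.
Qed.

(** If x + t h lies in S then x lies in the prism swept by S along - h. The
    segments of direction h that cross a face therefore start in a set whose
    volume is bounded by the area of the face. *)
Lemma meets_flat S eta b h D : 0 <= D -> (forall i, `|h 0 i| <= D) ->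
  enorm eta = 1 -> measurable S -> S `<=` hyperplane eta b ->
  exists Z, [/\ measurable Z, meets S h `<=` Z &
    (lam Z <= ((2 * (1 + l%:R * (D + 1))) ^+ l)%:E * flat_measure eta S)%E].
Proof.
move=> D0 hD e1 mS Sb.
have [|Z [mZ SZ ZS]] := prism_le_flat D0 e1 Sb mS (v := - h).
  by move=> i; rewrite mxE normrN.
by exists Z; split => //; apply: subset_trans SZ; exact: meets_prism.
Qed.

End segments_meeting_a_set.

Section mesh_bounds.
Context (R : realType) (l : nat) (d : model_data R l).
Hypothesis (Hd : standing_assumptions d).
Let lam := @lebesgue_rV R l.

Lemma closed_cube (c : 'rV[R]_l) (r : R) : closed (cube c r).
Proof.
rewrite (_ : cube c r = \bigcap_(i in [set: 'I_l])
    ((fun x : 'rV[R]_l => x 0 i) @^-1` [set t | c 0 i - r <= t] `&`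
     (fun x : 'rV[R]_l => x 0 i) @^-1` [set t | t <= c 0 i + r])).
  apply: closed_bigI => i _; apply: closedI; apply: preimage_closed.
  - by move=> x _; exact: coord_continuous.
  - exact: closed_ge.
  - by move=> x _; exact: coord_continuous.
  - exact: closed_le.
apply/seteqP; split => x h i; first by move=> _ /=; have /andP[] := h i.
by have [/= h1 h2] := h i I; rewrite h1 h2.
Qed.

Lemma Omega_cube : exists2 M : R, 0 < M & closure (Omega d) `<=` cube 0 M.
Proof.
have [M M0 OM] := bounded_cube (Omega_bounded Hd); exists M => //.
rewrite [X in _ `<=` X](iffLR (closure_id _) (@closed_cube _ _)).
exact: closure_subset.
Qed.

Section fixed_mesh.
Context (m : mesh R l).
Hypothesis (Hm : admissible d m).
Variable (M : R).
Hypothesis (M0 : 0 < M) (OM : closure (Omega d) `<=` cube 0 M).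

Lemma cell_cube K : cell (m := m) K `<=` cube 0 M.
Proof.
apply: subset_trans OM; apply: (subset_trans (cell_sub_Omega Hd Hm (K := K))).
exact: subset_closure.
Qed.

Lemma volumeE K : lam (cell (m := m) K) = (volume K)%:E.
Proof.
rewrite /volume fineK// ge0_fin_numE//.
apply: (@le_lt_trans _ _ (lam (cube 0 M))).
  by apply: le_measure; rewrite ?inE; [exact: cell_measurable Hm _|
    exact: measurable_cube|exact: cell_cube].
by rewrite [X in (X < _)%E]lebesgue_cube ?ltW// ltry.
Qed.

Lemma volume_gt0 (K : cv m) : 0 < volume K.
Proof.
rewrite -lte_fin -volumeE; apply: open_gt0; first exact: cell_open Hm _.
  exact: cell_measurable Hm _.
exact: cell_neq0 Hm _.
Qed.

Lemma sum_volume_le : \sum_(K : cv m) volume K <= (2 * M) ^+ l.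
Proof.
rewrite -lee_fin -sumEFin; under eq_bigr do rewrite -volumeE.
rewrite -(lebesgue_cube 0 (ltW M0)).
apply: (@sum_almost_disjoint _ _ _ lam (cv m) (index_enum (cv m))
  (fun K => cell K)).
- exact: index_enum_uniq.
- by move=> K _; exact: cell_measurable Hm _.
- exact: measurable_cube.
- by move=> K L _ _ KL; rewrite (cell_disjoint Hm KL) measure0.
- by move=> K _; exact: cell_cube.
Qed.

Lemma interface_cube (K L : cv m) : interface K L `<=` cube 0 M.
Proof.
move=> x [Kx _]; apply: OM; rewrite (closure_Omega Hm); by exists K.
Qed.

Lemma ext_face_cube (e : ext m) : ext_face e `<=` cube 0 M.
Proof.
move=> x /(ext_face_sub Hm)[Kx _]; apply: OM; rewrite (closure_Omega Hm).
by exists (ext_cell e).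
Qed.

Lemma nb_area_intE (K L : cv m) : adjacent K L ->
  flat_measure (face_normal K L) (interface K L) = (nb_area K (inl L))%:E.
Proof.
move=> adj; have [b [e1 Ib _]] := normal_outward Hm adj.
exact: (flat_measure_fin e1 (interface_measurable K L) Ib (@interface_cube K L)).
Qed.

Lemma nb_area_extE K (e : ext m) :
  flat_measure (ext_normal e) (ext_face e) = (nb_area K (inr e))%:E.
Proof.
have [e1 Ib _] := ext_face_normal Hm e.
exact: (flat_measure_fin e1 (ext_face_measurable Hm e) Ib (@ext_face_cube e)).
Qed.

End fixed_mesh.

(** Up to hyperplanes, Omega is a finite union of open convex polyhedra. The
    constraints with zero normal are dropped, and so are the pieces without
    interior points: these lie in finitely many hyperplanes, hence removing them
    loses no open subset of Omega. *)
Lemma Omega_pieces : exists ps : seq (seq ('rV[R]_l * R)),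
  [/\ forall hs, hs \in ps -> open_polyhedron hs !=set0,
      forall hs, hs \in ps -> open_polyhedron hs `<=` Omega d,
      closure (Omega d) `<=` [set x | exists2 hs, hs \in ps & closed_polyhedron hs x] &
      frontier (Omega d) `<=` hyperplane_union (flatten ps)].
Proof.
have [qs qsE] := Omega_polygonal Hd.
set F := [set x | _] in qsE.
have cF : closed F.
  rewrite (_ : F = \bigcup_(hs in [set` qs]) closed_polyhedron hs).
    apply: closed_bigcup => [|hs _]; first exact: finite_seq.
    exact: closed_polyhedron_closed.
  by apply/seteqP; split => x [hs]; exists hs.
have oO : open (Omega d) by rewrite qsE; exact: open_interior.
have cOF : closure (Omega d) `<=` F.
  rewrite [X in _ `<=` X](iffLR (closure_id _) cF); apply: closure_subset.
  by rewrite qsE; exact: interior_subset.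
(* On a nonempty polyhedron a constraint with zero normal always holds. *)
pose nz (hs : seq ('rV[R]_l * R)) := [seq h <- hs | h.1 != 0].
have nzP hs x : closed_polyhedron hs x ->
    closed_polyhedron hs = closed_polyhedron (nz hs).
  move=> hx; apply/seteqP; split => y hy h.
    by rewrite mem_filter => /andP[_ /hy].
  move=> hh; have [h0|h0] := eqVneq h.1 0; last by apply: hy; rewrite mem_filter h0.
  by have := hx h hh; rewrite h0 !dotv0l.
have nd hs : nondegenerate (nz hs).
  by move=> h; rewrite mem_filter => /andP[/eqP + _] => h0 /h0.
pose fat hs := `[< open_polyhedron (nz hs) !=set0 /\ closed_polyhedron hs !=set0 >].
pose ps := [seq nz hs | hs <- qs & fat hs].
have psP hs : hs \in ps -> exists ks, [/\ hs = nz ks, ks \in qs,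
    open_polyhedron hs !=set0 & closed_polyhedron ks = closed_polyhedron hs].
  move=> /mapP[ks]; rewrite mem_filter => /andP[/asboolP[k0 [x kx]] kq] ->.
  by exists ks; split => //; exact: nzP kx.
have fat_sub hs : hs \in ps -> open_polyhedron hs `<=` Omega d.
  move=> /psP[ks [_ kq _ ckh]]; rewrite qsE -open_subsetE; last first.
    exact: open_polyhedron_open.
  by move=> x /open_polyhedronW; rewrite -ckh => kx; exists ks.
have cov : closure (Omega d) `<=` [set x | exists2 hs, hs \in ps & closed_polyhedron hs x].
  set G := [set x | _].
  have cG : closed G.
    rewrite (_ : G = \bigcup_(hs in [set` ps]) closed_polyhedron hs).
      apply: closed_bigcup => [|hs _]; first exact: finite_seq.
      exact: closed_polyhedron_closed.
    by apply/seteqP; split => x [hs]; exists hs.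
  rewrite [X in _ `<=` X](iffLR (closure_id _) cG); apply: closure_subset.
  suff D0 : Omega d `\` G = set0 by rewrite -setD_eq0.
  apply: contrapT => D0; have Dn0 : Omega d `\` G !=set0 by apply/set0P/eqP.
  have oD : open (Omega d `\` G) by rewrite setDE; apply: openI => //; exact: closed_openC.
  have mD := open_measurable_rV oD.
  have := open_gt0 oD mD Dn0; rewrite (@sub_null _ _ _
    (hyperplane_union (flatten (map nz qs)))) ?ltxx//.
  - by apply: closed_measurable_rV; exact: closed_hyperplane_union.
  - move=> x [Ox nGx]; have [ks kq kx] : F x by apply: cOF; exact: subset_closure.
    have nf : ~ (open_polyhedron (nz ks) !=set0).
      move=> k0; apply: nGx; exists (nz ks); last by rewrite -(nzP _ _ kx).
      by apply/mapP; exists ks => //; rewrite mem_filter kq andbT; apply/asboolP;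
        split => //; exists x.
    have [|h hh [h0 hx]] := @polyhedron_boundary _ _ (nz ks) (nd ks) x.
      by split; [rewrite -(nzP _ _ kx)|move=> kox; apply: nf; exists x].
    by exists h => //; apply/flattenP; exists (nz ks) => //; exact: map_f.
  - exact: hyperplane_union_null.
exists ps; split => //.
  by move=> hs /psP[ks []].
move=> x [/cov[hs hp hx] nOx].
have ndhs : nondegenerate hs by have [ks [-> _ _ _]] := psP _ hp; exact: nd.
have [|h hh [h0 hxE]] := @polyhedron_boundary _ _ hs ndhs x.
  split => // /(fat_sub _ hp); move: nOx.
  by rewrite (iffLR (interior_id _) oO).
by exists h => //; apply/flattenP; exists hs.
Qed.

End mesh_bounds.

(** * Total area of the exterior faces *)

Section exterior_area.
Context (R : realType) (l : nat) (d : model_data R l).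
Hypothesis (Hd : standing_assumptions d).
Let lam := @lebesgue_rV R l.

Lemma prismI (S S' : set 'rV[R]_l) eta b : enorm eta = 1 ->
  S `<=` hyperplane eta b -> S' `<=` hyperplane eta b ->
  prism S eta `&` prism S' eta `<=` prism (S `&` S') eta.
Proof.
move=> e1 Sb Sb' x [[y [t [Sy t01 ->]]] [y' [t' [Sy' _ yy]]]].
have tt : t = t'.
  have := congr1 (dotv eta) yy; rewrite !dotvDr !dotvZr (Sb _ Sy) (Sb' _ Sy').
  by rewrite (enorm1 e1) !mulr1 => /addrI.
exists y, t; split => //; split => //.
by move: yy; rewrite -tt => /addIr ->.
Qed.

(** For faces of one cell this is a property of the mesh; two different cells on
    the same side of a hyperplane share no area of it. *)
Lemma ext_face_overlap_null (m : mesh R l) (Hm : admissible d m) (e e' : ext m) :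
  e != e' -> ext_normal e = ext_normal e' -> ext_offset e = ext_offset e' ->
  flat_measure (ext_normal e) (ext_face e `&` ext_face e') = 0%E.
Proof.
move=> ee' en eo; have [e1 Ib Kb] := ext_face_normal Hm e.
have [_ Ib' Kb'] := ext_face_normal Hm e'.
have mI : measurable (ext_face e `&` ext_face e').
  by apply: measurableI; exact: (ext_face_measurable Hm).
have [cc|cc] := eqVneq (ext_cell e) (ext_cell e').
  apply: (npos_measure_flat0 (b := ext_offset e) e1 mI _ (ext_face_overlap Hm ee' cc)).
  by move=> x [/Ib].
have [hs hsE] := cell_polyhedron Hm (ext_cell e).
have [ks ksE] := cell_polyhedron Hm (ext_cell e').
have h0 := cell_neq0 Hm (ext_cell e); have k0 := cell_neq0 Hm (ext_cell e').
have dis := cell_disjoint Hm cc; rewrite -en -eo in Kb'.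
have sub : ext_face e `&` ext_face e' `<=` closure (cell (ext_cell e)) `&`
    closure (cell (ext_cell e')) `&` hyperplane (ext_normal e) (ext_offset e).
  by move=> x [ex e'x]; split; [split|exact: Ib];
    [have [] := ext_face_sub Hm ex|have [] := ext_face_sub Hm e'x].
apply/eqP; rewrite eq_le; apply/andP; split; last by rewrite flat_measureE.
rewrite hsE ksE in sub dis h0 k0 Kb Kb'.
rewrite -(same_side_null e1 h0 k0 dis Kb Kb') -!closure_open_polyhedron//.
apply: (flat_measure_le (b := ext_offset e) e1 _ mI _ sub); first by move=> x [].
apply: measurableI; last exact: measurable_hyperplane.
by apply: measurableI; apply: closed_measurable_rV; exact: closed_closure.
Qed.

(** With c the norm of h.1 or its opposite, h.1 becomes a unit normal. *)
Let scaled (h : 'rV[R]_l * R) (c : R) := (c^-1 *: h.1, c^-1 * h.2).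

(** The frontier of Omega lies in the hyperplanes of hs. A face of positive area
    is not covered by those transverse to it, so its own hyperplane is one of
    them, with one of the two unit normals. *)
Lemma ext_normal_frontier (m : mesh R l) (Hm : admissible d m) (e : ext m) hs :
  frontier (Omega d) `<=` hyperplane_union hs ->
  (ext_normal e, ext_offset e) \in
    [seq scaled h (enorm h.1) | h <- hs] ++ [seq scaled h (- enorm h.1) | h <- hs].
Proof.
move=> fhs; have [e1 Ib _] := ext_face_normal Hm e.
set eta := ext_normal e in e1 Ib *; set b := ext_offset e in Ib *.
have [[h hh [h0 h1E h2E]]|nh] := pselect (exists2 h, h \in hs &
    [/\ h.1 != 0, h.1 = dotv h.1 eta *: eta & h.2 = dotv h.1 eta * b]).
  set c := dotv h.1 eta in h1E h2E.
  have c0 : c != 0 by apply: contraNneq h0 => c0; rewrite h1E c0 scale0r.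
  have hc : (eta, b) = scaled h c.
    rewrite /scaled h1E h2E scalerA !mulVf// scale1r mulrA mulVf// mul1r//.
  have ehc : enorm h.1 = `|c|.
    by rewrite /enorm h1E dotvZl dotvZr (enorm1 e1) mulr1 -expr2 sqrtr_sqr.
  rewrite mem_cat; apply/orP; have [c_ge0|c_lt0] := leP 0 c; [left|right].
    by apply/mapP; exists h => //; rewrite ehc ger0_norm.
  by apply/mapP; exists h => //; rewrite ehc ltr0_norm// opprK.
exfalso.
(* The components of the constraints along the plane of the face. *)
pose hs' := [seq (h.1 - dotv h.1 eta *: eta, h.2 - dotv h.1 eta * b) |
  h <- hs : seq ('rV[R]_l * R)].
have flat0 : lam (prism (ext_face e) eta) = 0%E.
  apply: (@sub_null _ _ _ (hyperplane_union hs')).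
  - exact: measurable_flat_prism e1 Ib (ext_face_measurable Hm e).
  - by apply: closed_measurable_rV; exact: closed_hyperplane_union.
  - move=> _ [y [t [ey _ ->]]]; have [_ fy] := ext_face_sub Hm ey.
    have [h hh [h0 hy]] := fhs _ fy.
    exists (h.1 - dotv h.1 eta *: eta, h.2 - dotv h.1 eta * b); first exact: map_f.
    rewrite /= subr_eq0; split; last first.
      by rewrite dotvBl !dotvDr !dotvZr !dotvZl (enorm1 e1) hy (Ib _ ey); ring.
    apply/eqP => hE; apply: nh; exists h => //; split => //.
    by rewrite -hy {1}hE dotvZl (Ib _ ey).
  - exact: hyperplane_union_null.
have := pos_measure_flat_gt0 e1 (ext_face_measurable Hm e) Ib (ext_face_pos Hm e).
by rewrite flat_measureE -/lam flat0 ltxx.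
Qed.

Lemma sum_classify (I J : eqType) (r : seq I) (s : seq J) (f : I -> J) (F : I -> R) :
  (forall i, i \in r -> f i \in s) -> (forall i, 0 <= F i) ->
  \sum_(i <- r) F i <= \sum_(j <- s) \sum_(i <- r | f i == j) F i.
Proof.
move=> fs F0; rewrite (exchange_big_dep xpredT)//= big_seq [leRHS]big_seq.
apply: ler_sum => i ir; rewrite (big_rem (f i)) ?fs//= eqxx lerDl.
by apply: sumr_ge0.
Qed.

(** The faces are grouped by oriented hyperplane. The number of groups depends
    on Omega only, and the faces of one group are almost disjoint and lie in a
    bounded set. *)
Lemma exterior_area_bound : exists2 A : R, 0 <= A & forall m : mesh R l,
  admissible d m -> \sum_(e : ext m) nb_area (ext_cell e) (inr e) <= A.
Proof.
have [M M0 OM] := Omega_cube Hd.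
have [ps [_ _ _ fps]] := Omega_pieces Hd.
set hs := flatten ps in fps.
pose cs := [seq scaled h (enorm h.1) | h <- hs] ++
  [seq scaled h (- enorm h.1) | h <- hs].
have M1 : 0 <= M + 1 by lra.
exists ((2 * (M + 1)) ^+ l *+ size cs).
  by rewrite mulrn_wge0// exprn_ge0// mulr_ge0.
move=> m Hm.
apply: (le_trans (@sum_classify (ext m) _ _ cs
  (fun e => (ext_normal e, ext_offset e)) _ _ _)).
- by move=> e _; exact: ext_normal_frontier.
- by move=> e; exact: nb_area_ge0.
rewrite (le_trans (ler_sum _ (_ : forall c, true -> _ <= (2 * (M + 1)) ^+ l)))//.
  move=> [eta b] _; rewrite -big_filter.
  set r := [seq e <- _ | _].
  have rP e : e \in r -> ext_normal e = eta /\ ext_offset e = b.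
    by rewrite mem_filter => /andP[/eqP[]].
  rewrite -lee_fin -sumEFin -(lebesgue_cube 0 M1).
  have [->|[e0 e0r]] : r = [::] \/ exists e, e \in r.
    by case: (r) => [|e t]; [left|right; exists e; rewrite mem_head].
    by rewrite big_nil measure_ge0.
  have e1 : enorm eta = 1.
    by have [<- _] := rP _ e0r; have [] := ext_face_normal Hm e0.
  have Sb e : e \in r -> ext_face e `<=` hyperplane eta b.
    by move=> /rP[<- <-]; have [] := ext_face_normal Hm e.
  have -> : (\sum_(e <- r) (nb_area (ext_cell e) (inr e))%:E =
      \sum_(e <- r) lam (prism (ext_face e) eta))%E.
    rewrite big_seq [RHS]big_seq; apply: eq_bigr => e er.
    by rewrite -(nb_area_extE Hm OM) flat_measureE; have [-> _] := rP _ er.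
  apply: sum_almost_disjoint.
  - by rewrite filter_uniq// index_enum_uniq.
  - by move=> e er; apply: measurable_flat_prism e1 (Sb _ er) (ext_face_measurable Hm e).
  - exact: measurable_cube.
  - move=> e e' er e'r ee'; have [en eo] := rP _ er; have [e'n e'o] := rP _ e'r.
    have mp f : f \in r -> measurable (prism (ext_face f) eta).
      by move=> fr; exact: measurable_flat_prism e1 (Sb _ fr) (ext_face_measurable Hm f).
    apply: (@sub_null _ _ _ (prism (ext_face e `&` ext_face e') eta)).
    + by apply: measurableI; exact: mp.
    + apply: (measurable_flat_prism e1 (b := b)); first by move=> x [/(Sb _ er)].
      by apply: measurableI; exact: (ext_face_measurable Hm).
    + exact: prismI e1 (Sb _ er) (Sb _ e'r).
    + rewrite -flat_measureE -en; apply: ext_face_overlap_null => //.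
      by rewrite en e'n.
      by rewrite eo e'o.
  - move=> e er; have [] // := flat_measure_cube e1 (ext_face_measurable Hm e) (Sb _ er) (ltW M0).
    exact: (ext_face_cube Hm OM).
by rewrite big_const_seq count_predT iter_addr_0.
Qed.

End exterior_area.

(** * Chains of cells along a segment *)

Section chains_of_cells.
Context (R : realType).

Lemma path_variation (T : finType) (e : rel T) (w : T -> R) (x : T) p :
  path e x p -> uniq (x :: p) ->
  `|w x - w (last x p)| <= \sum_(y <- x :: p) \sum_(z | e y z) `|w y - w z|.
Proof.
elim: p x => [x _ _|y p IHp x /= /andP[exy pp] /andP[_ up]].
  by rewrite /= subrr normr0 big_seq1 sumr_ge0.
rewrite big_cons; apply: (@le_trans _ _ (`|w x - w y| + `|w y - w (last y p)|)).
  by rewrite -[X in `|X|](subrKA (w y)) ler_normD.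
rewrite lerD ?IHp// (bigD1 y)//= lerDl; exact: sumr_ge0.
Qed.

Lemma connect_variation (T : finType) (e : rel T) (w : T -> R) (x y : T) :
  connect e x y -> `|w x - w y| <= \sum_t \sum_(z | e t z) `|w t - w z|.
Proof.
move=> /connectP[p pp ->]; case: (shortenP pp) => q qp uq _.
apply: (le_trans (path_variation w qp uq)).
rewrite big_uniq//= [leRHS](bigID (mem (x :: q)))/= lerDl.
by apply: sumr_ge0 => t _; exact: sumr_ge0.
Qed.

Lemma line_continuous (n : nat) (x h : 'rV[R]_n) : continuous (fun t : R => x + t *: h).
Proof.
move=> t; have th : (fun t : R => t *: h) t @[t --> t] --> t *: h.
  by apply: cvgZr_tmp; exact: cvg_id.
exact: (cvgD (cvg_cst x) th).
Qed.

(** The sets reachable from i and the other sets form two closed sets that would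
    separate the segment; as it is connected, reachable sets cover all of it, and
    one of them contains the end point. *)
Lemma closed_cover_connect (n : nat) (T : finType) (F : T -> set 'rV[R]_n)
    (e : rel T) (x h : 'rV[R]_n) (i j : T) :
  (forall k, closed (F k)) ->
  (forall t : R, 0 <= t <= 1 -> exists k, F k (x + t *: h)) ->
  (forall k k' (t : R), 0 <= t <= 1 -> F k (x + t *: h) -> F k' (x + t *: h) ->
     k != k' -> e k k') ->
  F i x -> F j (x + h) -> connect e i j.
Proof.
move=> cF cov link Fi Fj.
pose g (t : R) := x + t *: h.
have cg : continuous g by exact: line_continuous.
pose U (P : pred T) : set R := \bigcup_(k in [set k | P k]) (g @^-1` F k).
have cU P : closed (U P).
  apply: closed_bigcup => [|k _]; first exact: finite_finset.
  by apply: preimage_closed => // t _; exact: cg.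
have U01 : (U (connect e i) `&` `[0, 1]) = `[0, 1]%classic.
  have cI : connected (`[0, 1]%classic : set R).
    exact: segment_connected.
  apply: cI.
  - exists 0; split; last by rewrite /= in_itv/= lexx ler01.
    by exists i => /=; [exact: connect0|rewrite /g scale0r addr0].
  - exists (~` U (predC (connect e i))); first exact: closed_openC.
    rewrite setIC; apply/seteqP; split => t [t01 tU]; split => //.
      move=> [k /= nk Fk]; case: tU => k' /= ck' Fk'.
      have kk : k' != k by apply: contraNneq nk => <-.
      move: nk; rewrite (connect_trans ck')// connect1//.
      by apply: (link _ _ t) => //; move: t01; rewrite /= in_itv.
    have [k Fk] : exists k, F k (g t) by apply: cov; move: t01; rewrite /= in_itv.
    exists k => //=; apply: contrapT => /negP nk; apply: tU.
    by exists k.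
  - by exists (U (connect e i)) => //; rewrite setIC.
have : (U (connect e i) `&` `[0, 1]) 1 by rewrite U01 /= in_itv/= lexx ler01.
move=> [[k /= ck Fk] _].
have [<-//|kj] := eqVneq k j.
rewrite (connect_trans ck)// connect1//; apply: (link k j 1) => //.
  by rewrite ler01 lexx.
by rewrite scale1r.
Qed.

End chains_of_cells.

Section weighted_measures.
Context dd (T : measurableType dd) (R : realType) (mu : {measure set T -> \bar R}).

Let weighted_measure_le_total (I J : finType) (N : I -> set T) (Z : J -> set T)
    (Z0 : set T) (c : I -> R) (g : J -> R) :
  (forall i, measurable (N i)) -> (forall j, measurable (Z j)) ->
  measurable Z0 -> mu Z0 = 0%E ->
  (forall i i', i != i' -> N i `&` N i' = set0) ->
  (forall i, 0 <= c i) -> (forall j, 0 <= g j) ->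
  (forall i x, N i x -> ~ Z0 x -> c i <= \sum_j g j * \1_(Z j) x) ->
  (\sum_i (c i)%:E * mu (N i) <= \sum_j (g j)%:E * mu (Z j))%E.
Proof.
move=> mN mZ mZ0 Z00 dN c0 g0 cg.
pose N' i := N i `\` Z0.
have mN' i : measurable (N' i) by exact: measurableD.
have N'E i : mu (N i) = mu (N' i).
  rewrite (measureDI mu (mN i) mZ0) [X in (_ + X)%E](_ : _ = 0%E) ?adde0//.
  by apply: (subset_measure0 _ _ _ Z00) => //; first exact: measurableI.
have mind (a : R) (X : set T) : measurable X ->
    measurable_fun setT (fun x => (a * \1_X x : R)%:E).
  by move=> mX; apply/measurable_EFinP; apply: measurable_funM => //;
    exact: measurable_indic.
have intI (K : finType) (a : K -> R) (X : K -> set T) :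
    (forall k, 0 <= a k) -> (forall k, measurable (X k)) ->
    (\sum_k (a k)%:E * mu (X k) =
     \int[mu]_x (\sum_k (a k * \1_(X k) x)%:E))%E.
  move=> a0 mX; rewrite ge0_integral_sum//.
  - apply: eq_bigr => k _; under eq_integral do rewrite EFinM.
    rewrite ge0_integralZl//.
    + by rewrite integral_indic ?setIT//; exact: mX.
    + by apply/measurable_EFinP; apply: measurable_indic; exact: mX.
    + by rewrite lee_fin.
  - by move=> k; exact: mind.
  - by move=> k x _; rewrite lee_fin mulr_ge0.
under eq_bigr do rewrite N'E.
rewrite !intI//; apply: ge0_le_integral => //.
- by move=> x _; apply: sume_ge0 => k _; rewrite lee_fin mulr_ge0.
- by apply: emeasurable_sum => k; exact: mind.
- by apply: emeasurable_sum => k; exact: mind.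
move=> x _; rewrite !sumEFin lee_fin.
have rhs0 : 0 <= \sum_j g j * \1_(Z j) x by apply: sumr_ge0 => j _; rewrite mulr_ge0.
have [[i [Nx Zx]]|nN] := pselect (exists i, N' i x); last first.
  rewrite big1// => i _; rewrite indicE memNset ?mulr0// => Nx.
  by apply: nN; exists i.
rewrite (bigD1 i)//= big1 ?addr0 => [|i' i'i].
  by rewrite indicE mem_set ?mulr1//; exact: cg.
rewrite indicE memNset ?mulr0// => -[Ni'x _].
suff : set0 x by [].
by rewrite -(dN _ _ i'i).
Qed.

(** Integration of a pointwise bound; the null set Z0 absorbs the points where
    it fails. *)
Lemma weighted_measure_le (I J : finType) (N : I -> set T) (Z : J -> set T)
    (Z0 : set T) (c : I -> R) (g : J -> R) (PJ : pred J) :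
  (forall i, measurable (N i)) -> (forall j, PJ j -> measurable (Z j)) ->
  measurable Z0 -> mu Z0 = 0%E ->
  (forall i i', i != i' -> N i `&` N i' = set0) ->
  (forall i, 0 <= c i) -> (forall j, 0 <= g j) ->
  (forall i x, N i x -> ~ Z0 x -> c i <= \sum_(j | PJ j && `[< Z j x >]) g j) ->
  (\sum_i (c i)%:E * mu (N i) <= \sum_(j | PJ j) (g j)%:E * mu (Z j))%E.
Proof.
move=> mN mZ mZ0 Z00 dN c0 g0 cg.
pose Z' j := if PJ j then Z j else set0.
have := @weighted_measure_le_total I J N Z' Z0 c g mN _ mZ0 Z00 dN c0 g0 _.
have -> : (\sum_j (g j)%:E * mu (Z' j) = \sum_(j | PJ j) (g j)%:E * mu (Z j))%E.
  rewrite [RHS]big_mkcond; apply: eq_bigr => j _; rewrite /Z'.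
  by case: ifP => //; rewrite measure0 mule0.
apply.
  by move=> j; rewrite /Z'; case: ifP => // /mZ.
move=> i x Nx Zx; rewrite (le_trans (cg _ _ Nx Zx))// [leLHS]big_mkcond/=.
apply: ler_sum => j _; rewrite /Z' indicE; case: (PJ j) => /=.
  by case: asboolP => Zjx; [rewrite mem_set ?mulr1|rewrite mulr_ge0].
by rewrite in_set0 mulr0.
Qed.

End weighted_measures.

(** * Sets on which the total variation controls a discrete function *)

Lemma bigsetU_null dd (T : measurableType dd) (R : realType)
    (mu : {measure set T -> \bar R}) (I : finType) (A : I -> set T) :
  (forall i, measurable (A i)) -> (forall i, mu (A i) = 0%E) ->
  mu (\big[setU/set0]_i A i) = 0%E.
Proof.
move=> mA A0; elim: (index_enum I) => [|i s IHs]; first by rewrite big_nil measure0.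
by rewrite big_cons null_set_setU//; exact: bigsetU_measurable.
Qed.

Lemma ler_sum_pred (R : realType) (I : finType) (P Q : pred I) (F : I -> R) :
  (forall i, 0 <= F i) -> (forall i, P i -> Q i) ->
  \sum_(i | P i) F i <= \sum_(i | Q i) F i.
Proof.
move=> F0 PQ; rewrite big_mkcond [leRHS]big_mkcond; apply: ler_sum => i _.
by case: ifPn => [/PQ ->//|_]; case: ifP.
Qed.

Section controlled_sets.
Context (R : realType) (l : nat) (d : model_data R l).
Hypothesis (Hd : standing_assumptions d).
Let lam := @lebesgue_rV R l.

Definition nb_face (m : mesh R l) (K : cv m) (x : nb m) : set 'rV[R]_l :=
  match x with inl L => interface K L | inr e => ext_face e end.

(** The total variation of a cellwise constant function, extended by zero
    beyond Gamma_l. *)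
Definition variation (m : mesh R l) (w : cv m -> R) : R :=
  \sum_K \sum_(x | is_nb d K x) nb_area K x * `|w K - nb_val w 0 x|.

(** The L1 Poincare inequality on A only, with a constant uniform over meshes. *)
Definition controlled (A : set 'rV[R]_l) : Prop := exists2 C : R, 0 <= C &
  forall m : mesh R l, admissible d m -> forall w : cv m -> R,
    (\sum_K (`|w K|)%:E * lam (A `&` cell K) <= (C * variation w)%:E)%E.

Lemma variation_ge0 (m : mesh R l) (w : cv m -> R) : 0 <= variation w.
Proof.
by apply: sumr_ge0 => K _; apply: sumr_ge0 => x _; rewrite mulr_ge0// nb_area_ge0.
Qed.

Lemma controlledS (A B : set 'rV[R]_l) : measurable A -> measurable B ->
  A `<=` B -> controlled B -> controlled A.
Proof.
move=> mA mB AB [C C0 CB]; exists C => // m Hm w.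
apply: le_trans (CB m Hm w); apply: lee_sum => K _; apply: lee_wpmul2l => //.
have mK := cell_measurable Hm K.
by apply: le_measure; rewrite ?inE; [exact: measurableI|exact: measurableI|exact: setSI].
Qed.

Section fixed_mesh.
Context (m : mesh R l).
Hypothesis (Hm : admissible d m).
Variable (M : R).
Hypothesis (M0 : 0 < M) (OM : closure (Omega d) `<=` cube 0 M).
Variables (D : R) (h : 'rV[R]_l).
Hypothesis (D0 : 0 <= D) (hD : forall i, `|h 0 i| <= D).

Let cst := (2 * (1 + l%:R * (D + 1))) ^+ l.

Lemma cst_ge0 : 0 <= cst.
Proof. by rewrite exprn_ge0// mulr_ge0// addr_ge0// mulr_ge0// addr_ge0. Qed.

Lemma nb_face_cover (K : cv m) (x : nb m) : is_nb d K x -> exists Z,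
  [/\ measurable Z, meets (nb_face K x) h `<=` Z &
     (lam Z <= (cst * nb_area K x)%:E)%E].
Proof.
case: x => [L adj|e _] /=.
  have [b [e1 Ib _]] := normal_outward Hm adj.
  have [Z [mZ mtZ ZI]] := meets_flat D0 hD e1 (interface_measurable K L) Ib.
  by exists Z; split => //; rewrite EFinM -(nb_area_intE Hm OM adj).
have [e1 Ib _] := ext_face_normal Hm e.
have [Z [mZ mtZ ZI]] := meets_flat D0 hD e1 (ext_face_measurable Hm e) Ib.
by exists Z; split => //; rewrite EFinM -(nb_area_extE Hm OM K e).
Qed.

Lemma nonadjacent_cover : exists Z0, [/\ measurable Z0, lam Z0 = 0%E &
  forall K L : cv m, K != L -> ~~ adjacent K L -> meets (interface K L) h `<=` Z0].
Proof.
have : forall KL : cv m * cv m, exists Z, [/\ measurable Z, lam Z = 0%E &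
    KL.1 != KL.2 -> ~~ adjacent KL.1 KL.2 -> meets (interface KL.1 KL.2) h `<=` Z].
  move=> [K L]; have [[KL nadj]|nKL] := pselect (K != L /\ ~~ adjacent K L); last first.
    exists set0; split => [||KL nadj]; [exact: measurable0|exact: measure0|].
    by exfalso; apply: nKL.
  have [eta [b [e1 Ib f0]]] := nonadjacent_flat0 Hm KL nadj.
  have [Z [mZ mtZ ZI]] := meets_flat D0 hD e1 (interface_measurable K L) Ib.
  exists Z; split => //; apply/eqP; rewrite eq_le measure_ge0 andbT.
  by rewrite (le_trans ZI)// f0 mule0.
move=> /choice[Z ZP].
have mZ KL : measurable (Z KL) by have [] := ZP KL.
exists (\big[setU/set0]_KL Z KL); split.
- by apply: bigsetU_measurable => KL _; exact: mZ.
- by apply: bigsetU_null => // KL; have [] := ZP KL.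
- move=> K L KL nadj; have [_ _ sub] := ZP (K, L).
  apply: subset_trans (sub KL nadj) _ => x Zx; rewrite -bigcup_seq.
  by exists (K, L) => //=; rewrite mem_index_enum.
Qed.

(** Integrates a pointwise bound by the jumps crossed along [x, x + h]. The
    starting points whose segment crosses a given face have measure at most cst
    times the area of the face; crossings of interfaces of zero area only occur
    on a null set, which is why adjacency may be assumed pointwise. *)
Lemma crossing_estimate (I : finType) (N : I -> set 'rV[R]_l) (Z0 : set 'rV[R]_l)
    (c : I -> R) (w : cv m -> R) :
  (forall i, measurable (N i)) -> measurable Z0 -> lam Z0 = 0%E ->
  (forall i i', i != i' -> N i `&` N i' = set0) -> (forall i, 0 <= c i) ->
  (forall i x, N i x -> ~ Z0 x ->
    (forall K L : cv m, K != L -> meets (interface K L) h x -> adjacent K L) ->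
    c i <= \sum_K \sum_(y | is_nb d K y && `[< meets (nb_face K y) h x >])
      `|w K - nb_val w 0 y|) ->
  (\sum_i (c i)%:E * lam (N i) <= (cst * variation w)%:E)%E.
Proof.
move=> mN mZ0 Z00 dN c0 cP.
have [Z1 [mZ1 Z10 Z1P]] := nonadjacent_cover.
have : forall Ky : cv m * nb m, exists Z, is_nb d Ky.1 Ky.2 -> [/\ measurable Z,
    meets (nb_face Ky.1 Ky.2) h `<=` Z &
    (lam Z <= (cst * nb_area Ky.1 Ky.2)%:E)%E].
  move=> [K y]; have [nKy|nKy] := boolP (is_nb d K y); last by exists set0.
  by have [Z ZP] := nb_face_cover nKy; exists Z.
move=> /choice[Z ZP].
have mZ01 : measurable (Z0 `|` Z1) by exact: measurableU.
have Z010 : lam (Z0 `|` Z1) = 0%E by rewrite null_set_setU.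
apply: (le_trans (@weighted_measure_le _ _ _ lam I (cv m * nb m)%type N Z (Z0 `|` Z1) c
  (fun Ky => `|w Ky.1 - nb_val w 0 Ky.2|) (fun Ky => is_nb d Ky.1 Ky.2) _ _ _ _ _ _ _ _)) => //.
- by move=> Ky /ZP[].
- move=> i x Nx nZ; have nZ0 : ~ Z0 x by move=> Zx; apply: nZ; left.
  apply: (le_trans (cP i x Nx nZ0 _)).
    move=> K L KL mKL; apply: contrapT => /negP nadj; apply: nZ; right.
    exact: (Z1P K L).
  rewrite pair_big_dep/=; apply: ler_sum_pred => // -[K y] /andP[nKy /asboolP mt] /=.
  rewrite nKy/=; apply/asboolP; have [_ + _] := ZP (K, y) nKy; exact.
- rewrite /variation pair_big_dep/= mulr_sumr -sumEFin; apply: lee_sum => -[K y] /= nKy.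
  have [_ _ le] := ZP (K, y) nKy.
  apply: (le_trans (lee_wpmul2l _ le)); first by rewrite lee_fin.
  by rewrite -EFinM lee_fin mulrA mulrC.
Qed.

(** The closed cells met by the segment form a chain from K to L, linked by the
    interfaces that the segment crosses. *)
Lemma segment_variation (w : cv m -> R) (x : 'rV[R]_l) (s : R) (K L : cv m) :
  0 <= s <= 1 -> (forall t : R, 0 <= t <= s -> closure (Omega d) (x + t *: h)) ->
  (forall K' L' : cv m, K' != L' -> meets (interface K' L') h x -> adjacent K' L') ->
  closure (cell K) x -> closure (cell L) (x + s *: h) ->
  `|w K - w L| <= \sum_K' \sum_(L' | adjacent K' L' && `[< meets (interface K' L') h x >])
      `|w K' - w L'|.
Proof.
move=> /andP[s0 s1] sO adj Kx Ls.
pose e (K' L' : cv m) := adjacent K' L' && `[< meets (interface K' L') h x >].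
have cKL : connect e K L.
  apply: (@closed_cover_connect R l (cv m) (fun K => closure (cell K)) e x (s *: h)) => //.
  - by move=> k; exact: closed_closure.
  - move=> t /andP[t0 t1]; rewrite scalerA.
    have : closure (Omega d) (x + (t * s) *: h).
      by apply: sO; rewrite mulr_ge0//= ler_piMl.
    by rewrite (closure_Omega Hm) => -[k _ kx]; exists k.
  - move=> k k' t /andP[t0 t1]; rewrite scalerA => kx k'x kk'.
    have mk : meets (interface k k') h x.
      by exists (t * s) => //; rewrite mulr_ge0//= mulr_ile1.
    by rewrite /e (adj _ _ kk' mk)/=; apply/asboolP.
exact: (connect_variation w cKL).
Qed.

End fixed_mesh.
End controlled_sets.

(** * Control spreads over convex sets *)

Section spreading.
Context (R : realType) (l : nat) (d : model_data R l).
Hypothesis (Hd : standing_assumptions d).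
Let lam := @lebesgue_rV R l.

Lemma measurable_shift_inter (X Y : set 'rV[R]_l) : measurable X -> measurable Y ->
  measurable_fun setT (fun h => lam [set x | X x /\ Y (x + h)]).
Proof.
move=> mX mY.
have mP : measurable [set xh : 'rV[R]_l * 'rV[R]_l | X xh.1 /\ Y (xh.1 + xh.2)].
  apply: (measurableI [set xh | X xh.1] [set xh | Y (xh.1 + xh.2)]).
    exact: measurable_preim measurable_fst mX.
  apply: (measurable_preim
    (f := fun xh : 'rV[R]_l * 'rV[R]_l => xh.1 + xh.2)) mY.
  by apply: measurable_addv; [exact: measurable_fst|exact: measurable_snd].
have := @measurable_fun_ysection _ _ _ _ R lam _ mP.
rewrite (_ : _ \o _ = (fun h => lam [set x | X x /\ Y (x + h)]))//.
apply/funext => h /=; congr (lam _).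
by apply/seteqP; split => x; rewrite /ysection/= inE.
Qed.

Lemma measure_le_cells (m : mesh R l) (Hm : admissible d m) (A : set 'rV[R]_l) :
  measurable A -> A `<=` closure (Omega d) ->
  (lam A <= \sum_(K : cv m) lam (A `&` cell K))%E.
Proof.
move=> mA AO.
have /choice[Z ZP] := closure_cell_null (m := m) Hm.
have mK K := cell_measurable Hm K.
have := @weighted_measure_le _ _ _ lam unit (cv m) (fun=> A) (fun K => A `&` cell K)
  (\big[setU/set0]_K Z K) (fun=> 1) (fun=> 1) xpredT.
rewrite big_const card_unit/= adde0 mul1e.
have -> : (\sum_(K : cv m) 1 * lam (A `&` cell K) = \sum_(K : cv m) lam (A `&` cell K))%E.
  by apply: eq_bigr => K _; rewrite mul1e.
apply => //.
- by move=> K _; exact: measurableI.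
- by apply: bigsetU_measurable => K _; have [] := ZP K.
- by apply: bigsetU_null => K; have [] := ZP K.
- move=> _ x Ax nZ; have := AO x Ax; rewrite (closure_Omega Hm) => -[K _ Kx].
  have cKx : cell K x.
    apply: contrapT => nK; apply: nZ; rewrite -bigcup_seq; exists K => /=.
      by rewrite mem_index_enum.
    by have [_ _] := ZP K; apply.
  rewrite (bigD1 K)/=; last by apply/asboolP.
  by rewrite lerDl; exact: sumr_ge0.
Qed.

Lemma sum_cells_le (m : mesh R l) (Hm : admissible d m) (A : set 'rV[R]_l) :
  measurable A -> (\sum_(K : cv m) lam (A `&` cell K) <= lam A)%E.
Proof.
move=> mA; have mK K := cell_measurable Hm K.
apply: (@sum_almost_disjoint _ _ _ lam (cv m) (index_enum (cv m)) (fun K => A `&` cell K)) => //.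
- exact: index_enum_uniq.
- by move=> K _; exact: measurableI.
- move=> K L _ _ KL; rewrite setIACA (cell_disjoint Hm KL) setI0 measure0//.
Qed.

(** The values of w on Q are compared with those on A along segments, which stay
    in the convex set Q: the sum of |w K - w L| over pairs of cells, weighted by
    the measures of Q in K and A in L, is the integral over h of crossing
    estimates for the segments [x, x + h] with x in Q and x + h in A. Dividing
    by the measure of A bounds w on Q. *)
Lemma controlled_spread (Q A : set 'rV[R]_l) :
  measurable Q -> measurable A -> A `<=` Q -> Q `<=` Omega d ->
  (forall x y (t : R), Q x -> Q y -> 0 <= t <= 1 -> Q (x + t *: (y - x))) ->
  (0 < lam A)%E -> controlled d A -> controlled d Q.
Proof.
move=> mQ mA AQ QO cQ A0 [C C0 CA].
have [M M0 OM] := Omega_cube Hd.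
have OcO : Omega d `<=` closure (Omega d) by exact: subset_closure.
have QM : Q `<=` cube 0 M := subset_trans QO (subset_trans OcO OM).
have M2 : 0 <= 2 * M by lra.
have fin X : measurable X -> X `<=` Q -> lam X = (fine (lam X))%:E.
  move=> mX XQ; rewrite fineK// ge0_fin_numE//.
  apply: (@le_lt_trans _ _ (lam (cube 0 M))).
    by apply: le_measure; rewrite ?inE; [|exact: measurable_cube|exact: subset_trans QM].
  by rewrite [X in (X < _)%E]lebesgue_cube ?ltW// ltry.
pose cst := (2 * (1 + l%:R * (2 * M + 1))) ^+ l.
have cst0 : 0 <= cst by exact: cst_ge0.
pose alpha := fine (lam A).
have alpha0 : 0 < alpha by rewrite -lte_fin -fin.
pose B := (2 * (2 * M)) ^+ l.
have B0 : 0 <= B by rewrite exprn_ge0// mulr_ge0.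
exists ((cst * B + fine (lam Q) * C) / alpha).
  by rewrite divr_ge0 ?addr_ge0 ?mulr_ge0 ?fine_ge0// ltW.
move=> m Hm w; have mK K := cell_measurable Hm K.
pose q K := fine (lam (Q `&` cell (m := m) K)).
pose a K := fine (lam (A `&` cell (m := m) K)).
have qE K : lam (Q `&` cell (m := m) K) = (q K)%:E.
  by apply: fin; [exact: measurableI|move=> x []].
have aE K : lam (A `&` cell (m := m) K) = (a K)%:E.
  by apply: fin; [exact: measurableI|move=> x [/AQ]].
have q0 K : 0 <= q K by rewrite fine_ge0.
have a0 K : 0 <= a K by rewrite fine_ge0.
have sumq : \sum_K q K <= fine (lam Q).
  rewrite -lee_fin -fin// -sumEFin; under eq_bigr do rewrite -qE.
  exact: sum_cells_le.
have suma : alpha <= \sum_K a K.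
  rewrite -lee_fin -fin// -sumEFin; under eq_bigr do rewrite -aE.
  by apply: measure_le_cells => //; apply: subset_trans OcO; exact: subset_trans QO.
have V0 : 0 <= variation d w by exact: variation_ge0.
have aw : \sum_K `|w K| * a K <= C * variation d w.
  rewrite -lee_fin -sumEFin; apply: le_trans (CA m Hm w).
  by apply: lee_sum => K _; rewrite EFinM aE.
(* q K * a L is the integral over h of the measure of N h (K, L) below. *)
have key : \sum_K \sum_L `|w K - w L| * (q K * a L) <= cst * variation d w * B.
  rewrite -lee_fin pair_big/= -sumEFin.
  pose N (h : 'rV[R]_l) (KL : cv m * cv m) :=
    [set x | (Q `&` cell KL.1) x /\ (A `&` cell KL.2) (x + h)].
  have mN h KL : measurable (N h KL).
    apply: (measurableI (Q `&` cell KL.1)); first exact: measurableI.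
    apply: (measurable_preim (f := fun x : 'rV[R]_l => x + h)); first exact: measurable_add_rV.
    exact: measurableI.
  rewrite (eq_bigr (fun KL => (\int[lam]_h (`|w KL.1 - w KL.2|%R%:E * lam (N h KL)))%E)); last first.
    move=> [K L] _ /=; rewrite !EFinM -qE -aE ge0_integralZl//; last first.
      by apply: measurable_shift_inter; exact: measurableI.
    congr (_ * _)%E; symmetry.
    by apply: (@lebesgue_rV_shift_tonelli R l idfun); [exact: measurable_id|
      exact: measurableI|exact: measurableI].
  rewrite -ge0_integral_sum//; last 2 first.
  - move=> KL; apply: emeasurable_funM => //.
    by apply: measurable_shift_inter; exact: measurableI.
  - by move=> KL h _; rewrite mule_ge0// lee_fin.
  apply: (@le_trans _ _ (\int[lam]_h ((cst * variation d w)%:E * (\1_(cube 0 (2 * M)) h)%:E)))%E.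
    apply: ge0_le_integral => //.
    - by move=> h _; apply: sume_ge0 => KL _; rewrite mule_ge0// lee_fin.
    - apply: emeasurable_sum => KL; apply: emeasurable_funM => //.
      by apply: measurable_shift_inter; exact: measurableI.
    - apply: emeasurable_funM => //; apply/measurable_EFinP.
      by apply: measurable_indic; exact: measurable_cube.
    move=> h _; rewrite indicE; case: (boolP (h \in _)) => [/set_mem hM|/negP hM].
      rewrite mule1.
      apply: (crossing_estimate Hm OM (h := h) M2 _ (N := N h) (Z0 := set0)) => //.
      + by move=> i; have := hM i; rewrite -ler_distl mxE subr0.
      + move=> [K L] [K' L'] KL; rewrite -subset0 => x [[/= [_ Kx] [_ Lx]] [[_ K'x] [_ L'x]]].
        have [KK|KK] := eqVneq K K'.
          have LL : L != L' by apply: contraNneq KL => ->; rewrite KK.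
          have : (cell L `&` cell L') (x + h) by [].
          by rewrite (cell_disjoint Hm LL).
        have : (cell K `&` cell K') x by [].
        by rewrite (cell_disjoint Hm KK).
      + move=> [K L] x [[Qx Kx] [Ax Lx]] _ adj /=.
        apply: (@le_trans _ _ (\sum_K' \sum_(L' | adjacent K' L' &&
            `[< meets (interface K' L') h x >]) `|w K' - w L'|)); last first.
          by apply: ler_sum => K' _; rewrite big_sumType/= lerDl; exact: sumr_ge0.
        apply: (@segment_variation _ _ _ _ Hm h w x 1 K L) => //.
        * by rewrite ler01 lexx.
        * move=> t t01; apply: OcO; apply: QO.
          by have := cQ x (x + h) t Qx (AQ _ Ax) t01; rewrite addrAC subrr add0r.
        * exact: subset_closure.
        * by rewrite scale1r; exact: subset_closure.
    rewrite mule0 big1// => KL _; rewrite (_ : N h KL = set0) ?measure0 ?mule0//.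
    rewrite -subset0 => x [[Qx _] [/AQ Ax _]]; apply: hM; apply/mem_set => i.
    have := QM _ Qx i; have := QM _ Ax i; rewrite !mxE => /andP[h1 h2] /andP[h3 h4].
    by apply/andP; split; lra.
  rewrite ge0_integralZl//; last 2 first.
  - by apply/measurable_EFinP; apply: measurable_indic; exact: measurable_cube.
  - by rewrite lee_fin mulr_ge0.
  rewrite integral_indic ?setIT//; last exact: measurable_cube.
  by rewrite [X in (_ * X)%E]lebesgue_cube// -EFinM.
rewrite (eq_bigr (fun K => (`|w K| * q K)%:E)) => [|K _]; last by rewrite qE EFinM.
rewrite sumEFin lee_fin mulrAC ler_pdivlMr// mulrC.
apply: (@le_trans _ _ ((\sum_L a L) * \sum_K `|w K| * q K)).
  by rewrite ler_wpM2r// sumr_ge0// => K _; rewrite mulr_ge0.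
have -> : (\sum_L a L) * (\sum_K `|w K| * q K) = \sum_K \sum_L `|w K| * (q K * a L).
  rewrite mulrC mulr_suml; apply: eq_bigr => K _; rewrite mulr_sumr.
  by apply: eq_bigr => L _; rewrite mulrA.
apply: (@le_trans _ _ (\sum_K \sum_L `|w K - w L| * (q K * a L) +
   (\sum_K q K) * (\sum_L `|w L| * a L))).
  rewrite mulr_suml -big_split/=; apply: ler_sum => K _.
  rewrite mulr_sumr -big_split/=; apply: ler_sum => L _.
  rewrite (_ : q K * (`|w L| * a L) = `|w L| * (q K * a L)); last by ring.
  rewrite -mulrDl ler_wpM2r ?mulr_ge0//.
  by rewrite -{1}(subrK (w L) (w K)) ler_normD.
rewrite mulrDl lerD//; first by rewrite mulrAC.
by rewrite -mulrA; apply: ler_pM => //; apply: sumr_ge0 => K _; rewrite ?mulr_ge0.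
Qed.

End spreading.

(** * A controlled set next to the Dirichlet boundary *)

Section poincare.
Context (R : realType) (l : nat) (d : model_data R l).
Hypothesis (Hd : standing_assumptions d).
Let lam := @lebesgue_rV R l.

Lemma flat_gt0_piece (I : countType) (eta : 'rV[R]_l) (b : R) (S : set 'rV[R]_l)
    (T : I -> set 'rV[R]_l) : enorm eta = 1 -> S `<=` hyperplane eta b ->
  measurable S -> (forall i, measurable (T i)) -> S `<=` \bigcup_i T i ->
  (0 < flat_measure eta S)%E -> exists i, (0 < flat_measure eta (S `&` T i))%E.
Proof.
move=> e1 Sb mS mT ST S0; apply: contrapT => nT.
have Ib i : S `&` T i `<=` hyperplane eta b by move=> x [/Sb].
have mI i : measurable (prism (S `&` T i) eta).
  by apply: (measurable_flat_prism e1 (Ib i)); exact: measurableI.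
have T0 i : lam (prism (S `&` T i) eta) = 0%E.
  apply/eqP; rewrite eq_le measure_ge0 andbT leNgt; apply/negP => h.
  by apply: nT; exists i.
pose F k := if @unpickle I k is Some i then prism (S `&` T i) eta else set0.
have FN : lam.-negligible (\bigcup_k F k).
  apply: negligible_bigcup => k; rewrite /F; case: unpickle => [i|].
    by apply/negligibleP; [exact: mI|exact: T0].
  exact: negligible_set0.
have mF : measurable (\bigcup_k F k).
  by apply: bigcupT_measurable => k; rewrite /F; case: unpickle => [i|//]; exact: mI.
have := S0; rewrite flat_measureE (@sub_null _ _ _ (\bigcup_k F k)) ?ltxx//.
- exact: measurable_flat_prism e1 Sb mS.
- move=> _ [y [t [Sy t01 ->]]]; have [i _ Ti] := ST y Sy.
  by exists (pickle i) => //; rewrite /F pickleK; exists y, t.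
- by move/(negligibleP lam mF) : FN.
Qed.

(** Some part S1 of positive area of Gamma_l lies in one hyperplane and in the
    closure of one convex piece of Omega. With c in the interior of that piece,
    off the hyperplane, and S a small part of S1 around z, the set A is swept by
    S along v = c - z: from each of its points the direction - v leads back to S
    inside the piece. *)
Lemma exit_set : exists hs A eta b (h : 'rV[R]_l) (D : R),
  [/\ open_polyhedron hs `<=` Omega d, A `<=` open_polyhedron hs, measurable A,
     (0 < lam A)%E & [/\ enorm eta = 1, 0 <= D, (forall i, `|h 0 i| <= D) &
     forall x, A x -> exists t : R, [/\ 0 <= t <= 1,
       (Gamma_l d `&` hyperplane eta b) (x + t *: h) &
       forall s, 0 <= s <= t -> closure (Omega d) (x + s *: h)]]].
Proof.
have [eta [b [e1 pos]]] := Gamma_l_pos Hd.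
have [ps [ps0 psO psc _]] := Omega_pieces Hd.
set S0 := Gamma_l d `&` hyperplane eta b in pos.
have mS0 : measurable S0.
  by apply: measurableI; [exact: Gamma_l_measurable Hd|exact: measurable_hyperplane].
have S0b : S0 `<=` hyperplane eta b by move=> x [].
have mC hs : measurable (closed_polyhedron hs : set 'rV[R]_l).
  by apply: closed_measurable_rV; exact: closed_polyhedron_closed.
have [k posk] : exists k : nat,
    (0 < flat_measure eta (S0 `&` (if (k < size ps)%N then
      closed_polyhedron (nth [::] ps k) else set0)))%E.
  apply: (flat_gt0_piece (b := b)) => //.
    by move=> k; case: ifP => _ //; exact: mC.
  move=> x [Gx _]; have : frontier (Omega d) x by rewrite (Gamma_cover Hd); left.
  move=> [/psc[hs hsp hx] _]; exists (index hs ps) => //.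
  by rewrite index_mem hsp nth_index.
have kps : (k < size ps)%N.
  move: posk; case: ifP => // _; rewrite setI0 flat_measureE.
  rewrite (_ : prism set0 eta = set0) ?measure0 ?ltxx// -subset0.
  by move=> x [y [t []]].
rewrite kps in posk; set hs := nth [::] ps k in posk.
have hsp : hs \in ps by exact: mem_nth.
set S1 := S0 `&` closed_polyhedron hs in posk.
have mS1 : measurable S1 by exact: measurableI.
have oP : open (open_polyhedron hs) by exact: open_polyhedron_open.
have mP := open_measurable_rV oP.
have hs0 := ps0 _ hsp.
have [c cP cb] : exists2 c, open_polyhedron hs c & dotv eta c != b.
  apply: contrapT => nc; have := open_gt0 oP mP hs0.
  rewrite (@sub_null _ _ _ (hyperplane eta b)) ?ltxx//.
  - exact: measurable_hyperplane.
  - by move=> x Px; apply/eqP/negPn/negP => xb; apply: nc; exists x.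
  - by apply: hyperplane_null; exact: enorm_neq0.
have [r r0 rP] := iffLR (open_cubeP _) oP c cP.
have [q posq] : exists q : 'rV[rat]_l,
    (0 < flat_measure eta (S1 `&` cube (map_mx ratr q) (r / 2)))%E.
  apply: (flat_gt0_piece (b := b)) => //.
  - by move=> x [/S0b].
  - by move=> q; exact: measurable_cube.
  - by move=> x _; have [|q qx] := @rat_cube R l x (r / 2); [lra|exists q].
set S := S1 `&` _ in posq.
have mS : measurable S by apply: measurableI => //; exact: measurable_cube.
have Sb : S `<=` hyperplane eta b by move=> x [[/S0b]].
have [z Sz] : S !=set0.
  apply: contrapT => S_0; move: posq; rewrite flat_measureE.
  rewrite (_ : prism S eta = set0) ?measure0 ?ltxx// -subset0.
  by move=> x [y [t [Sy _ _]]]; apply: S_0; exists y.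
pose v := c - z.
have ev : dotv eta v != 0 by rewrite dotvBr (Sb _ Sz) subr_eq0.
have mpr : measurable (prism S v) by exact: measurable_prism Sb ev mS.
(* y and z are within r / 2 of a common point, so that y + v is within r of c. *)
have inside y (t : R) : S y -> 0 < t -> t <= 1 -> open_polyhedron hs (y + t *: v).
  move=> Sy t0 t1.
  rewrite (_ : y + t *: v = (1 - t) *: y + t *: (y + v)); last first.
    by apply/rowP => i; rewrite !mxE; ring.
  apply: open_polyhedron_mix => //; first by case: Sy => -[].
  apply: rP => i; have [_ /(_ i) h1] := Sy; have [_ /(_ i) h2] := Sz.
  have -> : (y + v) 0 i = y 0 i + c 0 i - z 0 i by rewrite !mxE addrA.
  move: h1 h2.
  by move: (map_mx _ _ _ _) => u /andP[h1 h2] /andP[h3 h4]; apply/andP; split; lra.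
have clP : closed_polyhedron hs `<=` closure (Omega d).
  by rewrite -closure_open_polyhedron//; apply: closure_subset; exact: psO.
have mA : measurable (prism S v `&` open_polyhedron hs) by exact: measurableI.
exists hs, (prism S v `&` open_polyhedron hs), eta, b, (- v), (\sum_i `|v 0 i|).
split => //.
- exact: psO.
- have := prism_gt0 e1 Sb ev mS posq; rewrite (measureDI lam mpr mP).
  rewrite [X in (_ < X + _)%E -> _](_ : _ = 0%E) ?add0e//.
  apply: (@sub_null _ _ _ (hyperplane eta b)).
  + exact: measurableD.
  + exact: measurable_hyperplane.
  + move=> x [[y [t [Sy /andP[t0 t1] ->]]] nP].
    have [t00|t00] := eqVneq t 0; first by rewrite t00 scale0r addr0; exact: Sb.
    by exfalso; apply: nP; apply: inside => //; rewrite lt_def t00.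
  + by apply: hyperplane_null; exact: enorm_neq0.
split => //.
- by apply: sumr_ge0.
- by move=> i; rewrite mxE normrN (bigD1 i)//= lerDl sumr_ge0.
move=> x [[y [t [Sy /andP[t0 t1] xE]]] _].
have xs s : x + s *: - v = y + (t - s) *: v.
  by rewrite xE; apply/rowP => i; rewrite !mxE; ring.
exists t; split; rewrite ?t0//.
- by rewrite xs subrr scale0r addr0; case: Sy => -[].
move=> s /andP[s0 st]; rewrite xs; apply: clP.
have [ts|ts] := eqVneq (t - s) 0.
  by rewrite ts scale0r addr0; case: Sy => -[].
by apply: open_polyhedronW; apply: inside => //; rewrite ?lt_def ?ts/=; lra.
Qed.

(** From almost every point of the exit set the segment along h leaves Omega
    through an exterior face contained in Gamma_l, where the function is extended
    by zero. The jumps crossed on the way, the last one included, bound |w|. *)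
Lemma controlled_exit_set : exists hs A, [/\ open_polyhedron hs `<=` Omega d,
  A `<=` open_polyhedron hs, measurable A, (0 < lam A)%E & controlled d A].
Proof.
have [hs [A [eta [b [h [D [hsO Ahs mA A0 [e1 D0 hD exitA]]]]]]]] := exit_set.
exists hs, A; split => //.
have [M M0 OM] := Omega_cube Hd.
exists ((2 * (1 + l%:R * (D + 1))) ^+ l); first exact: cst_ge0.
move=> m Hm w.
have mH := measurable_hyperplane eta b.
have mF : measurable (frontier (Omega d)).
  by rewrite (Gamma_cover Hd); apply: measurableU;
    [exact: Gamma_l_measurable Hd|exact: Gamma_imp_measurable Hd].
(* Exits missed by the exterior faces of a cell, and, for None, exits that also
   belong to Gamma_imp. *)
pose T (L : option (cv m)) := hyperplane eta b `&` if L is Some L then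
  (closure (cell L) `&` frontier (Omega d)) `\`
     \bigcup_(e in [set e | ext_cell e = L]) ext_face e
  else Gamma_l d `&` Gamma_imp d.
have Tb L : T L `<=` hyperplane eta b by move=> x [].
have TN L : exists Z, [/\ measurable Z, meets (T L) h `<=` Z & lam Z = 0%E].
  have [mT f0] : measurable (T L) /\ flat_measure eta (T L) = 0%E.
    case: L => [L|].
      have mU : measurable ((closure (cell L) `&` frontier (Omega d)) `\`
         \bigcup_(e in [set e | ext_cell e = L]) ext_face e).
        apply: measurableD; first by apply: measurableI => //; exact: closure_cell_measurable.
        by apply: fin_bigcup_measurable => [|e _]; [exact: finite_finset|exact: ext_face_measurable Hm e].
      split; first exact: measurableI.
      apply: (npos_measure_flat0 (b := b) e1); [exact: measurableI|by move=> x []|].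
      move=> [eta' [b' [e1' pos]]]; apply: (ext_face_cover Hm (K := L)).
      exists eta', b'; split => //; apply: lt_le_trans pos _.
      apply: (flat_measure_le (b := b') e1') => //.
      - by apply: measurableI; [exact: measurableI|exact: measurable_hyperplane].
      - by apply: measurableI => //; exact: measurable_hyperplane.
      - by move=> x [[]].
    have mU : measurable (Gamma_l d `&` Gamma_imp d).
      by apply: measurableI; [exact: Gamma_l_measurable Hd|exact: Gamma_imp_measurable Hd].
    split; first exact: measurableI.
    apply: (npos_measure_flat0 (b := b) e1); [exact: measurableI|by move=> x []|].
    move=> [eta' [b' [e1' pos]]]; apply: (Gamma_overlap Hd).
    exists eta', b'; split => //; apply: lt_le_trans pos _.
    apply: (flat_measure_le (b := b') e1') => //.
    - by apply: measurableI; [exact: measurableI|exact: measurable_hyperplane].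
    - by apply: measurableI => //; exact: measurable_hyperplane.
    - by move=> x [[]].
  have [Z [mZ mtZ ZI]] := meets_flat D0 hD e1 mT (Tb L).
  exists Z; split => //; apply/eqP; rewrite eq_le measure_ge0 andbT.
  by rewrite (le_trans ZI)// f0 mule0.
have /choice[Z ZP] := TN.
have mZ L : measurable (Z L) by have [] := ZP L.
pose Z0 := \big[setU/set0]_L Z L.
have Z0P L : Z L `<=` Z0.
  by move=> x Zx; rewrite /Z0 -bigcup_seq; exists L => //=; rewrite mem_index_enum.
have mK K := cell_measurable Hm K.
apply: (crossing_estimate Hm OM D0 hD (N := fun K => A `&` cell K) (Z0 := Z0)) => //.
- by move=> K; exact: measurableI.
- exact: bigsetU_measurable.
- by apply: bigsetU_null => // L; have [] := ZP L.
- by move=> K L KL; rewrite setIACA (cell_disjoint Hm KL) setI0.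
move=> K x [Ax Kx] nZ adj.
have [t [/andP[t0 t1] [Gz Hz] seg]] := exitA x Ax.
have cz : closure (Omega d) (x + t *: h) by apply: seg; rewrite lexx t0.
have fz : frontier (Omega d) (x + t *: h) by rewrite (Gamma_cover Hd); left.
have [L _ Lz] : (\bigcup_(K in [set: cv m]) closure (cell K)) (x + t *: h).
  by rewrite -(closure_Omega Hm).
have nT L' : ~ T L' (x + t *: h).
  move=> Tz; apply: nZ; apply: (Z0P L'); have [_ + _] := ZP L'; apply.
  by exists t => //; rewrite t0.
have [e eL ez] : exists2 e, ext_cell e = L & ext_face e (x + t *: h).
  apply: contrapT => ne; apply: (nT (Some L)); split => //; split => //.
have eG : ext_face e `<=` Gamma_l d.
  have [//|eI] := ext_face_split Hm e; exfalso; apply: (nT None); split => //.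
  by split => //; exact: eI.
have wL : `|w L| <= \sum_K' \sum_(f : ext m | is_nb d K' (inr f) &&
    `[< meets (ext_face f) h x >]) `|w K' - 0|.
  have neL : is_nb d L (inr e) by rewrite /= eL eqxx/=; apply/asboolP.
  rewrite (bigD1 L)//= (bigD1 e)/=; last first.
    by move: neL => /= ->; apply/asboolP; exists t => //; rewrite t0.
  rewrite subr0 -addrA lerDl addr_ge0//; first exact: sumr_ge0.
  by apply: sumr_ge0 => K' _; exact: sumr_ge0.
have wKL : `|w K - w L| <= \sum_K' \sum_(L' | adjacent K' L' &&
    `[< meets (interface K' L') h x >]) `|w K' - w L'|.
  apply: (segment_variation Hm w (s := t)) => //; first by rewrite t0.
  exact: subset_closure.
have -> : `|w K| = `|(w K - w L) + w L| by rewrite subrK.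
rewrite (le_trans (ler_normD _ _))// (le_trans (lerD wKL wL))//.
by rewrite -big_split/=; apply: ler_sum => K' _; rewrite big_sumType/=.
Qed.

End poincare.

(** * The discrete Poincare inequality in total variation *)

Section poincare_inequality.
Context (R : realType) (l : nat) (d : model_data R l).
Hypothesis (Hd : standing_assumptions d).
Let lam := @lebesgue_rV R l.

Lemma cube_convex (c : 'rV[R]_l) (r : R) x y (t : R) : cube c r x -> cube c r y ->
  0 <= t <= 1 -> cube c r (x + t *: (y - x)).
Proof.
move=> cx cy /andP[t0 t1] i; have := cx i; have := cy i; rewrite !mxE.
move=> /andP[h1 h2] /andP[h3 h4].
have -> : x 0 i + t * (y 0 i - x 0 i) = (1 - t) * x 0 i + t * y 0 i by ring.
have t1' : 0 <= 1 - t by lra.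
have := ler_wpM2l t1' h3; have := ler_wpM2l t1' h4.
have := ler_wpM2l t0 h1; have := ler_wpM2l t0 h2.
by move=> ? ? ? ?; apply/andP; split; lra.
Qed.

Lemma open_polyhedron_convex hs (x y : 'rV[R]_l) (t : R) : open_polyhedron hs x ->
  open_polyhedron hs y -> 0 <= t <= 1 -> open_polyhedron hs (x + t *: (y - x)).
Proof.
move=> hx hy /andP[t0 t1]; have [->|tn0] := eqVneq t 0.
  by rewrite scale0r addr0.
rewrite (_ : x + _ = (1 - t) *: x + t *: y); last first.
  by apply/rowP => i; rewrite !mxE; ring.
by apply: open_polyhedron_mix => //; [exact: open_polyhedronW|rewrite lt_def tn0].
Qed.

Lemma cube_lam_gt0 (c : 'rV[R]_l) (r : R) : 0 < r -> (0 < lam (cube c r))%E.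
Proof.
by move=> r0; rewrite [lam _]lebesgue_cube ?ltW// lte_fin exprn_gt0// mulr_gt0.
Qed.

(** The points with a controlled neighbourhood form an open set, nonempty by
    controlled_exit_set, and closed in Omega because control spreads from a small
    cube to a larger one. Omega is connected. *)
Lemma controlled_cubes : forall x, Omega d x -> exists r : R,
  [/\ 0 < r, cube x r `<=` Omega d & controlled d (cube x r)].
Proof.
have oO : open (Omega d).
  by have [ps ->] := Omega_polygonal Hd; exact: open_interior.
pose G := [set x | Omega d x /\ exists r : R,
  [/\ 0 < r, cube x r `<=` Omega d & controlled d (cube x r)]].
suff GO : G = Omega d by move=> x; rewrite -{1}GO => -[_].
have mcube c r := @measurable_cube R l c r.
have Gnear x : Omega d x -> closure G x -> G x.
  move=> Ox cG; split => //.
  have [r r0 rO] := iffLR (open_cubeP _) oO x Ox.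
  have [y [Gy xy]] : G `&` cube x (r / 2) !=set0.
    by apply: cG; apply/nbhs_cube; exists (r / 2) => //; rewrite divr_gt0.
  have [_ [r' [r'0 r'O cr']]] := Gy.
  exists r; split => //.
  pose s := Num.min r' (r / 2).
  have s0 : 0 < s by rewrite lt_min r'0 divr_gt0.
  have sr : s <= r / 2 by rewrite ge_min lexx orbT.
  apply: (controlled_spread Hd (A := cube y s)) => //.
  - move=> z yz i; have := xy i; have := yz i => /andP[h1 h2] /andP[h3 h4].
    by apply/andP; split; lra.
  - by move=> a b t; exact: cube_convex.
  - exact: cube_lam_gt0.
  - apply: (controlledS _ _ _ cr') => //.
    by apply: cube_le; rewrite ge_min lexx.
have oG : open G.
  apply/open_cubeP => x [Ox [r [r0 rO cr]]].
  exists (r / 2); first by rewrite divr_gt0.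
  move=> y xy; split.
    by apply: rO; apply: (cube_le (r := r / 2)) => //; lra.
  have sub : cube y (r / 2) `<=` cube x r.
    move=> z yz i; have := xy i; have := yz i => /andP[h1 h2] /andP[h3 h4].
    by apply/andP; split; lra.
  exists (r / 2); split; first by rewrite divr_gt0.
    exact: subset_trans rO.
  exact: controlledS sub cr.
apply: (Omega_connected Hd).
- have [hs [A [hsO Ahs mA A0 cA]]] := controlled_exit_set Hd.
  have oP : open (open_polyhedron hs) by exact: open_polyhedron_open.
  have chs : controlled d (open_polyhedron hs).
    apply: (controlled_spread Hd (A := A)) => //.
      exact: open_measurable_rV.
    by move=> a b t; exact: open_polyhedron_convex.
  have [x Ax] : A !=set0.
    apply: contrapT => nA; move: A0; rewrite (_ : A = set0) ?measure0 ?ltxx//.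
    by rewrite -subset0 => x Ax; apply: nA; exists x.
  have [r r0 rP] := iffLR (open_cubeP _) oP x (Ahs _ Ax).
  exists x; split; first by apply: hsO; exact: Ahs.
  exists r; split => //; first exact: subset_trans hsO.
  by apply: controlledS rP chs => //; exact: open_measurable_rV.
- exists G => //; apply/seteqP; split => [x Gx|x [_ //]].
  by split => //; case: Gx.
- exists (closure G); first exact: closed_closure.
  apply/seteqP; split => [x Gx|x [Ox cx]].
    by split; [case: Gx|exact: subset_closure].
  exact: Gnear.
Qed.

(** Each of the convex pieces of Omega contains a controlled cube, so that
    control spreads to the piece; the pieces cover Omega up to a null set. *)
Lemma controlled_Omega : controlled d (Omega d).
Proof.
have [ps [ps0 psO psc _]] := Omega_pieces Hd.
have cps hs : hs \in ps -> controlled d (open_polyhedron hs).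
  move=> hp; have [x hx] := ps0 _ hp.
  have oP : open (open_polyhedron hs) by exact: open_polyhedron_open.
  have [r [r0 rO cr]] := controlled_cubes (psO _ hp _ hx).
  have [r' r'0 r'P] := iffLR (open_cubeP _) oP x hx.
  pose s := Num.min r r'.
  have s0 : 0 < s by rewrite lt_min r0 r'0.
  apply: (controlled_spread Hd (A := cube x s)).
  - exact: open_measurable_rV.
  - exact: measurable_cube.
  - by apply: subset_trans r'P; apply: cube_le; rewrite ge_min lexx orbT.
  - exact: psO.
  - by move=> a b t; exact: open_polyhedron_convex.
  - exact: cube_lam_gt0.
  - apply: (controlledS _ _ _ cr); [exact: measurable_cube|exact: measurable_cube|].
    by apply: cube_le; rewrite ge_min lexx.
have oO : open (Omega d).
  by have [qs ->] := Omega_polygonal Hd; exact: open_interior.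
have mO := open_measurable_rV oO.
have mP hs : measurable (open_polyhedron hs : set 'rV[R]_l).
  by apply: open_measurable_rV; exact: open_polyhedron_open.
have U_ind (A : set 'rV[R]_l) (B : set 'rV[R]_l) : measurable A -> measurable B ->
    controlled d A -> controlled d B -> controlled d (A `|` B).
  move=> mA mB [C C0 CA] [C' C'0 CB]; exists (C + C') => [|m Hm w]; first exact: addr_ge0.
  rewrite mulrDl EFinD; apply: le_trans (leeD (CA m Hm w) (CB m Hm w)).
  rewrite -big_split/=; apply: lee_sum => K _.
  have mK := cell_measurable Hm K.
  rewrite -ge0_muleDr//; apply: lee_wpmul2l => //.
  by rewrite setIUl measureU2//; exact: measurableI.
have cU : measurable (\big[setU/set0]_(hs <- ps) open_polyhedron hs) /\
    controlled d (\big[setU/set0]_(hs <- ps) open_polyhedron hs).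
  elim: ps cps {ps0 psO psc} => [_|hs ps IH cps].
    rewrite big_nil; split; first exact: measurable0.
    exists 0 => // m Hm w; rewrite mul0r big1// => K _.
    by rewrite set0I measure0 mule0.
  have [|mU cU] := IH; first by move=> k kp; apply: cps; rewrite inE kp orbT.
  rewrite big_cons; split; first exact: measurableU.
  by apply: U_ind => //; apply: cps; rewrite mem_head.
case: cU => mU [C C0 CU].
exists C => // m Hm w; apply: le_trans (CU m Hm w); apply: lee_sum => K _.
have mK := cell_measurable Hm K.
apply: lee_wpmul2l => //.
set U := \big[setU/set0]_(hs <- ps) _ in mU *.
have mOK : measurable (Omega d `&` cell K) by exact: measurableI.
have mUK : measurable (U `&` cell K) by exact: measurableI.
have mN : measurable (hyperplane_union (flatten ps)).
  by apply: closed_measurable_rV; exact: closed_hyperplane_union.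
apply: (@le_trans _ _ (lam ((U `&` cell K) `|` hyperplane_union (flatten ps)))); last first.
  by rewrite measureU0//; exact: hyperplane_union_null.
apply: le_measure; rewrite ?inE//; first exact: measurableU.
move=> x [Ox Kx]; have [hs hp hx] := psc _ (subset_closure Ox).
have [ox|nox] := pselect (open_polyhedron hs x).
  by left; split => //; rewrite /U -bigcup_seq; exists hs.
have nd := open_polyhedron_nondegenerate (ps0 _ hp).
right; have [h hh hE] := polyhedron_boundary nd (conj hx nox).
by exists h => //; apply/flattenP; exists hs.
Qed.

Lemma poincare_variation : exists2 C : R, 0 <= C & forall m : mesh R l,
  admissible d m -> forall w : cv m -> R,
  \sum_K volume K * `|w K| <= C * variation d w.
Proof.
have [M M0 OM] := Omega_cube Hd; have [C C0 CO] := controlled_Omega.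
exists C => // m Hm w; rewrite -lee_fin -sumEFin; apply: le_trans (CO m Hm w).
apply: lee_sum => K _; rewrite EFinM muleC setIidr; last exact: cell_sub_Omega.
by rewrite -(volumeE Hd Hm M0 OM).
Qed.

End poincare_inequality.

(** * Integrals over oriented intervals *)

Section oriented_integral.
Context (R : realType).
Implicit Types (f g : R -> R) (a b c m M : R).

Definition itv_int f a b : R := \int[lebesgue_measure]_(x in `[a, b]) f x.

Lemma itv_integrable f a b : {within `[a, b], continuous f} ->
  lebesgue_measure.-integrable `[a, b] (EFin \o f).
Proof.
by move=> cf; apply: continuous_compact_integrable => //; exact: segment_compact.
Qed.

Lemma within_sub f m M a b : {within `[m, M], continuous f} -> m <= a -> b <= M ->
  {within `[a, b], continuous f}.
Proof.
move=> cf ma bM; apply: continuous_subspaceW cf.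
by apply: subset_itvScc => //; rewrite bnd_simp.
Qed.

Lemma itv_int_self f a : itv_int f a a = 0.
Proof. by rewrite /itv_int set_itv1 Rintegral_set1. Qed.

Lemma itv_int_oo f a b : {within `[a, b], continuous f} ->
  itv_int f a b = \int[lebesgue_measure]_(x in `]a, b[) f x.
Proof.
move=> cf; have cI := itv_integrable cf; rewrite /itv_int.
rewrite -Rintegral_itv_bndo_bndc -?Rintegral_itv_obnd_cbnd//.
- by apply: integrableS cI => //; apply: subset_itv; rewrite bnd_simp.
- by apply: integrableS cI => //; apply: subset_itv; rewrite bnd_simp.
Qed.

Lemma itv_int_le f g a b : {within `[a, b], continuous f} ->
  {within `[a, b], continuous g} -> (forall x, a < x < b -> f x <= g x) ->
  itv_int f a b <= itv_int g a b.
Proof.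
move=> cf cg fg; rewrite !itv_int_oo//; apply: le_Rintegral => //.
- by apply: integrableS (itv_integrable cf) => //; apply: subset_itv; rewrite bnd_simp.
- by apply: integrableS (itv_integrable cg) => //; apply: subset_itv; rewrite bnd_simp.
Qed.

Lemma itv_int_cst a b c : a <= b -> itv_int (fun=> c) a b = c * (b - a).
Proof.
move=> ab; rewrite /itv_int Rintegral_cst//= lebesgue_measure_itv/= lte_fin.
move: ab; rewrite le_eqVlt => /orP[/eqP->|ab]; first by rewrite ltxx subrr.
by rewrite ab.
Qed.

Lemma within_cst a b c : {within `[a, b], continuous (fun=> c : R)}.
Proof. by apply: continuous_subspaceT => x; exact: cst_continuous. Qed.

Lemma itv_int_bounds f a b m M : a <= b -> {within `[a, b], continuous f} ->
  (forall x, a < x < b -> m <= f x <= M) ->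
  m * (b - a) <= itv_int f a b <= M * (b - a).
Proof.
move=> ab cf fmM; rewrite -!itv_int_cst//; apply/andP; split.
  by apply: itv_int_le => // [|x /fmM/andP[]//]; exact: within_cst.
by apply: itv_int_le => // [|x /fmM/andP[]//]; exact: within_cst.
Qed.

Lemma itv_int_chasles f a b c : {within `[a, c], continuous f} -> a <= b -> b <= c ->
  itv_int f a c = itv_int f a b + itv_int f b c.
Proof.
move=> cf ab bc; have := @Rintegral_itvB _ f (BLeft a) (BRight c) b.
rewrite -/(itv_int f a c) -/(itv_int f a b) => chasles.
rewrite -[LHS](subrK (itv_int f a b)) addrC; congr (_ + _).
rewrite chasles ?bnd_simp//; last exact: itv_integrable.
rewrite Rintegral_itv_obnd_cbnd//.
apply: integrableS (itv_integrable cf) => //.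
by apply: subset_itv; rewrite bnd_simp.
Qed.

Lemma ointE f a b : a <= b -> oint f a b = itv_int f a b.
Proof. by rewrite /oint => ->. Qed.

Lemma oint_self f a : oint f a a = 0.
Proof. by rewrite ointE// itv_int_self. Qed.

Lemma oint_anti f a b : oint f a b = - oint f b a.
Proof.
have [->|ab] := eqVneq a b; first by rewrite oint_self oppr0.
rewrite /oint; case: (ltgtP a b) ab => // ab _; by rewrite ?opprK.
Qed.

Let oint_chasles_sorted f a b c : {within `[a, c], continuous f} -> a <= b -> b <= c ->
  oint f a c = oint f a b + oint f b c.
Proof.
move=> cf ab bc; rewrite !ointE ?(le_trans ab bc)//.
exact: itv_int_chasles.
Qed.

Lemma oint_chasles f m M a b c : {within `[m, M], continuous f} ->
  m <= a <= M -> m <= b <= M -> m <= c <= M ->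
  oint f a c = oint f a b + oint f b c.
Proof.
move=> cf /andP[ma aM] /andP[mb bM] /andP[mc cM].
have S u v w : m <= u -> w <= M -> u <= v -> v <= w ->
    oint f u w = oint f u v + oint f v w.
  by move=> mu wM uv vw; apply: oint_chasles_sorted => //; exact: within_sub cf _ _.
have [ab|/ltW ba] := leP a b; have [bc|/ltW cb] := leP b c;
  have [ac|/ltW ca] := leP a c.
- exact: S.
- have -> : a = b by apply/eqP; rewrite eq_le ab (le_trans bc ca).
  by rewrite oint_self add0r.
- by rewrite (S a c b)// (oint_anti f c b) subrK.
- by rewrite (oint_anti f a c) (oint_anti f b c) (S c a b)//; ring.
- by rewrite (S b a c)// (oint_anti f b a); ring.
- by rewrite (oint_anti f a c) (oint_anti f a b) (S b c a)//; ring.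
- have -> : a = b by apply/eqP; rewrite eq_le ba (le_trans ac cb).
  by rewrite oint_self add0r.
- by rewrite (oint_anti f a c) (oint_anti f a b) (oint_anti f b c) (S c b a)//; ring.
Qed.

Lemma oint_chaslesT f a b c : continuous f -> oint f a c = oint f a b + oint f b c.
Proof.
move=> cf; pose m := Num.min a (Num.min b c); pose M := Num.max a (Num.max b c).
by apply: (@oint_chasles f m M); [exact: continuous_subspaceT| | | ];
  rewrite !ge_min !le_max !lexx ?orbT.
Qed.

(** For a decreasing f and v = f a, this is the tangent inequality for the
    concave primitive of f. *)
Lemma oint_tangent_decr f (v : R) a b : continuous f ->
  (forall x, x <= a -> v <= f x) -> (forall x, a <= x -> f x <= v) ->
  oint f a b <= v * (b - a).
Proof.
move=> cf lo hi; have [ab|ba] := leP a b.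
  rewrite ointE//.
  have cw : {within `[a, b], continuous f} by exact: continuous_subspaceT.
  rewrite -itv_int_cst//; apply: itv_int_le => //; first exact: within_cst.
  by move=> x /andP[ax _]; apply: hi; exact: ltW.
rewrite oint_anti (ointE _ (ltW ba)) lerNl -mulrN opprB.
have cw : {within `[b, a], continuous f} by exact: continuous_subspaceT.
rewrite -(itv_int_cst _ (ltW ba)); apply: itv_int_le => //; first exact: within_cst.
by move=> x /andP[_ xa]; apply: lo; exact: ltW.
Qed.

Lemma within_continuous_retract (f r : R -> R) a b : {within `[a, b], continuous f} ->
  continuous r -> (forall x, a <= r x <= b) -> continuous (f \o r).
Proof.
move=> /subspace_continuousP cf cr rab x.
have ab y : `[a, b]%classic (r y) by rewrite /= in_itv/= rab.
move=> U fU.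
have nearU : nbhs (r x) [set y | `[a, b]%classic y -> U (f y)] := cf (r x) (ab x) U fU.
have nearx : nbhs x [set y | `[a, b]%classic (r y) -> U (f (r y))] := cr x _ nearU.
by apply: (filterS _ nearx) => y; apply; exact: ab.
Qed.

End oriented_integral.

(** * Enthalpy, capillary energy and mobilities *)

Section data_functions.
Context (R : realType) (l : nat) (d : model_data R l).
Hypothesis (Hd : standing_assumptions d).
Implicit Types (al : phase) (a b p q s z : R).

Lemma rho_continuous al : continuous (rho d al).
Proof.
move=> x; apply: differentiable_continuous; apply/derivable1_diffP.
exact: rho_derivable Hd al x.
Qed.

Lemma rho_gt0 al x : 0 < rho d al x.
Proof.
by have [rm [rM [rm0 rr]]] := rho_range Hd; have /andP[h _] := rr al x;
   exact: lt_le_trans h.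
Qed.

Lemma rho_nondecreasing al a b : a <= b -> rho d al a <= rho d al b.
Proof.
by rewrite le_eqVlt => /orP[/eqP->//|/(rho_increasing Hd al)/ltW].
Qed.

Lemma inv_rho_continuous al : continuous (fun z => (rho d al z)^-1).
Proof.
move=> x; apply: continuousV; last exact: rho_continuous.
by rewrite gt_eqF// rho_gt0.
Qed.

(** Testing the scheme with this function turns the upwind flux into a square:
    by the choice of rho_mean, rho_mean times the jump of the enthalpy is the
    jump of the pressure. *)
Definition enthalpy al p : R := oint (fun z => (rho d al z)^-1) 0 p.

Lemma enthalpyB al p q : oint (fun z => (rho d al z)^-1) p q = enthalpy al q - enthalpy al p.
Proof.
rewrite /enthalpy (@oint_chaslesT _ _ 0 p q); first by rewrite addrC addKr.
exact: inv_rho_continuous.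
Qed.

Lemma enthalpy0 al : enthalpy al 0 = 0.
Proof. exact: oint_self. Qed.

(** The enthalpy is concave, because rho is increasing. *)
Lemma enthalpy_tangent al p q :
  enthalpy al q - enthalpy al p <= (rho d al p)^-1 * (q - p).
Proof.
rewrite -enthalpyB; apply: oint_tangent_decr; first exact: inv_rho_continuous.
  by move=> x xp; rewrite lef_pV2 ?posrE ?rho_gt0// rho_nondecreasing.
by move=> x xp; rewrite lef_pV2 ?posrE ?rho_gt0// rho_nondecreasing.
Qed.

Lemma enthalpy_bounds (rm rM : R) al p q : 0 < rm ->
  (forall x, rm <= rho d al x <= rM) -> p <= q ->
  rM^-1 * (q - p) <= enthalpy al q - enthalpy al p <= rm^-1 * (q - p).
Proof.
move=> rm0 rr pq; rewrite -enthalpyB ointE//; apply: itv_int_bounds => //.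
  by apply: continuous_subspaceT; exact: inv_rho_continuous.
move=> x _; have /andP[h1 h2] := rr x; have r0 := rho_gt0 al x.
by rewrite !lef_pV2 ?posrE// ?h1 ?h2//; exact: lt_le_trans h2.
Qed.

Lemma enthalpy_norm_le (rm rM : R) al p q : 0 < rm ->
  (forall x, rm <= rho d al x <= rM) ->
  `|enthalpy al q - enthalpy al p| <= rm^-1 * `|q - p|.
Proof.
move=> rm0 rr; wlog pq : p q / p <= q.
  move=> H; have [/H//|/ltW/H] := leP p q.
  by rewrite distrC (distrC p).
have /andP[h1 h2] := enthalpy_bounds rm0 rr pq.
have rM0 : 0 < rM by have /andP[k1 k2] := rr 0; lra.
rewrite [`|q - p|]ger0_norm ?subr_ge0// ger0_norm//.
by apply: le_trans h1; rewrite mulr_ge0 ?subr_ge0// invr_ge0 ltW.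
Qed.

Lemma enthalpy_diff_neq0 al p q : p != q -> enthalpy al q - enthalpy al p != 0.
Proof.
have [rm [rM [rm0 rr]]] := rho_range Hd.
have rM0 : 0 < rM by have /andP[k1 k2] := rr al 0; lra.
move=> pq; wlog lt_pq : p q pq / p < q.
  move=> H; have [/H->//|/H|pqE] := ltgtP p q; last by rewrite pqE eqxx in pq.
  by rewrite eq_sym pq => /(_ isT); rewrite -oppr_eq0 opprB.
have /andP[h1 _] := enthalpy_bounds rm0 (rr al) (ltW lt_pq).
rewrite gt_eqF//; apply: lt_le_trans h1.
by rewrite mulr_gt0 ?invr_gt0// subr_gt0.
Qed.

Lemma rho_mean_enthalpy al p q :
  rho_mean d al p q * (enthalpy al q - enthalpy al p) = q - p.
Proof.
rewrite /rho_mean; case: eqVneq => [->|pq]; first by rewrite !subrr mulr0.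
rewrite enthalpyB invfM invrK mulfVK//.
exact: enthalpy_diff_neq0.
Qed.

Lemma rho_mean_sym al p q : rho_mean d al p q = rho_mean d al q p.
Proof.
rewrite /rho_mean eq_sym; case: eqVneq => [->//|pq].
by rewrite [in RHS]oint_anti -[p - q]opprB invrN mulrNN.
Qed.

Lemma rho_mean_range (rm rM : R) al p q : 0 < rm ->
  (forall x, rm <= rho d al x <= rM) -> rm <= rho_mean d al p q <= rM.
Proof.
move=> rm0 rr; wlog pq : p q / p <= q.
  by move=> H; have [/H//|/ltW/H] := leP p q; rewrite rho_mean_sym.
have rM0 : 0 < rM by have /andP[k1 k2] := rr 0; lra.
rewrite /rho_mean; case: eqVneq => [//|npq].
have qp : 0 < q - p by rewrite subr_gt0 lt_def eq_sym npq.
have := enthalpy_bounds rm0 rr pq; rewrite -enthalpyB.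
set x := oint _ _ _ => /andP[h1 h2].
have x0 : 0 < x by apply: lt_le_trans h1; rewrite mulr_gt0// invr_gt0.
rewrite invfM invrK; apply/andP; split.
  by rewrite ler_pdivlMr// -ler_pdivlMl.
by rewrite ler_pdivrMr// mulrC -ler_pdivrMr// mulrC.
Qed.

(** The tangent at p lies above the enthalpy at 0. *)
Lemma enthalpy_energy_ge0 al p : 0 <= rho d al p * enthalpy al p - p.
Proof.
have := enthalpy_tangent al p 0; rewrite enthalpy0 !sub0r mulrN lerN2.
by rewrite ler_pdivrMl ?rho_gt0// subr_ge0.
Qed.

Definition cap_energy s : R := oint (pc d) 0 s.

(** The capillary energy is concave, because pc is decreasing. *)
Lemma cap_energy_tangent a b : cap_energy b - cap_energy a <= pc d a * (b - a).
Proof.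
have cpc := pc_continuous Hd.
rewrite /cap_energy (@oint_chaslesT _ _ 0 a b)// [X in X - _]addrC addrK.
have dec x y : x <= y -> pc d y <= pc d x.
  by rewrite le_eqVlt => /orP[/eqP->//|/(pc_decreasing Hd)/ltW].
by apply: oint_tangent_decr => // x; exact: dec.
Qed.

Lemma cap_energy_range s : 0 <= s <= 1 -> 0 <= cap_energy s <= pc d 0.
Proof.
move=> /andP[s0 s1]; have cpc := pc_continuous Hd.
have pc0 : 0 <= pc d 0 by apply: (pc_ge0 Hd); rewrite lexx ler01.
have dec x y : x <= y -> pc d y <= pc d x.
  by rewrite le_eqVlt => /orP[/eqP->//|/(pc_decreasing Hd)/ltW].
have := @itv_int_bounds _ (pc d) 0 s 0 (pc d 0) s0.
rewrite -ointE// -/(cap_energy s) mul0r subr0 => /(_ _ _)/andP[].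
- by apply: continuous_subspaceT.
- move=> x /andP[x0 xs]; rewrite (pc_ge0 Hd) ?dec// ?ltW//.
  exact: lt_le_trans xs s1.
move=> -> h /=; apply: le_trans h _; rewrite -[leRHS]mulr1.
exact: ler_wpM2l.
Qed.

(** The retraction onto [0, 1], with the minimum written as a maximum. *)
Let clamp z : R := Num.max 0 (1 - Num.max 0 (1 - z)).

Let clamp_continuous : continuous clamp.
Proof.
have c1 : continuous (fun z : R => 1 - z).
  by move=> z; apply: continuousB; [exact: cst_continuous|exact: cvg_id].
have m0 (f : R -> R) : continuous f -> continuous (fun z => Num.max 0 (f z)).
  by move=> cf z; apply: continuous_max; [exact: cst_continuous|exact: cf].
have c2 := m0 _ c1.
have c3 : continuous (fun z : R => 1 - Num.max 0 (1 - z)).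
  by move=> z; exact: (continuous_comp (c2 z) (c1 _)).
exact: (m0 _ c3).
Qed.

Let clampE z : clamp z = if z <= 0 then 0 else if 1 <= z then 1 else z.
Proof.
rewrite /clamp; have [z0|z0] := leP z 0.
  by rewrite (max_idPr (_ : 0 <= 1 - z)) ?subr_ge0 ?(le_trans z0)// subKr (max_idPl z0).
have [z1|z1] := leP 1 z.
  by rewrite (max_idPl (_ : 1 - z <= 0)) ?subr_le0// subr0 (max_idPr ler01).
rewrite (max_idPr (_ : 0 <= 1 - z)) ?subr_ge0 1?ltW// subKr.
by rewrite (max_idPr (ltW z0)).
Qed.

Let clamp_range z : 0 <= clamp z <= 1.
Proof.
rewrite clampE; have [z0|z0] := leP z 0; first by rewrite lexx ler01.
have [z1|z1] := leP 1 z; first by rewrite lexx ler01.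
by rewrite !ltW.
Qed.

Lemma mob_clamp al z : mob d al (clamp z) = mob d al z.
Proof.
rewrite clampE; have [z0|z0] := leP z 0; first by rewrite (mob_ext_left Hd al z0).
by have [z1|//] := leP 1 z; rewrite (mob_ext_right Hd al z1).
Qed.

Lemma mob_continuousT al : continuous (mob d al).
Proof.
rewrite (_ : mob d al = mob d al \o clamp); last first.
  by apply/funext => z /=; rewrite mob_clamp.
apply: (@within_continuous_retract R (mob d al) clamp 0 1) => //; exact: mob_continuous Hd al.
Qed.

Lemma mob_ge0T al z : 0 <= mob d al z.
Proof. by rewrite -mob_clamp; apply: (mob_ge0 Hd); exact: clamp_range. Qed.

Lemma mob_mono al a b : a <= b -> mob d al a <= mob d al b.
Proof.
move=> ab; rewrite -(mob_clamp al a) -(mob_clamp al b).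
have /andP[a0 a1] := clamp_range a; have /andP[b0 b1] := clamp_range b.
apply: (mob_nondecreasing Hd) => //; move: a0 a1 b0 b1; rewrite !clampE.
by case: (leP a 0); case: (leP b 0); case: (leP 1 a); case: (leP 1 b); lra.
Qed.

Lemma mob_le1 al z : mob d al z <= mob d al 1.
Proof.
by rewrite -mob_clamp; apply: mob_mono; have /andP[] := clamp_range z.
Qed.

Lemma mob_neg al z : z <= 0 -> mob d al z = 0.
Proof. by move=> z0; rewrite (mob_ext_left Hd al z0) (mob_0 Hd). Qed.

Lemma mob_tot_ge (m0 : R) z : (forall s, 0 <= s <= 1 -> m0 <= mob_tot d s) ->
  m0 <= mob_tot d z.
Proof.
move=> m0P; have := m0P _ (clamp_range z); rewrite /mob_tot mob_clamp.
rewrite (_ : mob d gas (1 - clamp z) = mob d gas (1 - z))// -[RHS]mob_clamp.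
congr mob; rewrite !clampE.
by case: (leP z 0); case: (leP (1 - z) 0); case: (leP 1 z); case: (leP 1 (1 - z)); lra.
Qed.

(** Otherwise gamma would not be positive at z. *)
Lemma dpc_lt0 z : 0 < z < 1 -> dpc d z < 0.
Proof.
move=> z01; have := gamma_gt0 Hd z01; rewrite /gamma -mulrN => h.
have t0 : 0 <= mob d liq z * mob d gas (1 - z) / mob_tot d z.
  by rewrite divr_ge0 ?mulr_ge0 ?addr_ge0 ?mob_ge0T.
rewrite ltNge; apply/negP => d0; move: h; rewrite ltNge mulr_ge0_le0//.
by rewrite oppr_le0.
Qed.

Lemma dpc_continuous a b : 0 <= a -> b <= 1 -> {within `[a, b], continuous (dpc d)}.
Proof. by move=> a0 b1; have [_ c _] := pc_C1 Hd; exact: within_sub c a0 b1. Qed.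

Lemma dpc_int a b : 0 <= a -> a <= b -> b <= 1 -> itv_int (dpc d) a b = pc d b - pc d a.
Proof.
move=> a0 ab b1; have [ab_eq|ab_ne] := eqVneq a b.
  by rewrite ab_eq itv_int_self subrr.
have lt_ab : a < b by rewrite lt_def eq_sym ab_ne.
have [_ _ der] := pc_C1 Hd.
have cpc := pc_continuous Hd.
have inner x : x \in `]a, b[ -> is_derive x 1 (pc d) (dpc d x).
  by rewrite in_itv/= => /andP[ax xb]; apply: der; apply/andP; split; lra.
have := @continuous_FTC2 R (dpc d) (pc d) a b lt_ab (dpc_continuous a0 b1).
rewrite /itv_int /Rintegral => -> //.
- split; first by move=> x /inner[].
  + by apply: cvg_at_right_filter; exact: cpc.
  + by apply: cvg_at_left_filter; exact: cpc.
- by move=> x /inner dx; rewrite derive1E derive_val.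
Qed.

(** As dpc is negative, the integral of |dpc| is a difference of values of pc. *)
Lemma pc_weighted_int (th : R -> R) (Th : R) a b : continuous th ->
  0 <= a <= 1 -> 0 <= b <= 1 ->
  (forall z, Num.min a b < z -> z < Num.max a b -> `|th z| <= Th) ->
  `|oint (fun z => th z * dpc d z) 0 b - oint (fun z => th z * dpc d z) 0 a|
    <= Th * `|pc d b - pc d a|.
Proof.
move=> cth; wlog ab : a b / a <= b.
  move=> H a01 b01 thP; have [ab|/ltW ba] := leP a b; first exact: H.
  rewrite distrC (distrC (pc d b)); apply: H => // z.
  by rewrite minC maxC; exact: thP.
move=> /andP[a0 a1] /andP[b0 b1] thP; rewrite (min_idPl ab) (max_idPr ab) in thP.
set f := fun z => _.
have cf u v : 0 <= u -> v <= 1 -> {within `[u, v], continuous f}.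
  move=> u0 v1 x; apply: continuousM; last exact: dpc_continuous.
  by apply: continuous_subspaceT.
rewrite (@oint_chasles _ f 0 1 0 a b) ?lexx ?ler01 ?a0 ?b0//; last exact: cf.
rewrite addrC addKr ointE//.
have cD c : {within `[a, b], continuous (fun z => c * dpc d z)}.
  move=> x; apply: continuousM; last exact: dpc_continuous.
  by apply: continuous_subspaceT => y; exact: cst_continuous.
have DI c : itv_int (fun z => c * dpc d z) a b = c * (pc d b - pc d a).
  rewrite -dpc_int// /itv_int RintegralZl//.
  by apply: itv_integrable; exact: dpc_continuous.
have pcab : pc d b - pc d a <= 0.
  rewrite subr_le0; move: ab; rewrite le_eqVlt => /orP[/eqP->//|].
  by move=> /(pc_decreasing Hd)/ltW.
rewrite (ler0_norm pcab) ler_norml mulrN opprK -mulNr -!DI; apply/andP; split.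
  apply: itv_int_le => //; [exact: cf|move=> z /andP[az zb]].
  have dz : dpc d z <= 0 by apply: ltW; apply: dpc_lt0; apply/andP; split; lra.
  have /ler_normlP[_ h] := thP z az zb.
  by rewrite ler_wnM2r.
apply: itv_int_le => //; [exact: cf|move=> z /andP[az zb]].
have dz : dpc d z <= 0 by apply: ltW; apply: dpc_lt0; apply/andP; split; lra.
have /ler_normlP[h _] := thP z az zb.
by rewrite ler_wnM2r// lerNl.
Qed.

End data_functions.

(** * Pressure jumps across a face *)

Section edge_algebra.
Context (R : realType).

Lemma sqr_le_of_norm (x y : R) : `|x| <= y -> x ^+ 2 <= y ^+ 2.
Proof.
move=> xy; rewrite -(real_normK (num_real x)) ler_sqr// nnegrE.
exact: le_trans xy.
Qed.

Lemma sqrD_le2 (x y : R) : (x + y) ^+ 2 <= 2 * (x ^+ 2 + y ^+ 2).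
Proof. by have := sqr_ge0 (x - y); rewrite sqrrB sqrrD; lra. Qed.

(** Mx bounds the mobilities and i0 is the inverse of the lower bound m0 of the
    total mobility. It dominates the constants of all the estimates below. *)
Definition edge_const (Mx i0 : R) : R :=
  2 + Mx * i0 + 16 * i0 + 16 * (Mx * i0 ^+ 2) + 16 * (Mx ^+ 2 * i0 ^+ 2)
    + 16 * (Mx ^+ 3 * i0 ^+ 2).

(** E is the dissipation on a face: ml, mg are the upwind mobilities, dl, dg the
    pressure jumps of the two phases. L and G are the larger of the two mobilities
    on the face, and X, Y, B stand for the jumps of pbar, ptilde and calB; thus
    dl + X is the jump of the global pressure. *)
Definition edge_control (C ml mg L G dl dg X Y B : R) : Prop :=
  let E := ml * dl ^+ 2 + mg * dg ^+ 2 in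
  [/\ L * dl ^+ 2 <= C * E, G * dg ^+ 2 <= C * E, (dl + X) ^+ 2 <= C * E
    & [/\ B ^+ 2 <= C * E, ml * X ^+ 2 <= C * E & mg * Y ^+ 2 <= C * E]].

Section cases.
Variables (m0 i0 Mx ml mg L G dl dg X Y B : R).
Hypotheses (i00 : 0 <= i0) (m0i0 : m0 * i0 = 1) (ml0 : 0 <= ml) (mg0 : 0 <= mg)
  (mlL : ml <= L) (mgG : mg <= G) (LM : L <= Mx) (GM : G <= Mx)
  (mm : m0 <= ml + mg) (XY : dl + X = dg + Y).
Local Notation D := `|dg - dl|.
Hypotheses (X1 : `|X| <= D) (XG : `|X| <= G * i0 * D)
  (Y1 : `|Y| <= D) (YL : `|Y| <= L * i0 * D) (BLG : `|B| <= L * G * i0 * D).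
Local Notation E := (ml * dl ^+ 2 + mg * dg ^+ 2).
Local Notation C := (edge_const Mx i0).

Let L0 : 0 <= L. Proof. exact: le_trans mlL. Qed.
Let G0 : 0 <= G. Proof. exact: le_trans mgG. Qed.
Let Mx0 : 0 <= Mx. Proof. exact: le_trans LM. Qed.
Let el0 : 0 <= ml * dl ^+ 2. Proof. by rewrite mulr_ge0// sqr_ge0. Qed.
Let eg0 : 0 <= mg * dg ^+ 2. Proof. by rewrite mulr_ge0// sqr_ge0. Qed.
Let elE : ml * dl ^+ 2 <= E. Proof. by rewrite lerDl. Qed.
Let egE : mg * dg ^+ 2 <= E. Proof. by rewrite lerDr. Qed.
Let E0 : 0 <= E. Proof. exact: addr_ge0. Qed.
Let p1 : 0 <= Mx * i0. Proof. exact: mulr_ge0. Qed.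
Let p2 : 0 <= Mx * i0 ^+ 2. Proof. by rewrite mulr_ge0// sqr_ge0. Qed.
Let p3 : 0 <= Mx ^+ 2 * i0 ^+ 2. Proof. by rewrite mulr_ge0// sqr_ge0. Qed.
Let p4 : 0 <= Mx ^+ 3 * i0 ^+ 2. Proof. by rewrite mulr_ge0 ?sqr_ge0// exprn_ge0. Qed.

Let sq_weight m z : 0 <= m -> m <= Mx -> m ^+ 2 * z ^+ 2 <= Mx * (m * z ^+ 2).
Proof.
by move=> m_0 mM; rewrite expr2 -mulrA ler_wpM2r// mulr_ge0// sqr_ge0.
Qed.

Let conclude (k : R) x : k <= C -> x <= k * E -> x <= C * E.
Proof. by move=> kC /le_trans; apply; rewrite ler_wpM2r. Qed.

Ltac const_bound := rewrite /edge_const; have := p1; have := p2; have := p3;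
  have := p4; have := i00; lra.

(** The gas has the larger jump and is taken with its larger mobility. Then
    m0 dl^2 is at most (ml + mg) dl^2, hence at most E, and the other jumps are
    multiples of |dg|, with a factor G for those not weighted by mg. *)
Lemma edge_control_dominant : G = mg -> `|dl| <= `|dg| -> D <= `|dg| ->
  edge_control C ml mg L G dl dg X Y B.
Proof.
move=> Gmg dld Dd.
have dl2 : dl ^+ 2 <= dg ^+ 2.
  by have := sqr_le_of_norm dld; rewrite real_normK ?num_real.
have dlE : dl ^+ 2 <= i0 * E.
  rewrite -[leLHS]mul1r -m0i0 [m0 * i0]mulrC -mulrA; apply: ler_wpM2l => //.
  apply: (@le_trans _ _ ((ml + mg) * dl ^+ 2)); first by rewrite ler_wpM2r ?sqr_ge0.
  by rewrite mulrDl lerD2l ler_wpM2l.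
have dgw (k x : R) : 0 <= k -> `|x| <= k * D -> x ^+ 2 <= k ^+ 2 * dg ^+ 2.
  move=> k0 xk; rewrite -exprMn; have : `|x| <= k * `|dg|.
    by rewrite (le_trans xk)// ler_wpM2l.
  by move/sqr_le_of_norm; rewrite !exprMn real_normK ?num_real.
have X2 : X ^+ 2 <= Mx * i0 ^+ 2 * E.
  apply: (le_trans (dgw _ _ (mulr_ge0 G0 i00) XG)).
  rewrite exprMn Gmg mulrAC; apply: (@le_trans _ _ (Mx * (mg * dg ^+ 2) * i0 ^+ 2)).
    by rewrite ler_wpM2r ?sqr_ge0// sq_weight// -Gmg.
  by rewrite mulrAC ler_wpM2l.
split.
- apply: (@conclude (Mx * i0)); first by const_bound.
  by rewrite -mulrA ler_pM// sqr_ge0.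
- apply: (@conclude 1); first by const_bound.
  by rewrite mul1r Gmg.
- apply: (@conclude (2 * (i0 + Mx * i0 ^+ 2))); first by const_bound.
  apply: (le_trans (sqrD_le2 _ _)); rewrite -mulrA ler_wpM2l// mulrDl.
  exact: lerD.
split.
- apply: (@conclude (Mx ^+ 3 * i0 ^+ 2)); first by const_bound.
  apply: (le_trans (dgw _ _ _ BLG)); first by rewrite !mulr_ge0.
  rewrite !exprMn Gmg.
  have -> : L ^+ 2 * mg ^+ 2 * i0 ^+ 2 * dg ^+ 2 = L ^+ 2 * i0 ^+ 2 * (mg ^+ 2 * dg ^+ 2).
    by ring.
  have -> : Mx ^+ 3 * i0 ^+ 2 * E = Mx ^+ 2 * i0 ^+ 2 * (Mx * E) by ring.
  apply: ler_pM; rewrite 1?mulr_ge0 ?sqr_ge0//.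
    by rewrite ler_wpM2r ?sqr_ge0// ler_sqr ?nnegrE.
  apply: (le_trans (sq_weight _ _ _)) => //; first by rewrite -Gmg.
  exact: ler_wpM2l.
- apply: (@conclude (Mx ^+ 2 * i0 ^+ 2)); first by const_bound.
  have -> : Mx ^+ 2 * i0 ^+ 2 * E = Mx * (Mx * i0 ^+ 2 * E) by ring.
  by apply: ler_pM; rewrite ?sqr_ge0// (le_trans mlL).
- apply: (@conclude 1); first by const_bound.
  rewrite mul1r (le_trans _ egE)// ler_wpM2l//.
  have := dgw 1 Y ler01; rewrite mul1r expr1n mul1r; exact.
Qed.

(** Both phases are taken with their larger mobility. Then E controls L dl^2 and
    G dg^2; one of L and G is at least m0 / 2, which controls the global
    pressure. *)
Lemma edge_control_opposite : L = ml -> G = mg -> edge_control C ml mg L G dl dg X Y B.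
Proof.
move=> Lml Gmg.
have D2 : D ^+ 2 <= 2 * (dl ^+ 2 + dg ^+ 2).
  by rewrite real_normK ?num_real// -(sqrrN dl) addrC; have := sqrD_le2 dg (- dl); lra.
have w (k x : R) : 0 <= k -> `|x| <= k * D -> x ^+ 2 <= 2 * (k ^+ 2 * dl ^+ 2 + k ^+ 2 * dg ^+ 2).
  move=> k0 /sqr_le_of_norm; rewrite exprMn => /le_trans; apply.
  have -> : 2 * (k ^+ 2 * dl ^+ 2 + k ^+ 2 * dg ^+ 2) = k ^+ 2 * (2 * (dl ^+ 2 + dg ^+ 2)).
    by ring.
  by apply: ler_wpM2l => //; exact: sqr_ge0.
have gw : (mg * i0) ^+ 2 * dg ^+ 2 <= Mx * i0 ^+ 2 * E.
  rewrite exprMn mulrAC; apply: (@le_trans _ _ (Mx * (mg * dg ^+ 2) * i0 ^+ 2)).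
    by rewrite ler_wpM2r ?sqr_ge0// sq_weight// -Gmg.
  by rewrite mulrAC ler_wpM2l.
have lw : (ml * i0) ^+ 2 * dl ^+ 2 <= Mx * i0 ^+ 2 * E.
  rewrite exprMn mulrAC; apply: (@le_trans _ _ (Mx * (ml * dl ^+ 2) * i0 ^+ 2)).
    by rewrite ler_wpM2r ?sqr_ge0// sq_weight// -Lml.
  by rewrite mulrAC ler_wpM2l.
(* Whether mg * i0 is below or above 1 decides which bound on X is better. *)
have Xw : X ^+ 2 <= 2 * (dl ^+ 2 + Mx * i0 ^+ 2 * E).
  have [c1|c1] := leP (mg * i0) 1.
    apply: (le_trans (w _ _ (mulr_ge0 mg0 i00) _)); first by rewrite -Gmg.
    rewrite ler_wpM2l// lerD// ler_piMl ?sqr_ge0// expr_le1//; exact: mulr_ge0.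
  have := w 1 X ler01; rewrite mul1r expr1n !mul1r => /(_ X1)/le_trans; apply.
  rewrite ler_wpM2l// lerD2l (le_trans _ gw)// ler_peMl ?sqr_ge0//.
  by rewrite expr_ge1//; [exact: ltW|exact: mulr_ge0].
have Yw : Y ^+ 2 <= 2 * (dg ^+ 2 + Mx * i0 ^+ 2 * E).
  rewrite [dg ^+ 2 + _]addrC; have [c1|c1] := leP (ml * i0) 1.
    apply: (le_trans (w _ _ (mulr_ge0 ml0 i00) _)); first by rewrite -Lml.
    rewrite ler_wpM2l// lerD// ler_piMl ?sqr_ge0// expr_le1//; exact: mulr_ge0.
  have := w 1 Y ler01; rewrite mul1r expr1n !mul1r => /(_ Y1)/le_trans; apply.
  rewrite ler_wpM2l// lerD2r (le_trans _ lw)// ler_peMl ?sqr_ge0//.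
  by rewrite expr_ge1//; [exact: ltW|exact: mulr_ge0].
have big (m z : R) : 0 <= m -> m0 / 2 <= m -> m * z ^+ 2 <= E -> z ^+ 2 <= 2 * i0 * E.
  move=> m_0 m2 mz; rewrite -[leLHS]mul1r -[X in X * _ <= _]m0i0.
  apply: (@le_trans _ _ (2 * i0 * (m * z ^+ 2))); last by rewrite ler_wpM2l// mulr_ge0.
  rewrite (_ : m0 * i0 * z ^+ 2 = 2 * i0 * (m0 / 2 * z ^+ 2)); last by field.
  by rewrite ler_wpM2l ?mulr_ge0// ler_wpM2r ?sqr_ge0.
split.
- by apply: (@conclude 1); rewrite ?mul1r ?Lml//; const_bound.
- by apply: (@conclude 1); rewrite ?mul1r ?Gmg//; const_bound.
- have [m2|m2] := leP (m0 / 2) ml.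
    have z2 := big _ _ ml0 m2 elE.
    apply: (@conclude (12 * i0 + 4 * (Mx * i0 ^+ 2))); first by const_bound.
    by apply: (le_trans (sqrD_le2 _ _)); lra.
  have m2' : m0 / 2 <= mg by have := mm; lra.
  have z2 := big _ _ mg0 m2' egE; rewrite XY.
  apply: (@conclude (12 * i0 + 4 * (Mx * i0 ^+ 2))); first by const_bound.
  by apply: (le_trans (sqrD_le2 _ _)); lra.
split.
- apply: (@conclude (4 * (Mx ^+ 3 * i0 ^+ 2))); first by const_bound.
  apply: (le_trans (w _ _ _ BLG)); first by rewrite !mulr_ge0.
  rewrite Lml Gmg !exprMn.
  have -> : ml ^+ 2 * mg ^+ 2 * i0 ^+ 2 * dl ^+ 2 = mg ^+ 2 * i0 ^+ 2 * (ml ^+ 2 * dl ^+ 2).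
    by ring.
  have -> : ml ^+ 2 * mg ^+ 2 * i0 ^+ 2 * dg ^+ 2 = ml ^+ 2 * i0 ^+ 2 * (mg ^+ 2 * dg ^+ 2).
    by ring.
  have half (m m' z : R) : 0 <= m -> m <= Mx -> 0 <= m' -> m' <= Mx -> m' * z ^+ 2 <= E ->
      m ^+ 2 * i0 ^+ 2 * (m' ^+ 2 * z ^+ 2) <= Mx ^+ 3 * i0 ^+ 2 * E.
    move=> m_0 mM m'0 m'M mz.
    have -> : Mx ^+ 3 * i0 ^+ 2 * E = Mx ^+ 2 * i0 ^+ 2 * (Mx * E) by ring.
    apply: ler_pM; rewrite 1?mulr_ge0 ?sqr_ge0//.
      by rewrite ler_wpM2r ?sqr_ge0// ler_sqr ?nnegrE.
    by apply: (le_trans (sq_weight _ _ _)) => //; exact: ler_wpM2l.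
  have h1 := half mg ml dl mg0 (le_trans mgG GM) ml0 (le_trans mlL LM) elE.
  have h2 := half ml mg dg ml0 (le_trans mlL LM) mg0 (le_trans mgG GM) egE.
  lra.
- apply: (@conclude (2 + 2 * (Mx ^+ 2 * i0 ^+ 2))); first by const_bound.
  apply: (@le_trans _ _ (ml * (2 * (dl ^+ 2 + Mx * i0 ^+ 2 * E)))); first by rewrite ler_wpM2l.
  have : ml * (Mx * i0 ^+ 2 * E) <= Mx * (Mx * i0 ^+ 2 * E).
    by rewrite ler_wpM2r ?(le_trans mlL)// mulr_ge0.
  have -> : Mx * (Mx * i0 ^+ 2 * E) = Mx ^+ 2 * i0 ^+ 2 * E by ring.
  by have := elE; lra.
- apply: (@conclude (2 + 2 * (Mx ^+ 2 * i0 ^+ 2))); first by const_bound.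
  apply: (@le_trans _ _ (mg * (2 * (dg ^+ 2 + Mx * i0 ^+ 2 * E)))); first by rewrite ler_wpM2l.
  have : mg * (Mx * i0 ^+ 2 * E) <= Mx * (Mx * i0 ^+ 2 * E).
    by rewrite ler_wpM2r ?(le_trans mgG)// mulr_ge0.
  have -> : Mx * (Mx * i0 ^+ 2 * E) = Mx ^+ 2 * i0 ^+ 2 * E by ring.
  by have := egE; lra.
Qed.

End cases.
End edge_algebra.

Section edge_estimates.
Context (R : realType) (l : nat) (d : model_data R l).
Hypothesis (Hd : standing_assumptions d).
Implicit Types (a b dl dg z : R).

Definition max_mob : R := Num.max (mob d liq 1) (mob d gas 1).

Lemma mob_le_max al z : mob d al z <= max_mob.
Proof.
apply: (le_trans (mob_le1 Hd al z)); rewrite /max_mob le_max.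
by case: al; rewrite lexx ?orbT.
Qed.

Lemma mob_gasC_continuous : continuous (fun z => mob d gas (1 - z)).
Proof.
have c1 : continuous (fun z : R => 1 - z).
  by move=> z; apply: continuousB; [exact: cst_continuous|exact: cvg_id].
by move=> z; apply: (continuous_comp (c1 z)); exact: mob_continuousT.
Qed.

Lemma mob_tot_continuous : continuous (mob_tot d).
Proof.
by move=> z; apply: continuousD; [exact: mob_continuousT|exact: mob_gasC_continuous].
Qed.

Section with_lower_bound.
Variable (m0 : R).
Hypotheses (m0_gt0 : 0 < m0) (m0P : forall s : R, 0 <= s <= 1 -> m0 <= mob_tot d s).

Lemma tot_gt0 z : 0 < mob_tot d z.
Proof. exact: lt_le_trans m0_gt0 (mob_tot_ge Hd _ m0P). Qed.

Lemma div_tot_continuous (f : R -> R) : continuous f ->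
  continuous (fun z => f z / mob_tot d z).
Proof.
move=> cf z; have tz : mob_tot d z != 0 by rewrite gt_eqF// tot_gt0.
have ci := continuousV tz (@mob_tot_continuous z).
have cp := continuousM (cf z) ci.
exact: cp.
Qed.

Lemma div_tot_le (f : R -> R) z (K : R) : 0 <= f z -> f z <= K ->
  `|f z / mob_tot d z| <= K * m0^-1.
Proof.
move=> f0 fK; have tz := tot_gt0 z.
rewrite ger0_norm; last by apply: divr_ge0 => //; exact: ltW.
apply: ler_pM => //; first by rewrite invr_ge0 ltW.
by rewrite lef_pV2 ?posrE//; exact: (mob_tot_ge Hd _ m0P).
Qed.

Let thg z := mob d gas (1 - z) / mob_tot d z.
Let thl z := mob d liq z / mob_tot d z.

Let thg_continuous : continuous thg.
Proof. exact: div_tot_continuous mob_gasC_continuous. Qed.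

Let thl_continuous : continuous thl.
Proof. by apply: div_tot_continuous; exact: mob_continuousT. Qed.

Let thgl z : thg z + thl z = 1.
Proof.
by rewrite /thg /thl -mulrDl addrC mulfV// gt_eqF// tot_gt0.
Qed.

Let thg_ge0 z : 0 <= thg z.
Proof. by rewrite divr_ge0 ?mob_ge0T// ltW// tot_gt0. Qed.

Let thl_ge0 z : 0 <= thl z.
Proof. by rewrite divr_ge0 ?mob_ge0T// ltW// tot_gt0. Qed.

Lemma pbarB a b (K : R) : 0 <= a <= 1 -> 0 <= b <= 1 ->
  mob d gas (1 - Num.min a b) <= K ->
  `|pbar d b - pbar d a| <= `|pc d b - pc d a| /\
  `|pbar d b - pbar d a| <= K * m0^-1 * `|pc d b - pc d a|.
Proof.
move=> a01 b01 KP; split.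
  rewrite -[leRHS]mul1r; apply: (pc_weighted_int Hd thg_continuous) => // z _ _.
  by rewrite ger0_norm// -(thgl z) lerDl.
apply: (pc_weighted_int Hd thg_continuous) => // z az zb.
apply: (div_tot_le (f := fun z => mob d gas (1 - z))); first exact: mob_ge0T.
by apply: le_trans KP; apply: (mob_mono Hd); rewrite lerD2l lerN2 ltW.
Qed.

Let ptildeE s : ptilde d s = - oint (fun z => thl z * dpc d z) 0 s.
Proof. by []. Qed.

Lemma ptildeB a b (K : R) : 0 <= a <= 1 -> 0 <= b <= 1 ->
  mob d liq (Num.max a b) <= K ->
  `|ptilde d b - ptilde d a| <= `|pc d b - pc d a| /\
  `|ptilde d b - ptilde d a| <= K * m0^-1 * `|pc d b - pc d a|.
Proof.
move=> a01 b01 KP; rewrite !ptildeE -opprD normrN.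
split.
  rewrite -[leRHS]mul1r; apply: (pc_weighted_int Hd thl_continuous) => // z _ _.
  by rewrite ger0_norm// -(thgl z) lerDr.
apply: (pc_weighted_int Hd thl_continuous) => // z az zb.
apply: (div_tot_le (f := mob d liq)); first exact: mob_ge0T.
by apply: le_trans KP; apply: (mob_mono Hd); exact: ltW.
Qed.

Lemma calBB a b (K K' : R) : 0 <= a <= 1 -> 0 <= b <= 1 ->
  mob d liq (Num.max a b) <= K -> mob d gas (1 - Num.min a b) <= K' ->
  `|calB d b - calB d a| <= K * K' * m0^-1 * `|pc d b - pc d a|.
Proof.
move=> a01 b01 KP KP'.
pose th z := - (mob d liq z * mob d gas (1 - z) / mob_tot d z).
have cth : continuous th.
  have cm : continuous (fun z => mob d liq z * mob d gas (1 - z)).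
    move=> z; have cp := continuousM (@mob_continuousT _ _ _ Hd liq z) (@mob_gasC_continuous z).
    exact: cp.
  move=> z; have cn := continuousN (@div_tot_continuous _ cm z).
  exact: cn.
have gE : gamma d = fun z => th z * dpc d z.
  by apply/funext => z; rewrite /gamma /th mulNr.
rewrite /calB gE; apply: (pc_weighted_int Hd cth) => // z az zb.
rewrite normrN; apply: (div_tot_le (f := fun z => mob d liq z * mob d gas (1 - z))) => //.
  by rewrite mulr_ge0// mob_ge0T.
apply: ler_pM; rewrite ?mob_ge0T//.
  by apply: le_trans KP; apply: (mob_mono Hd); exact: ltW.
by apply: le_trans KP'; apply: (mob_mono Hd); rewrite lerD2l lerN2 ltW.
Qed.

Lemma pbar_ptilde s : 0 <= s <= 1 -> pbar d s - ptilde d s = pc d s - pc d 0.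
Proof.
move=> /andP[s0 s1]; rewrite ptildeE opprK /pbar !ointE// -dpc_int// /itv_int.
have cf (th : R -> R) : continuous th -> {within `[0, s], continuous (fun z => th z * dpc d z)}.
  move=> cth x; apply: continuousM; last exact: dpc_continuous.
  exact: continuous_subspaceT.
rewrite -RintegralD//; last 2 first.
- by apply: itv_integrable; exact: (cf thg).
- by apply: itv_integrable; exact: (cf thl).
by apply: eq_Rintegral => z _; rewrite -mulrDl -/(thg z) thgl mul1r.
Qed.

(** The jumps differ by the jump of pc, which decreases. If dl and dg have
    different signs, both phases are upwinded with their larger mobility; if they
    have the same sign, the phase with the larger jump is. The case of a dominant
    liquid follows from that of a dominant gas by exchanging the phases. *)
Lemma edge_estimate a b dl dg : 0 <= a <= 1 -> 0 <= b <= 1 ->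
  pc d b - pc d a = dg - dl ->
  edge_control (edge_const max_mob m0^-1)
    (if dl <= 0 then mob d liq a else mob d liq b)
    (if dg <= 0 then mob d gas (1 - a) else mob d gas (1 - b))
    (Num.max (mob d liq a) (mob d liq b))
    (Num.max (mob d gas (1 - a)) (mob d gas (1 - b)))
    dl dg (pbar d b - pbar d a) (ptilde d b - ptilde d a) (calB d b - calB d a).
Proof.
move=> a01 b01 pcE.
set L := Num.max (mob d liq a) _; set G := Num.max (mob d gas _) _.
have m0i0 : m0 * m0^-1 = 1 by rewrite mulfV// gt_eqF.
have i00 : 0 <= m0^-1 by rewrite invr_ge0 ltW.
have XY : dl + (pbar d b - pbar d a) = dg + (ptilde d b - ptilde d a).
  by have := pbar_ptilde a01; have := pbar_ptilde b01; move: pcE; lra.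
have LM : L <= max_mob by rewrite ge_max !mob_le_max.
have GM : G <= max_mob by rewrite ge_max !mob_le_max.
have Lmax : mob d liq (Num.max a b) <= L.
  by rewrite /L; case: (leP a b) => ab; rewrite le_max lexx ?orbT.
have Gmin : mob d gas (1 - Num.min a b) <= G.
  by rewrite /G; case: (leP a b) => ab; rewrite le_max lexx ?orbT.
have [X1 XG] := pbarB a01 b01 Gmin; have [Y1 YL] := ptildeB a01 b01 Lmax.
have BLG := calBB a01 b01 Lmax Gmin.
rewrite pcE in X1 XG Y1 YL BLG.
have ma := m0P a01; have mb := m0P b01; rewrite /mob_tot in ma mb.
have la0 := mob_ge0T Hd liq a; have lb0 := mob_ge0T Hd liq b.
have ga0 := mob_ge0T Hd gas (1 - a); have gb0 := mob_ge0T Hd gas (1 - b).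
have laL : mob d liq a <= L by rewrite le_max lexx.
have lbL : mob d liq b <= L by rewrite le_max lexx orbT.
have gaG : mob d gas (1 - a) <= G by rewrite le_max lexx.
have gbG : mob d gas (1 - b) <= G by rewrite le_max lexx orbT.
(* The dominant case with the phases exchanged. *)
have mirror (ml mg : R) : 0 <= ml -> 0 <= mg -> ml <= L -> mg <= G -> m0 <= ml + mg ->
    L = ml -> `|dg| <= `|dl| -> `|dg - dl| <= `|dl| ->
    edge_control (edge_const max_mob m0^-1) ml mg L G dl dg
      (pbar d b - pbar d a) (ptilde d b - ptilde d a) (calB d b - calB d a).
  move=> ml0 mg0 mlL mgG mm Lml dgl Dl.
  rewrite (distrC dg dl) in X1 XG Y1 YL BLG Dl; rewrite [L * G]mulrC in BLG.
  rewrite addrC in mm.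
  have [h1 h2 h3 [h4 h5 h6]] :=
    edge_control_dominant i00 m0i0 mg0 ml0 mgG mlL GM LM mm YL X1 BLG Lml dgl Dl.
  have EE : mg * dg ^+ 2 + ml * dl ^+ 2 = ml * dl ^+ 2 + mg * dg ^+ 2 by rewrite addrC.
  rewrite -XY EE in h3; rewrite EE in h1 h2 h4 h5 h6; by split.
have [ab|ba] := leP a b.
  have LE : L = mob d liq b by rewrite /L (max_idPr (mob_mono Hd liq ab)).
  have GE : G = mob d gas (1 - a).
    by rewrite /G (max_idPl (mob_mono Hd gas _))// lerD2l lerN2.
  have dgl : dg <= dl.
    have : pc d b <= pc d a.
      by move: ab; rewrite le_eqVlt => /orP[/eqP->//|/(pc_decreasing Hd)/ltW].
    by move: pcE; lra.
  have [dl0|dl0] := leP dl 0.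
    have dg0 : dg <= 0 by exact: le_trans dl0.
    rewrite dg0; apply: (edge_control_dominant i00 m0i0) => //.
      by rewrite !ler0_norm//; lra.
    by rewrite !ler0_norm//; lra.
  have [dg0|dg0] := leP dg 0.
    by apply: (edge_control_opposite i00 m0i0) => //; move: laL ma; rewrite LE; lra.
  by apply: mirror => //; rewrite ?[`|dg - dl|]ler0_norm ?gtr0_norm//; lra.
have LE : L = mob d liq a by rewrite /L (max_idPl (mob_mono Hd liq (ltW ba))).
have GE : G = mob d gas (1 - b).
  by rewrite /G (max_idPr (mob_mono Hd gas _))// lerD2l lerN2 ltW.
have dgl : dl < dg by have := pc_decreasing Hd ba; move: pcE; lra.
have [dl0|dl0] := leP dl 0.
  have [dg0|dg0] := leP dg 0.
    by apply: mirror => //; rewrite ?[`|dg - dl|]gtr0_norm ?ler0_norm//; lra.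
  by apply: (edge_control_opposite i00 m0i0) => //; move: gaG ma; rewrite GE; lra.
have dg0 : 0 < dg by exact: lt_trans dgl.
rewrite (lt_geF dg0); apply: (edge_control_dominant i00 m0i0) => //.
  by rewrite !gtr0_norm//; lra.
by rewrite !gtr0_norm//; lra.
Qed.

End with_lower_bound.
End edge_estimates.

(** * Sums over faces and the discrete Poincare inequality in L2 *)

(** Young's inequality for the factors of a^2 - b^2. *)
Lemma sqr_difference_young (R : realType) (t r a b eps D : R) :
  0 <= t -> 0 <= D -> 0 < eps ->
  t * r * `|a ^+ 2 - b ^+ 2| <=
  ((4 * eps)^-1 + D) * (t * (a - b) ^+ 2) + 2 * eps * (t * r * r * (a ^+ 2 + b ^+ 2)).
Proof.
move=> t0 D0 e0; rewrite subr_sqr normrM.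
have h1 := sqrD_le2 a b.
rewrite -(real_normK (num_real (a - b))).
rewrite -(real_normK (num_real (a + b))) in h1.
set y := `|a + b| in h1 *; set z := `|a - b|.
have h3 : t * r ^+ 2 * eps * y ^+ 2 <= t * r ^+ 2 * eps * (2 * (a ^+ 2 + b ^+ 2)).
  by apply: ler_wpM2l => //; apply: mulr_ge0; [rewrite mulr_ge0 ?sqr_ge0|exact: ltW].
have h7 : 0 <= t * (eps * ((2 * eps)^-1 * z - r * y) ^+ 2).
  by apply: mulr_ge0 => //; apply: mulr_ge0; [exact: ltW|exact: sqr_ge0].
have E7 : t * (eps * ((2 * eps)^-1 * z - r * y) ^+ 2) =
  (4 * eps)^-1 * (t * z ^+ 2) - t * r * (z * y) + t * r ^+ 2 * eps * y ^+ 2.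
  by field; rewrite gt_eqF.
have h8 : 0 <= D * (t * z ^+ 2).
  by apply: mulr_ge0 => //; apply: mulr_ge0 => //; exact: sqr_ge0.
rewrite E7 in h7; lra.
Qed.

Section edge_sums.
Context (R : realType) (l : nat) (d : model_data R l) (m : mesh R l).
Hypothesis (Hd : standing_assumptions d) (Hm : admissible d m).
Implicit Types (K L : cv m) (e : ext m) (x : nb m).

Lemma sum_nb_split K (F : nb m -> R) :
  \sum_(x | is_nb d K x) F x =
  \sum_(L | adjacent K L) F (inl L) + \sum_(e | is_nb d K (inr e)) F (inr e).
Proof. by rewrite big_sumType. Qed.

Lemma sum_adjacent_swap (F : cv m -> cv m -> R) :
  \sum_K \sum_(L | adjacent K L) F K L = \sum_K \sum_(L | adjacent K L) F L K.
Proof.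
rewrite (exchange_big_dep predT)//=; apply: eq_bigr => K _.
by apply: eq_bigl => L; rewrite adjacentC.
Qed.

Lemma is_nb_ext K e : is_nb d K (inr e) -> K = ext_cell e.
Proof. by case/andP => /eqP. Qed.

Lemma nb_dist_gt0 K x : is_nb d K x -> 0 < nb_dist K x.
Proof.
case: x => [L|e] nKx.
  by apply: (nb_dist_int_gt0 Hm); exact: adjacent_neq.
by rewrite (is_nb_ext nKx); exact: (nb_dist_ext_gt0 Hm).
Qed.

Lemma tau_ge0 K x : is_nb d K x -> 0 <= tau K x.
Proof. by move=> Kx; rewrite divr_ge0 ?nb_area_ge0// ltW// nb_dist_gt0. Qed.

Lemma nb_areaE K x : is_nb d K x -> nb_area K x = tau K x * nb_dist K x.
Proof. by move=> Kx; rewrite divfK// gt_eqF// nb_dist_gt0. Qed.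

Lemma tau_sym K L : adjacent K L -> tau K (inl L) = tau L (inl K).
Proof. by move=> KL; rewrite /tau (nb_area_sym Hm KL) nb_dist_sym. Qed.

(** An interior face is seen from both of its sides. *)
Definition face_weight x : R := if x is inl _ then 2^-1 else 1.

Lemma face_weight_range x : 2^-1 <= face_weight x <= 1.
Proof. by case: x => ? /=; apply/andP; split; lra. Qed.

(** An interior flux occurs twice, with opposite signs; the mean of both
    occurrences gives half of the flux times the jump of w. Across the other
    faces w is extended by zero. *)
Lemma sum_flux_by_parts (F : cv m -> nb m -> R) (w : cv m -> R) :
  (forall K L, adjacent K L -> F L (inl K) = - F K (inl L)) ->
  \sum_K w K * \sum_(x | is_nb d K x) F K x =
  \sum_K \sum_(x | is_nb d K x) face_weight x * (F K x * (w K - nb_val w 0 x)).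
Proof.
move=> Fanti.
under eq_bigr do rewrite sum_nb_split mulrDr 2!mulr_sumr.
under [RHS]eq_bigr do rewrite sum_nb_split.
rewrite !big_split/=; congr (_ + _); last first.
  by apply: eq_bigr => K _; apply: eq_bigr => e _; rewrite mul1r subr0 mulrC.
set S := LHS.
have S1 : S = \sum_K \sum_(L | adjacent K L) - (F K (inl L) * w L).
  rewrite /S sum_adjacent_swap; apply: eq_bigr => K _; apply: eq_bigr => L KL.
  by rewrite Fanti// mulrN mulrC.
have half (z : R) : z = 2^-1 * (z + z) by lra.
rewrite [LHS]half {2}S1 /S -big_split/= mulr_sumr; apply: eq_bigr => K _.
rewrite -big_split/= mulr_sumr; apply: eq_bigr => L _.
by congr (_ * _); ring.
Qed.

Variable (xi : R).
Hypothesis (reg : mesh_regular m xi).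
Variable (M : R).
Hypothesis (OM : closure (Omega d) `<=` cube 0 M).
Local Notation D := (Num.sqrt (l%:R * ((2 * M) * (2 * M)))).

Lemma sum_area_dist_le (f : cv m -> R) : (forall K, 0 <= f K) ->
  \sum_K \sum_(L | adjacent K L) nb_area K (inl L) * nb_dist K (inl L) * f K <=
  xi * \sum_K volume K * f K.
Proof.
move=> f0; rewrite mulr_sumr; apply: ler_sum => K _; rewrite -mulr_suml mulrA.
by apply: ler_wpM2r; [exact: f0|exact: reg].
Qed.

Lemma sum_ext_le (F : ext m -> R) : (forall e, 0 <= F e) ->
  \sum_K \sum_(e | is_nb d K (inr e)) F e <= \sum_e F e.
Proof.
move=> F0; rewrite (exchange_big_dep predT)//=; apply: ler_sum => e _.
rewrite (bigID (pred1 (ext_cell e)))/= [X in _ + X]big1 ?addr0; last first.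
  by move=> K /andP[/andP[/eqP-> _]]; rewrite eqxx.
have [h|h] := boolP (is_nb d (ext_cell e) (inr e)).
  rewrite (big_pred1 (ext_cell e))// => K; rewrite -/(is_nb d K (inr e)).
  by apply/idP/idP => [/andP[]//|/eqP ->]; rewrite h eqxx.
by rewrite big1// => K /andP[hK /eqP KE]; move: h; rewrite -KE /= hK.
Qed.

(** On interior faces the jump of u^2 is split by Young's inequality; the part
    without jumps is weighted by area times distance, and mesh regularity bounds
    its sum by the L2 norm. On exterior faces the neighbouring value is zero, so
    that the jump alone suffices. *)
Lemma variation_sqr (u : cv m -> R) (eps : R) : 0 < eps ->
  variation d (fun K => u K ^+ 2) <=
  ((4 * eps)^-1 + D) *
    \sum_K \sum_(x | is_nb d K x) tau K x * (u K - nb_val u 0 x) ^+ 2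
  + 4 * (eps * xi) * \sum_K volume K * u K ^+ 2.
Proof.
move=> e0; rewrite /variation.
have i0 : 0 < (4 * eps)^-1 by rewrite invr_gt0 mulr_gt0.
have D0 : 0 <= D by exact: sqrtr_ge0.
pose A K L := nb_area K (inl L) * nb_dist K (inl L).
have -> : 4 * (eps * xi) * \sum_K volume K * u K ^+ 2 =
  2 * eps * (2 * (xi * \sum_K volume K * u K ^+ 2)) by ring.
apply: (@le_trans _ _ (((4 * eps)^-1 + D) *
    (\sum_K \sum_(x | is_nb d K x) tau K x * (u K - nb_val u 0 x) ^+ 2)
  + 2 * eps * \sum_K \sum_(L | adjacent K L) A K L * (u K ^+ 2 + u L ^+ 2))); last first.
  rewrite lerD2l; apply: ler_wpM2l; first by rewrite mulr_ge0// ltW.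
  have -> : \sum_K \sum_(L | adjacent K L) A K L * (u K ^+ 2 + u L ^+ 2) =
     2 * \sum_K \sum_(L | adjacent K L) A K L * u K ^+ 2.
    under eq_bigr do (under eq_bigr do rewrite mulrDr; rewrite big_split/=).
    rewrite big_split/= mulr_natl mulr2n; congr (_ + _).
    rewrite sum_adjacent_swap; apply: eq_bigr => K _; apply: eq_bigr => L KL.
    by rewrite /A -(nb_area_sym Hm KL) nb_dist_sym.
  apply: ler_wpM2l => //; apply: sum_area_dist_le => K; exact: sqr_ge0.
rewrite mulr_sumr [X in _ <= _ + X]mulr_sumr -big_split/=; apply: ler_sum => K _.
rewrite [X in X <= _]sum_nb_split [X in _ <= _ * X + _]sum_nb_split mulrDr addrAC.
apply: lerD.
  rewrite !mulr_sumr -big_split/=; apply: ler_sum => L KL.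
  have nKL : is_nb d K (inl L) by [].
  have t0 := tau_ge0 nKL; have a0 := nb_areaE nKL.
  have h := sqr_difference_young (nb_dist K (inl L)) (u K) (u L) t0 D0 e0.
  by rewrite -a0 in h; exact: h.
rewrite mulr_sumr; apply: ler_sum => e nKe.
have t0 := tau_ge0 nKe; rewrite (nb_areaE nKe) !subr0.
have rD : nb_dist K (inr e) <= D by rewrite (is_nb_ext nKe) (nb_dist_ext_le Hd Hm).
rewrite ger0_norm ?sqr_ge0//.
set t := tau _ _ in t0 *; set r := nb_dist _ _ in rD *.
have tu : 0 <= t * u K ^+ 2 by rewrite mulr_ge0 ?sqr_ge0.
have h := ler_wpM2r tu rD; have h' : 0 <= (4 * eps)^-1 * (t * u K ^+ 2).
  by rewrite mulr_ge0// ltW.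
have -> : t * r * u K ^+ 2 = r * (t * u K ^+ 2) by ring.
lra.
Qed.

End edge_sums.

Section poincare_L2.
Context (R : realType) (l : nat) (d : model_data R l).
Hypothesis (Hd : standing_assumptions d).

(** The inequality in total variation is applied to u^2; eps is small enough for
    the L2 norm on the right to be absorbed. *)
Lemma poincare_L2 (xi : R) : 0 < xi -> exists2 C : R, 0 < C & forall m : mesh R l,
  admissible d m -> mesh_regular m xi -> forall u : cv m -> R,
  \sum_K volume K * u K ^+ 2 <=
  C * \sum_K \sum_(x | is_nb d K x) tau K x * (u K - nb_val u 0 x) ^+ 2.
Proof.
move=> xi0; have [M M0 OM] := Omega_cube Hd; have [C C0 PC] := poincare_variation Hd.
set D := Num.sqrt (l%:R * ((2 * M) * (2 * M))).
have C1 : 0 < C + 1 by lra.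
(* This makes 4 * eps * xi * (C + 1) equal to 1 / 2. *)
pose eps := (8 * (xi * (C + 1)))^-1.
have eps0 : 0 < eps by rewrite invr_gt0 !mulr_gt0.
exists (2 * (C + 1) * ((4 * eps)^-1 + D)).
  by rewrite !mulr_gt0// ltr_wpDr ?sqrtr_ge0// invr_gt0 mulr_gt0.
move=> m Hm reg u; set P := \sum_K volume K * _.
set S := \sum_K \sum_(x | is_nb d K x) _.
have P0 : 0 <= P.
  by apply: sumr_ge0 => K _; rewrite mulr_ge0 ?sqr_ge0//; exact: ltW (volume_gt0 Hd Hm M0 OM K).
have PV : P <= (C + 1) * variation d (fun K => u K ^+ 2).
  apply: (le_trans _ (ler_wpM2r (variation_ge0 _ _) (_ : C <= C + 1))); last by lra.
  apply: le_trans (PC m Hm _); apply: ler_sum => K _.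
  by rewrite ger0_norm ?sqr_ge0.
have V := variation_sqr Hd Hm reg OM u eps0; rewrite -/S -/P -/D in V.
have := ler_wpM2l (ltW C1) V.
have -> : (C + 1) * (((4 * eps)^-1 + D) * S + 4 * (eps * xi) * P) =
  (C + 1) * (((4 * eps)^-1 + D) * S) + (8 * (xi * (C + 1)) * eps) * P / 2.
  by set k := (4 * eps)^-1; field.
rewrite mulfV ?mul1r; last by rewrite gt_eqF// !mulr_gt0.
have -> : 2 * (C + 1) * ((4 * eps)^-1 + D) * S =
  2 * ((C + 1) * (((4 * eps)^-1 + D) * S)) by ring.
lra.
Qed.

End poincare_L2.

(** * Means *)

Section means.
Context dd (X : measurableType dd) (R : realType) (mu : {measure set X -> \bar R}).
Implicit Types (D : set X) (f g : X -> R).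

Lemma mean_ae_eq D f g : measurable D -> measurable_fun D f -> measurable_fun D g ->
  {ae mu, forall x, D x -> f x = g x} -> mean mu D f = mean mu D g.
Proof.
move=> mD mf mg fg; rewrite /mean; congr (_ * fine _).
apply: ae_eq_integral => //; try exact/measurable_EFinP.
by apply: filterS fg => x fgx Dx; rewrite /= fgx.
Qed.

Lemma mean_ge0 D f : measurable D -> measurable_fun D f ->
  {ae mu, forall x, D x -> 0 <= f x} -> 0 <= mean mu D f.
Proof.
move=> mD mf f0; rewrite (@mean_ae_eq _ _ (fun x => Num.max (f x) 0))//.
- rewrite /mean; apply: mulr_ge0; first by rewrite invr_ge0 fine_ge0.
  by apply: Rintegral_ge0 => x _; rewrite le_max lexx orbT.
- exact: measurable_maxr.
- by apply: filterS f0 => x fx Dx; rewrite (max_idPl (fx Dx)).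
Qed.

Lemma ae_sub S D (P : X -> Prop) : S `<=` D ->
  {ae mu, forall x, D x -> P x} -> {ae mu, forall x, S x -> P x}.
Proof. by move=> SD; apply: filterS => x h /SD; exact: h. Qed.

Section positive_mass.
Variables (D : set X) (v : R).
Hypotheses (mD : measurable D) (muD : mu D = v%:E) (v0 : 0 < v).

Lemma Rintegral_mean f : \int[mu]_(x in D) f x = v * mean mu D f.
Proof. by rewrite /mean muD /= mulVKf// gt_eqF. Qed.

Let clamp (a b : R) f := fun x => Num.max a (Num.min b (f x)).

Let clampP a b f x : a <= b -> a <= clamp a b f x <= b.
Proof.
move=> ab; rewrite /clamp le_max lexx /= ge_max ab/=.
by rewrite ge_min lexx.
Qed.

Let clamp_measurable a b f : measurable_fun D f -> measurable_fun D (clamp a b f).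
Proof.
by move=> mf; apply: measurable_maxr => //; apply: measurable_minr.
Qed.

Let clamp_integrable a b f : a <= b -> measurable_fun D f ->
  mu.-integrable D (EFin \o clamp a b f).
Proof.
move=> ab mf; apply: measurable_bounded_integrable => //; last 2 first.
- exact: clamp_measurable.
- exists (`|a| + `|b|); split; first exact: num_real.
  move=> M ltM x _; apply: le_trans (ltW ltM).
  have /andP[h1 h2] := clampP f x ab.
  rewrite ler_norml; have := ler_norm b; have := ler_norm (- a); rewrite normrN.
  have := normr_ge0 a; have := normr_ge0 b => *; apply/andP; split; lra.
by rewrite muD ltry.
Qed.

Let clamp_ae a b f : {ae mu, forall x, D x -> a <= f x <= b} ->
  {ae mu, forall x, D x -> f x = clamp a b f x}.
Proof.
apply: filterS => x fx Dx; have /andP[h1 h2] := fx Dx.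
by rewrite /clamp (min_idPr h2) (max_idPr h1).
Qed.

Lemma mean_cst (c : R) : mean mu D (fun=> c) = c.
Proof. by rewrite /mean Rintegral_cst// muD /= mulrC mulfK// gt_eqF. Qed.

Let cst_integrable (c : R) : mu.-integrable D (EFin \o (fun=> c)).
Proof.
apply: measurable_bounded_integrable => //; first by rewrite muD ltry.
exists `|c|; split; first exact: num_real.
by move=> M cM x _; exact: ltW.
Qed.

Lemma mean_le f g : mu.-integrable D (EFin \o f) -> mu.-integrable D (EFin \o g) ->
  (forall x, D x -> f x <= g x) -> mean mu D f <= mean mu D g.
Proof.
move=> jf jg fg; by rewrite /mean ler_wpM2l//; exact: le_Rintegral.
Qed.

(** The truncation of f to [a, b] equals f almost everywhere and is
    integrable. *)
Lemma mean_range (a b : R) f : a <= b -> measurable_fun D f ->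
  {ae mu, forall x, D x -> a <= f x <= b} -> a <= mean mu D f <= b.
Proof.
move=> ab mf fab; rewrite (mean_ae_eq mD mf (clamp_measurable a b mf) (clamp_ae fab)).
have ic := clamp_integrable ab mf.
apply/andP; split.
  rewrite -[leLHS](mean_cst a).
  by apply: mean_le => // x _; have /andP[] := clampP f x ab.
rewrite -[leRHS](mean_cst b).
by apply: mean_le => // x _; have /andP[] := clampP f x ab.
Qed.

Lemma mean_unit_sum f g : measurable_fun D f -> measurable_fun D g ->
  {ae mu, forall x, D x -> 0 <= f x <= 1} -> {ae mu, forall x, D x -> 0 <= g x <= 1} ->
  {ae mu, forall x, D x -> f x + g x = 1} -> mean mu D f + mean mu D g = 1.
Proof.
move=> mf mg f01 g01 fg.
rewrite (mean_ae_eq mD mf (clamp_measurable 0 1 mf) (clamp_ae f01)).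
rewrite (mean_ae_eq mD mg (clamp_measurable 0 1 mg) (clamp_ae g01)).
have iF := clamp_integrable (@ler01 R) mf; have iG := clamp_integrable (@ler01 R) mg.
rewrite -mulrDr -RintegralD// -/(mean mu D _) -[RHS](mean_cst 1).
apply: mean_ae_eq => //.
  by apply: measurable_funD; exact: clamp_measurable.
apply: filterS3 fg (clamp_ae f01) (clamp_ae g01) => x h1 h2 h3 Dx.
by rewrite -h2// -h3// h1.
Qed.

(** Jensen's inequality: the integral of the square of f minus its mean is
    nonnegative. *)
Lemma mean_sqr_le f : measurable_fun D f ->
  mu.-integrable D (fun x => (f x ^+ 2)%:E) ->
  v * mean mu D f ^+ 2 <= \int[mu]_(x in D) f x ^+ 2.
Proof.
move=> mf if2; set c := mean mu D f.
have if1 : mu.-integrable D (EFin \o f).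
  apply: (@le_integrable _ _ _ mu _ _ _ (EFin \o (fun x => 1 + f x ^+ 2))) => //.
  - exact/measurable_EFinP.
  - move=> x _ /=; rewrite lee_fin [leRHS]ger0_norm ?addr_ge0 ?sqr_ge0//.
    rewrite -(real_normK (num_real (f x))); set y := `|f x|.
    by have := sqr_ge0 (y - 1); have := normr_ge0 (f x); rewrite -/y sqrrB; lra.
  - exact: (integrableD mD (cst_integrable 1) if2).
have i2c : mu.-integrable D (EFin \o (fun x => - (2 * c) * f x)).
  exact: (integrableZl mD (- (2 * c)) if1).
have ipoly : mu.-integrable D (EFin \o (fun x => - (2 * c) * f x + c ^+ 2)).
  exact: (integrableD mD i2c (cst_integrable (c ^+ 2))).
have : 0 <= \int[mu]_(x in D) (f x ^+ 2 + (- (2 * c) * f x + c ^+ 2)).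
  by apply: Rintegral_ge0 => x _; have := sqr_ge0 (f x - c); rewrite sqrrB; lra.
rewrite RintegralD// RintegralD// RintegralZl// Rintegral_cst// muD /= (Rintegral_mean f) -/c.
by lra.
Qed.

End positive_mass.

(** Jensen's inequality on each of the disjoint sets. *)
Lemma sum_mean_sqr_le (I : finType) (D : I -> set X) (v : I -> R) f :
  measurable_fun setT f -> mu.-integrable setT (fun x => (f x ^+ 2)%:E) ->
  (forall i, measurable (D i)) -> (forall i, mu (D i) = (v i)%:E) ->
  (forall i, 0 < v i) -> (forall i j, i != j -> D i `&` D j = set0) ->
  \sum_i v i * mean mu (D i) f ^+ 2 <= \int[mu]_x f x ^+ 2.
Proof.
move=> mf if2 mD muD v0 dis.
have if2D i : mu.-integrable (D i) (fun x => (f x ^+ 2)%:E).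
  exact: integrableS if2.
apply: (@le_trans _ _ (\sum_i \int[mu]_(x in D i) f x ^+ 2)).
  apply: ler_sum => i _; apply: mean_sqr_le => //.
  exact: measurable_funS mf.
rewrite -lee_fin -sumEFin /Rintegral.
under eq_bigr do rewrite fineK ?integrable_fin_num//.
rewrite fineK ?integrable_fin_num//.
have mf2 : measurable_fun setT (fun x => (f x ^+ 2)%:E).
  by apply/measurable_EFinP; exact: measurable_funX.
rewrite -ge0_integral_bigsetU//; last 4 first.
- exact: index_enum_uniq.
- apply/trivIsetP => i j _ _; exact: dis.
- exact: measurable_funS mf2.
- by move=> x _; rewrite lee_fin sqr_ge0.
apply: ge0_subset_integral => //; first exact: bigsetU_measurable.
by move=> x _; rewrite lee_fin sqr_ge0.
Qed.

Lemma square_integrableP D f : measurable D -> square_integrable mu D f ->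
  measurable_fun setT (f \_ D) /\ mu.-integrable setT (fun x => ((f \_ D) x ^+ 2)%:E).
Proof.
move=> mD fD; split; first by have := sub_Lfun_mfun fD; rewrite inE.
exact: Lfun2_integrable_sqr.
Qed.

Lemma mean_patch S D f : S `<=` D -> mean mu S f = mean mu S (f \_ D).
Proof.
move=> SD; rewrite /mean; congr (_ * _); apply: eq_Rintegral => x.
by rewrite inE patchE => /SD Dx; rewrite mem_set.
Qed.

Lemma mean_patch_ge0 S D f : measurable S -> S `<=` D -> measurable_fun setT (f \_ D) ->
  {ae mu, forall x, D x -> 0 <= f x} -> 0 <= mean mu S f.
Proof.
move=> mS SD mf f0; rewrite (mean_patch _ SD); apply: mean_ge0 => //.
  exact: measurable_funS mf.
by apply: filterS f0 => x h /SD Dx; rewrite patchE mem_set//; exact: h.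
Qed.

End means.

(** * Means of the data over cells and slabs *)

Section discrete_data.
Context (R : realType) (l : nat) (d : model_data R l) (m : mesh R l).
Hypothesis (Hd : standing_assumptions d) (Hm : admissible d m).
Variable (M : R).
Hypothesis (M0 : 0 < M) (OM : closure (Omega d) `<=` cube 0 M).
Variable (N : nat).
Implicit Types (K : cv m) (n : nat) (al : phase).
Local Notation tn := (tn d N).
Local Notation dt := (dt d N).

Let Omega_open : open (Omega d).
Proof. by have [ps ->] := Omega_polygonal Hd; exact: open_interior. Qed.

Let Omega_measurable : measurable (Omega d).
Proof. exact: open_measurable_rV. Qed.

Let vol_gt0 K : 0 < volume K.
Proof. exact: (volume_gt0 Hd Hm M0 OM K). Qed.

Let volE K : lebesgue_rV l (cell K) = (volume K)%:E.
Proof. exact: (volumeE Hd Hm M0 OM K). Qed.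

Let cO K : cell K `<=` Omega d.
Proof. exact: (cell_sub_Omega Hd Hm). Qed.

Let mcell K : measurable (cell K).
Proof. exact: (cell_measurable Hm). Qed.

Lemma dt_gt0 : 0 < dt.
Proof. by rewrite /Defs.dt divr_gt0// ?ltr0n//; exact: (T_end_gt0 Hd). Qed.

Lemma tnS n : tn n.+1 = tn n + dt.
Proof. by rewrite /Defs.tn -natr1 mulrDl mul1r. Qed.

Lemma tn_le i j : (i <= j)%N -> tn i <= tn j.
Proof. by move=> ij; rewrite /Defs.tn ler_wpM2r ?ler_nat// ltW// dt_gt0. Qed.

Lemma tn_end : tn N.+1 = T_end d.
Proof. by rewrite /Defs.tn /Defs.dt mulrC divfK// pnatr_eq0. Qed.

Definition slab n K : set (R * 'rV[R]_l) := `]tn n, tn n.+1[ `*` cell K.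

Lemma slab_measurable n K : measurable (slab n K : set (measurableTypeR R * 'rV[R]_l)).
Proof. by apply: measurableX => //. Qed.

Lemma Q_T_measurable : measurable (Q_T d : set (measurableTypeR R * 'rV[R]_l)).
Proof. by apply: measurableX => //. Qed.

Lemma slab_mass n K : space_time R l (slab n K) = (dt * volume K)%:E.
Proof.
have -> : space_time R l (slab n K) =
    (lebesgue_measure `]tn n, tn n.+1[%classic * lebesgue_rV l (cell K))%E.
  exact: product_measure1E.
rewrite lebesgue_measure_itv/= lte_fin tnS.
by rewrite ltrDl dt_gt0 -EFinD addrAC subrr add0r volE.
Qed.

Lemma slab_sub_Q_T n K : (n <= N)%N -> slab n K `<=` Q_T d.
Proof.
move=> nN [t x] [/= + Kx]; rewrite in_itv/= => /andP[h1 h2]; split => /=; last exact: (cO Kx).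
rewrite in_itv/=; apply/andP; split.
  by apply: le_lt_trans h1; rewrite mulr_ge0// ltW// dt_gt0.
by apply: (lt_le_trans h2); rewrite -tn_end; exact: tn_le.
Qed.

Lemma slab_disjoint n n' K K' : (n, K) != (n', K') -> slab n K `&` slab n' K' = set0.
Proof.
have dis i j L L' : (i < j)%N -> slab i L `&` slab j L' = set0.
  move=> ij; rewrite -subset0 => -[t x] [[/= + _] [/= + _]].
  rewrite !in_itv/= => /andP[_ h1] /andP[h2 _].
  by have := tn_le ij; have := lt_trans h2 h1; case: ltgtP.
move=> ne; have [nn|nn|nn] := ltngtP n n'; first exact: dis.
  by rewrite setIC; exact: dis.
have KK : K != K' by apply: contraNneq ne => ->; rewrite nn.
rewrite -subset0 => -[t x] [[/= _ h1] [/= _ h2]].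
have : (cell K `&` cell K') x by [].
by rewrite (cell_disjoint Hm KK).
Qed.


Lemma slab_mean_unit al n K : (n <= N)%N -> 0 <= slab_mean d N (sI d al) n K <= 1.
Proof.
move=> nN; have sQ := @slab_sub_Q_T n K nN.
apply: (mean_range (slab_measurable n K) (slab_mass n K)) => //.
- by rewrite mulr_gt0 ?dt_gt0.
- by apply: measurable_funS (sI_measurable Hd al) => //; exact: Q_T_measurable.
- exact: (@ae_sub _ _ _ (space_time R l) _ _ _ sQ (sI_range Hd al)).
Qed.

Lemma slab_mean_ge0 (f : R * 'rV[R]_l -> R) n K : (n <= N)%N ->
  square_integrable (space_time R l) (Q_T d) f ->
  {ae space_time R l, forall z, Q_T d z -> 0 <= f z} -> 0 <= slab_mean d N f n K.
Proof.
move=> nN f2 f0; have sQ := @slab_sub_Q_T n K nN.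
have [mf _] := square_integrableP Q_T_measurable f2.
exact: (mean_patch_ge0 (slab_measurable n K) sQ mf f0).
Qed.

Lemma slab_mean_patch (f : R * 'rV[R]_l -> R) n K : (n <= N)%N ->
  slab_mean d N f n K = mean (space_time R l) (slab n K) (f \_ (Q_T d)).
Proof. by move=> nN; apply: mean_patch; exact: slab_sub_Q_T. Qed.

Lemma sum_slab_mean_sqr (f : R * 'rV[R]_l -> R) :
  square_integrable (space_time R l) (Q_T d) f ->
  \sum_(n < N) dt * \sum_(K : cv m) volume K * slab_mean d N f n K ^+ 2 <=
  \int[space_time R l]_z ((f \_ (Q_T d)) z) ^+ 2.
Proof.
move=> f2; have [mf jf] := square_integrableP Q_T_measurable f2.
pose D (i : 'I_N * cv m) := slab i.1 i.2.
have := @sum_mean_sqr_le _ _ _ (space_time R l) _ D (fun i => dt * volume i.2) _ mf jf.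
move=> H; apply: le_trans (H _ _ _ _).
- rewrite -(pair_bigA _ (fun (n : 'I_N) K => dt * volume K *
    mean (space_time R l) (slab n K) (f \_ (Q_T d)) ^+ 2))/=.
  apply: ler_sum => n _; rewrite mulr_sumr; apply: ler_sum => K _.
  by rewrite mulrA slab_mean_patch// ltnW.
- by move=> i; exact: slab_measurable.
- by move=> i; exact: slab_mass.
- by move=> i; rewrite mulr_gt0 ?dt_gt0.
- move=> [i K] [j L] ij; apply: slab_disjoint; apply: contraNneq ij => -[/= e1 e2].
  by rewrite e2; apply/eqP; congr (_, _); exact/val_inj.
Qed.

(** A cell has positive measure, so that the bounds of phi are consistent. *)
Lemma phiK_range (a b : R) : 0 < a ->
  {ae lebesgue_rV l, forall x, Omega d x -> a <= phi d x <= b} ->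
  forall K, a <= phiK d K <= b.
Proof.
move=> a0 ab K.
have ab' : {ae lebesgue_rV l, forall x, cell K x -> a <= phi d x <= b}.
  exact: (ae_sub (@cO K) ab).
have mphi : measurable_fun (cell K) (phi d).
  by apply: measurable_funS (phi_measurable Hd) => //; exact: cO.
apply: (mean_range (mcell K) (volE K)) => //.
have [//|ba] := leP a b.
have [Z [mZ Z0 sub]] := ab'.
have : (lebesgue_rV l (cell K) <= lebesgue_rV l Z)%E.
  apply: le_measure; rewrite ?inE// => x Kx; apply: sub => /= /(_ Kx) /andP[h1 h2].
  by have := le_trans h1 h2; rewrite leNgt ba.
by rewrite Z0 volE lee_fin leNgt vol_gt0.
Qed.

Lemma sum_mean_p0_sqr al :
  \sum_(K : cv m) volume K * mean (lebesgue_rV l) (cell K) (p0 d al) ^+ 2 <=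
  \int[lebesgue_rV l]_x ((p0 d al \_ (Omega d)) x) ^+ 2.
Proof.
have [mf jf] := square_integrableP Omega_measurable (p0_L2 Hd al).
have := @sum_mean_sqr_le _ _ _ (lebesgue_rV l) _ (@cell R l m) (@volume R l m) _ mf jf.
move=> H; apply: le_trans (H _ _ _ _) => //.
  by apply: ler_sum => K _; rewrite (mean_patch _ _ (@cO K)).
by move=> K L; exact: (cell_disjoint Hm).
Qed.

Lemma s0_mean_unit al K : 0 <= mean (lebesgue_rV l) (cell K) (s0 d al) <= 1.
Proof.
apply: (mean_range (mcell K) (volE K)) => //.
- by apply: measurable_funS (s0_measurable Hd al) => //; exact: cO.
- exact: (ae_sub (@cO K) (s0_range Hd al)).
Qed.

Lemma s0_mean_sum K : mean (lebesgue_rV l) (cell K) (s0 d liq) +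
  mean (lebesgue_rV l) (cell K) (s0 d gas) = 1.
Proof.
have ms al : measurable_fun (cell K) (s0 d al).
  by apply: measurable_funS (s0_measurable Hd al) => //; exact: cO.
apply: (mean_unit_sum (mcell K) (volE K)) => //.
- exact: (ae_sub (@cO K) (s0_range Hd liq)).
- exact: (ae_sub (@cO K) (s0_range Hd gas)).
- exact: (ae_sub (@cO K) (s0_sum Hd)).
Qed.

End discrete_data.

(** * Saturations stay in [0, 1] *)

Section saturations.
Context (R : realType) (l : nat) (d : model_data R l) (m : mesh R l).
Hypothesis (Hd : standing_assumptions d) (Hm : admissible d m).
Variables (N : nat) (p s : phase -> nat -> cv m -> R).
Hypothesis (sol : is_solution d N p s).
Implicit Types (K L : cv m) (x : nb m) (n : nat) (al : phase).

Lemma pos_part_ge0 (c : R) : 0 <= pos_part c.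
Proof. by rewrite le_max lexx orbT. Qed.

Lemma neg_part_ge0 (c : R) : 0 <= neg_part c.
Proof. by rewrite le_max lexx orbT. Qed.

Lemma pos_partN (c : R) : pos_part (- c) = neg_part c.
Proof. by []. Qed.

Lemma neg_partN (c : R) : neg_part (- c) = pos_part c.
Proof. by rewrite /neg_part opprK. Qed.

Lemma pos_part_le_norm (c : R) : pos_part c <= `|c|.
Proof. by rewrite ge_max ler_norm normr_ge0. Qed.

Lemma neg_part_le_norm (c : R) : neg_part c <= `|c|.
Proof. by rewrite -pos_partN -normrN pos_part_le_norm. Qed.

Lemma rhoKL_gt0 al n K x : 0 < rhoKL d p al n K x.
Proof.
have [rm [rM [rm0 rr]]] := rho_range Hd.
have /andP[h _] := rho_mean_range Hd (p al n K) (p_nb p al n x) rm0 (rr al).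
exact: lt_le_trans h.
Qed.

Lemma phiK_gt0 K : 0 < phiK d K.
Proof.
have [M M0 OM] := Omega_cube Hd.
have [a [b [a0 b0 ab]]] := phi_range Hd.
by have /andP[h _] := phiK_range Hd Hm M0 OM a0 ab K; exact: lt_le_trans h.
Qed.

(** Discrete maximum principle. If a saturation became negative, the mobility of
    the phase would vanish in the cell, so that the fluxes and the sources could
    only increase the mass of the phase, which was nonnegative before. *)
Lemma sat_ge0 al n K : (n <= N.+1)%N -> 0 <= s al n K.
Proof.
have [M M0 OM] := Omega_cube Hd.
elim: n al K => [|n IH] al K nN.
  by rewrite (init_s sol); have /andP[] := s0_mean_unit Hd Hm M0 OM al K.
have [//|sneg] := leP 0 (s al n.+1 K).
rewrite ltnS in nN.
have mb := scheme_mass sol al K nN.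
have v0 := volume_gt0 Hd Hm M0 OM K; have ph0 := phiK_gt0 K.
have dt0 := dt_gt0 Hd N.
have M_0 : mob d al (s al n.+1 K) = 0 by apply: mob_neg => //; exact: ltW.
have flux0 : \sum_(x | is_nb d K x) tau K x * rhoKL d p al n.+1 K x *
    upwind_flux d al (s al n.+1 K) (s_nb s al n.+1 x) (p_nb p al n.+1 x - p al n.+1 K) <= 0.
  apply: sumr_le0 => x nx; rewrite /upwind_flux M_0 mul0r addr0 mulNr mulrN oppr_le0.
  apply: mulr_ge0; first by rewrite mulr_ge0 ?(tau_ge0 Hm)// ltW// rhoKL_gt0.
  by rewrite mulr_ge0 ?mob_ge0T ?pos_part_ge0.
have grav0 : gravity_flux d p s al n.+1 K <= 0.
  apply: sumr_le0 => x nx; rewrite M_0 mul0r sub0r mulrN oppr_le0.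
  apply: mulr_ge0; first by apply: mulr_ge0; [exact: nb_area_ge0|exact: sqr_ge0].
  by rewrite mulr_ge0 ?mob_ge0T ?neg_part_ge0.
have r0 := rho_gt0 Hd al (p al n.+1 K); have r1 := rho_gt0 Hd al (p al n K).
have fP0 := slab_mean_ge0 Hd Hm K nN (fP_L2 Hd) (fP_ge0 Hd).
have fI0 := slab_mean_ge0 Hd Hm K nN (fI_L2 Hd) (fI_ge0 Hd).
have /andP[sI0 _] := slab_mean_unit Hd Hm M0 OM al K nN.
have prod0 : volume K * rho d al (p al n.+1 K) * s al n.+1 K * slab_mean d N (fP d) n K <= 0.
  have vr0 : 0 < volume K * rho d al (p al n.+1 K) by exact: mulr_gt0.
  have vrs : volume K * rho d al (p al n.+1 K) * s al n.+1 K <= 0.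
    by rewrite pmulr_rle0// ltW.
  exact: (mulr_le0_ge0 vrs fP0).
have rhs0 : 0 <= volume K * rho d al (p al n.+1 K) * slab_mean d N (sI d al) n K * slab_mean d N (fI d) n K.
  by apply: mulr_ge0 => //; apply: mulr_ge0 => //; rewrite mulr_ge0// ltW.
have acc : 0 <= volume K * phiK d K * ((rho d al (p al n.+1 K) * s al n.+1 K -
    rho d al (p al n K) * s al n K) / dt d N).
  by rewrite /mass_balance in mb; lra.
have dti : 0 < (dt d N)^-1 by rewrite invr_gt0.
rewrite (pmulr_rge0 _ (mulr_gt0 v0 ph0)) (pmulr_lge0 _ dti) in acc; move: acc.
have := IH al K (leqW nN) => sn0.
have := mulr_ge0 (ltW r1) sn0; have : rho d al (p al n.+1 K) * s al n.+1 K < 0.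
  by rewrite pmulr_rlt0.
by lra.
Qed.

Lemma sat_sum n K : (n <= N.+1)%N -> s gas n K = 1 - s liq n K.
Proof.
case: n => [_|n nN]; last by have := scheme_sum sol K nN; lra.
have [M M0 OM] := Omega_cube Hd.
by rewrite !(init_s sol); have := s0_mean_sum Hd Hm M0 OM K; lra.
Qed.

Lemma sat_unit al n K : (n <= N.+1)%N -> 0 <= s al n K <= 1.
Proof.
move=> nN; rewrite (sat_ge0 al K nN)/=.
by have := sat_sum K nN; have := sat_ge0 gas K nN; have := sat_ge0 liq K nN; case: al; lra.
Qed.

Lemma s_nb_unit al n x : (n <= N.+1)%N -> 0 <= s_nb s al n x <= 1.
Proof.
move=> nN; case: x => [L|e]; first exact: sat_unit.
by case: al; rewrite /s_nb /= lexx ler01.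
Qed.

Lemma s_nb_gas n x : (n <= N.+1)%N -> s_nb s gas n x = 1 - s_nb s liq n x.
Proof.
by move=> nN; case: x => [L|e]; [exact: sat_sum|rewrite /s_nb /= subrr].
Qed.

Lemma pc_nb n x : (n <= N)%N ->
  pc d (s_nb s liq n.+1 x) = p_nb p gas n.+1 x - p_nb p liq n.+1 x.
Proof.
move=> nN; case: x => [L|e]; first exact: (scheme_pc sol).
by rewrite /s_nb /p_nb /= subr0; exact: pc_1 Hd.
Qed.

Definition delta_p al n K x : R := p_nb p al n x - p al n K.

Definition dissipation n K x : R :=
  upwind_mob d p s liq n K x * delta_p liq n K x ^+ 2 +
  upwind_mob d p s gas n K x * delta_p gas n K x ^+ 2.

Definition max_mob_edge al n K x : R :=
  Num.max (mob d al (s al n K)) (mob d al (s_nb s al n x)).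

Lemma upwind_mob_ge0 al n K x : 0 <= upwind_mob d p s al n K x.
Proof. by rewrite /upwind_mob; case: ifP => _; exact: mob_ge0T. Qed.

Lemma dissipation_ge0 n K x : 0 <= dissipation n K x.
Proof. by rewrite addr_ge0// mulr_ge0 ?upwind_mob_ge0 ?sqr_ge0. Qed.

(** On a face in Gamma_l the fictitious values satisfy the same relations as those
    of a cell, since pc vanishes at 1; edge_estimate applies to all faces. *)
Lemma scheme_edge_control (m0 : R) n K x : 0 < m0 ->
  (forall z, 0 <= z <= 1 -> m0 <= mob_tot d z) -> (n <= N)%N ->
  edge_control (edge_const (max_mob d) m0^-1)
    (upwind_mob d p s liq n.+1 K x) (upwind_mob d p s gas n.+1 K x)
    (max_mob_edge liq n.+1 K x) (max_mob_edge gas n.+1 K x)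
    (delta_p liq n.+1 K x) (delta_p gas n.+1 K x)
    (delta_sl s (pbar d) n.+1 K x) (delta_sl s (ptilde d) n.+1 K x)
    (delta_sl s (calB d) n.+1 K x).
Proof.
move=> m0_gt0 m0P nN.
have := @edge_estimate _ _ _ Hd _ m0_gt0 m0P (s liq n.+1 K) (s_nb s liq n.+1 x)
  (delta_p liq n.+1 K x) (delta_p gas n.+1 K x).
rewrite -(@sat_sum n.+1 K nN) -(@s_nb_gas n.+1 x nN); apply.
- exact: sat_unit.
- exact: s_nb_unit.
- by rewrite pc_nb// (scheme_pc sol)// /delta_p; ring.
Qed.

End saturations.

(** * Energy balance of one time step *)

Lemma young (R : realFieldType) (k a b : R) : 0 < k ->
  a * b <= k * a ^+ 2 + (4 * k)^-1 * b ^+ 2.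
Proof.
move=> k0; have h : 0 <= k * (a - (2 * k)^-1 * b) ^+ 2.
  by apply: mulr_ge0; [exact: ltW|exact: sqr_ge0].
have E : k * (a - (2 * k)^-1 * b) ^+ 2 = k * a ^+ 2 - a * b + (4 * k)^-1 * b ^+ 2.
  by field; rewrite gt_eqF.
by rewrite E in h; lra.
Qed.

Lemma diff_nonneg_le (R : realDomainType) (a b c : R) : 0 <= a -> 0 <= b -> a <= c -> b <= c ->
  `|a - b| <= c.
Proof. by move=> *; rewrite ler_norml; apply/andP; split; lra. Qed.

Section energy_step.
Context (R : realType) (l : nat) (d : model_data R l) (m : mesh R l).
Hypothesis (Hd : standing_assumptions d) (Hm : admissible d m).
Variables (N : nat) (p s : phase -> nat -> cv m -> R).
Hypothesis (sol : is_solution d N p s).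
Variables (rm rM : R).
Hypotheses (rm0 : 0 < rm) (rr : forall al z, rm <= rho d al z <= rM).
Variable (n : nat).
Hypothesis (nN : (n <= N)%N).
Implicit Types (K L : cv m) (x : nb m) (al : phase).
Local Notation H al K := (enthalpy d al (p al n.+1 K)).

Lemma enthalpy_nb al x :
  nb_val (fun K => H al K) 0 x = enthalpy d al (p_nb p al n.+1 x).
Proof. by case: x => [//|e]; rewrite /p_nb /= enthalpy0. Qed.

Lemma rhoKL_enthalpy al K x :
  rhoKL d p al n.+1 K x * (H al K - nb_val (fun K => H al K) 0 x) = - delta_p p al n.+1 K x.
Proof.
rewrite enthalpy_nb -opprB mulrN; congr (- _).
exact: rho_mean_enthalpy.
Qed.

Lemma upwind_fluxE al K x :
  upwind_flux d al (s al n.+1 K) (s_nb s al n.+1 x) (p_nb p al n.+1 x - p al n.+1 K) =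
  - (upwind_mob d p s al n.+1 K x * delta_p p al n.+1 K x).
Proof.
rewrite /upwind_flux /upwind_mob -/(delta_p p al n.+1 K x) /pos_part /neg_part.
set c := delta_p _ _ _ _ _; case: (leP c 0) => c0.
  by rewrite max_l ?oppr_ge0//; ring.
rewrite max_r; first by ring.
by rewrite oppr_le0 ltW.
Qed.

Lemma rhoKL_sym al K L : rhoKL d p al n.+1 L (inl K) = rhoKL d p al n.+1 K (inl L).
Proof. exact: rho_mean_sym. Qed.

(** Summation by parts; the flux is minus the upwind mobility times the pressure
    jump, and rho_mean times the enthalpy jump is the pressure jump. *)
Lemma diffusion_energy al :
  2^-1 * \sum_K \sum_(x | is_nb d K x)
    tau K x * (upwind_mob d p s al n.+1 K x * delta_p p al n.+1 K x ^+ 2) <=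
  \sum_K H al K * \sum_(x | is_nb d K x) tau K x * rhoKL d p al n.+1 K x *
    upwind_flux d al (s al n.+1 K) (s_nb s al n.+1 x) (p_nb p al n.+1 x - p al n.+1 K).
Proof.
rewrite sum_flux_by_parts; last first.
  move=> K L KL; rewrite -(tau_sym Hm KL) rhoKL_sym -mulrN; congr (_ * _).
  rewrite /upwind_flux /p_nb /s_nb /= -(opprB (p al n.+1 L)) pos_partN neg_partN.
  by ring.
rewrite mulr_sumr; apply: ler_sum => K _; rewrite mulr_sumr; apply: ler_sum => x nx.
rewrite upwind_fluxE.
have -> : tau K x * rhoKL d p al n.+1 K x *
    - (upwind_mob d p s al n.+1 K x * delta_p p al n.+1 K x) *
    (H al K - nb_val (fun K => H al K) 0 x) =
  - (tau K x * (upwind_mob d p s al n.+1 K x * delta_p p al n.+1 K x) *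
    (rhoKL d p al n.+1 K x * (H al K - nb_val (fun K => H al K) 0 x))) by ring.
rewrite rhoKL_enthalpy; set U := upwind_mob _ _ _ _ _ _ _; set c := delta_p _ _ _ _ _.
have -> : - (tau K x * (U * c) * - c) = tau K x * (U * c ^+ 2) by ring.
apply: ler_wpM2r; last by have /andP[] := face_weight_range x.
apply: mulr_ge0; first exact: (tau_ge0 Hm nx).
by apply: mulr_ge0; [exact: upwind_mob_ge0|exact: sqr_ge0].
Qed.

Lemma dotv_nb_normal_le K x : is_nb d K x -> `|dotv (grav d) (nb_normal K x)| <= enorm (grav d).
Proof.
move=> nx; have -> : dotv (grav d) (nb_normal K x) = dotv (nb_normal K x) (grav d).
  by apply: eq_bigr => i _; rewrite mulrC.
apply: dotv_le_enorm; case: x nx => [L|e] nx; first exact: (face_normal_unit Hm nx).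
by have [] := ext_face_normal Hm e.
Qed.

(** After summation by parts, the work of gravity on a face is at most a constant
    times area, mobility and pressure jump. Young's inequality bounds it by a
    small multiple of the pressure term and by area times distance. *)
Lemma gravity_energy al (k : R) : 0 < k ->
  - \sum_K H al K * gravity_flux d p s al n.+1 K <=
  \sum_K \sum_(x | is_nb d K x)
    (tau K x * (k * (max_mob d * (max_mob_edge d s al n.+1 K x * delta_p p al n.+1 K x ^+ 2)))
     + (4 * k)^-1 * (rM * enorm (grav d)) ^+ 2 * (nb_area K x * nb_dist K x)).
Proof.
move=> k0; rewrite sum_flux_by_parts; last first.
  move=> K L KL; rewrite -(nb_area_sym Hm KL) rhoKL_sym -[RHS]mulrN; congr (_ * _).
  have -> : dotv (grav d) (nb_normal L (inl K)) = - dotv (grav d) (nb_normal K (inl L)).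
    rewrite /= (face_normalN Hm KL) /dotv -sumrN; apply: eq_bigr => i _.
    by rewrite !mxE mulrN.
  by rewrite pos_partN neg_partN /s_nb /= opprB.
rewrite -sumrN; apply: ler_sum => K _; rewrite -sumrN; apply: ler_sum => x nx.
apply: (le_trans (ler_norm _)); rewrite normrN normrM.
set A := nb_area K x; set r := nb_dist K x; set G := enorm (grav d).
set mx := max_mob_edge _ _ _ _ _ _; set dl := delta_p _ _ _ _ _.
set rk := rhoKL _ _ _ _ _ _; set B := mob d al _ * _ - _.
have A0 : 0 <= A by exact: nb_area_ge0.
have G0 : 0 <= G by exact: enorm_ge0.
have mxl : mob d al (s al n.+1 K) <= mx by rewrite le_max lexx.
have mxr : mob d al (s_nb s al n.+1 x) <= mx by rewrite le_max lexx orbT.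
have mx0 : 0 <= mx by apply: le_trans mxl; exact: mob_ge0T.
have mxM : mx <= max_mob d by rewrite ge_max !mob_le_max.
have BG : `|B| <= mx * G.
  have gG := dotv_nb_normal_le nx.
  apply: diff_nonneg_le; first by rewrite mulr_ge0 ?mob_ge0T ?pos_part_ge0.
  - by rewrite mulr_ge0 ?mob_ge0T ?neg_part_ge0.
  - apply: ler_pM => //; [exact: mob_ge0T|exact: pos_part_ge0|].
    exact: le_trans (pos_part_le_norm _) gG.
  - apply: ler_pM => //; [exact: mob_ge0T|exact: neg_part_ge0|].
    exact: le_trans (neg_part_le_norm _) gG.
have /andP[rk0 rkM] : 0 <= rk <= rM.
  have /andP[h1 h2] := rho_mean_range Hd (p al n.+1 K) (p_nb p al n.+1 x) rm0 (rr al).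
  by apply/andP; split; [exact: le_trans (ltW rm0) h1|exact: h2].
have step : `|A * rk ^+ 2 * B * (H al K - nb_val (fun K => H al K) 0 x)| <=
    A * (rM * (mx * G) * `|dl|).
  have -> : A * rk ^+ 2 * B * (H al K - nb_val (fun K => H al K) 0 x) =
    A * (rk * B * (rk * (H al K - nb_val (fun K => H al K) 0 x))) by ring.
  rewrite rhoKL_enthalpy !normrM normrN (ger0_norm A0) (ger0_norm rk0).
  by apply: ler_wpM2l => //; apply: ler_wpM2r => //; apply: ler_pM.
apply: (@le_trans _ _ (A * (rM * (mx * G) * `|dl|))).
  apply: le_trans step; rewrite -[leRHS]mul1r; apply: ler_wpM2r => //.
  by have /andP[h1 h2] := face_weight_range x; rewrite ger0_norm//; lra.
have t0 := tau_ge0 Hm nx; have AE : A = tau K x * r := nb_areaE Hm nx.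
set t := tau K x in t0 AE *.
have h1 := young (mx * `|dl|) (r * (rM * G)) k0.
have h2 : (mx * `|dl|) ^+ 2 <= max_mob d * (mx * dl ^+ 2).
  rewrite exprMn real_normK ?num_real// [mx ^+ 2]expr2 -mulrA; apply: ler_wpM2r => //.
  by apply: mulr_ge0 => //; exact: sqr_ge0.
have h3 := ler_wpM2l t0 (le_trans h1 (lerD (ler_wpM2l (ltW k0) h2) (lexx _))).
apply: le_trans (le_trans _ h3) _.
  by rewrite AE le_eqVlt; apply/orP; left; apply/eqP; ring.
by rewrite AE le_eqVlt; apply/orP; left; apply/eqP; ring.
Qed.

(** The energy per unit of pore volume; the capillary term compensates for the
    difference of the two pressures in the time increment. *)
Definition cell_energy (i : nat) K : R :=
  s liq i K * (rho d liq (p liq i K) * enthalpy d liq (p liq i K) - p liq i K) +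
  s gas i K * (rho d gas (p gas i K) * enthalpy d gas (p gas i K) - p gas i K) -
  cap_energy d (s liq i K).

(** Concavity of the enthalpy. *)
Lemma enthalpy_mass_increment al (a b a' b' : R) : 0 <= a ->
  b' * (rho d al a' * enthalpy d al a' - a') - a * (rho d al b * enthalpy d al b - b) +
    (b' - a) * a' <=
  enthalpy d al a' * (rho d al a' * b' - rho d al b * a).
Proof.
move=> a0; have r0 := rho_gt0 Hd al b.
have h := enthalpy_tangent Hd al b a'.
have ra : 0 <= rho d al b * a by rewrite mulr_ge0// ltW.
have h' := ler_wpM2l ra h.
have E : rho d al b * a * ((rho d al b)^-1 * (a' - b)) = a * (a' - b).
  by field; rewrite gt_eqF.
by rewrite E in h'; lra.
Qed.

(** Concavity of the enthalpies leaves the saturation increments times the new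
    pressures. As the saturations sum to one, this is minus pc times the liquid
    increment, which concavity of the capillary energy bounds. *)
Lemma cell_energy_increment K :
  cell_energy n.+1 K - cell_energy n K <=
  H liq K * (rho d liq (p liq n.+1 K) * s liq n.+1 K - rho d liq (p liq n K) * s liq n K) +
  H gas K * (rho d gas (p gas n.+1 K) * s gas n.+1 K - rho d gas (p gas n K) * s gas n K).
Proof.
have nN1 : (n <= N.+1)%N by exact: leqW.
have hl := enthalpy_mass_increment liq (p liq n K) (p liq n.+1 K) (s liq n.+1 K)
  (sat_ge0 Hd Hm sol liq K nN1).
have hg := enthalpy_mass_increment gas (p gas n K) (p gas n.+1 K) (s gas n.+1 K)
  (sat_ge0 Hd Hm sol gas K nN1).
have hc := cap_energy_tangent Hd (s liq n.+1 K) (s liq n K).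
have pcE := scheme_pc sol K nN.
have e1 := sat_sum Hd Hm sol K nN1.
have e2 := @sat_sum _ _ _ _ Hd Hm _ _ _ sol n.+1 K nN.
have E : (s liq n.+1 K - s liq n K) * p liq n.+1 K +
    (s gas n.+1 K - s gas n K) * p gas n.+1 K =
  pc d (s liq n.+1 K) * (s liq n K - s liq n.+1 K).
  by rewrite pcE e1 e2; ring.
rewrite /cell_energy; lra.
Qed.

End energy_step.

Section step_bound.
Context (R : realType) (l : nat) (d : model_data R l) (m : mesh R l).
Hypothesis (Hd : standing_assumptions d) (Hm : admissible d m).
Variables (N : nat) (p s : phase -> nat -> cv m -> R).
Hypothesis (sol : is_solution d N p s).
Variables (rm rM : R).
Hypotheses (rm0 : 0 < rm) (rr : forall al z, rm <= rho d al z <= rM).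
Variable (m0 : R).
Hypotheses (m0_gt0 : 0 < m0) (m0P : forall z, 0 <= z <= 1 -> m0 <= mob_tot d z).
Implicit Types (K L : cv m) (x : nb m) (al : phase) (n : nat).
Local Notation Ce := (edge_const (max_mob d) m0^-1).
Local Notation mx := (max_mob d).

Lemma max_mob_ge0 : 0 <= mx.
Proof. exact: le_trans (mob_ge0T Hd liq 0) (mob_le_max Hd liq 0). Qed.

Lemma edge_const_gt0 : 0 < Ce.
Proof.
have i0 : 0 <= m0^-1 by rewrite invr_ge0 ltW.
have mx0 := max_mob_ge0; rewrite /edge_const.
have h1 : 0 <= mx * m0^-1 by exact: mulr_ge0.
have h2 : 0 <= mx * m0^-1 ^+ 2 by apply: mulr_ge0 => //; exact: sqr_ge0.
have h3 : 0 <= mx ^+ 2 * m0^-1 ^+ 2 by apply: mulr_ge0; exact: sqr_ge0.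
have h4 : 0 <= mx ^+ 3 * m0^-1 ^+ 2.
  by apply: mulr_ge0; [exact: exprn_ge0|exact: sqr_ge0].
by move: h1 h2 h3 h4 i0; set a := mx * _; set b := _ * _ ^+ 2; lra.
Qed.

(** The global pressure, shifted so as to vanish on Gamma_l. *)
Definition global_pressure n K : R :=
  p liq n K + (pbar d (s liq n K) - pbar d 1).

Lemma global_pressure_jump n K x :
  (global_pressure n K - nb_val (global_pressure n) 0 x) =
  - (delta_p p liq n K x + delta_sl s (pbar d) n K x).
Proof.
rewrite /global_pressure /delta_p /delta_sl /p_nb /s_nb.
by case: x => [L|e] /=; rewrite /p_bnd; ring.
Qed.

Lemma pc_le_pc0 z : 0 <= z <= 1 -> pc d z <= pc d 0.
Proof.
move=> /andP[+ _]; rewrite le_eqVlt => /orP[/eqP<-//|z0].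
exact: ltW (pc_decreasing Hd z0).
Qed.

(** The phase pressures differ from the global pressure by bounded functions of
    the saturation. *)
Lemma phase_pressure_le al n K : (n <= N)%N ->
  `|p al n.+1 K| <= `|global_pressure n.+1 K| + 2 * pc d 0.
Proof.
move=> nN; have sK := @sat_unit _ _ _ _ Hd Hm _ _ _ sol liq n.+1 K nN.
have o1 : 0 <= (1 : R) <= 1 by rewrite ler01 lexx.
have [h _] := pbarB Hd m0_gt0 m0P o1 sK (mob_le_max Hd gas _).
have pcs := pc_ge0 Hd sK; have pcs0 := pc_le_pc0 sK.
rewrite (pc_1 Hd) subr0 (ger0_norm pcs) in h.
have pcE := scheme_pc sol K nN.
have h1 : `|p liq n.+1 K| <= `|global_pressure n.+1 K| + pc d 0.
  have -> : p liq n.+1 K = global_pressure n.+1 K - (pbar d (s liq n.+1 K) - pbar d 1).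
    by rewrite /global_pressure; ring.
  by apply: (le_trans (ler_normB _ _)); rewrite lerD2l (le_trans h).
case: al; first by apply: (le_trans h1); lra.
have -> : p gas n.+1 K = p liq n.+1 K + pc d (s liq n.+1 K) by rewrite pcE; ring.
by apply: (le_trans (ler_normD _ _)); rewrite (ger0_norm pcs); lra.
Qed.

Section one_step.
Variable (n : nat).
Hypothesis (nN : (n <= N)%N).
Local Notation H al K := (enthalpy d al (p al n.+1 K)).
Local Notation fPK K := (slab_mean d N (fP d) n K).
Local Notation fIK K := (slab_mean d N (fI d) n K).
Local Notation dt := (dt d N).
Local Notation u K := (global_pressure n.+1 K).

Definition source_work al K : R :=
  H al K * (volume K * rho d al (p al n.+1 K) * slab_mean d N (sI d al) n K * fIK K) -
  H al K * (volume K * rho d al (p al n.+1 K) * s al n.+1 K * fPK K).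

Lemma mass_balance_work al :
  \sum_K volume K * phiK d K / dt * (H al K * (rho d al (p al n.+1 K) * s al n.+1 K -
     rho d al (p al n K) * s al n K)) +
  \sum_K H al K * (\sum_(x | is_nb d K x) tau K x * rhoKL d p al n.+1 K x *
    upwind_flux d al (s al n.+1 K) (s_nb s al n.+1 x) (p_nb p al n.+1 x - p al n.+1 K)) +
  \sum_K H al K * gravity_flux d p s al n.+1 K = \sum_K source_work al K.
Proof.
rewrite -!big_split/=; apply: eq_bigr => K _.
have := scheme_mass sol al K nN; rewrite /mass_balance /source_work => mb.
rewrite -mb; set Q := \sum_(x | _) _; set G := gravity_flux _ _ _ _ _ _.
by ring.
Qed.

Lemma source_work_le al K :
  source_work al K <= volume K * (rM / rm * (`|u K| + 2 * pc d 0) * (fPK K + fIK K)).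
Proof.
have [M M0 OM] := Omega_cube Hd.
have v0 := volume_gt0 Hd Hm M0 OM K.
have /andP[sI0 sI1] := slab_mean_unit Hd Hm M0 OM al K nN.
have fP0 := slab_mean_ge0 Hd Hm K nN (fP_L2 Hd) (fP_ge0 Hd).
have fI0 := slab_mean_ge0 Hd Hm K nN (fI_L2 Hd) (fI_ge0 Hd).
have /andP[s0 s1] := @sat_unit _ _ _ _ Hd Hm _ _ _ sol al n.+1 K nN.
have r0 := rho_gt0 Hd al (p al n.+1 K); have /andP[_ rM1] := rr al (p al n.+1 K).
have Hp : `|H al K| <= rm^-1 * `|p al n.+1 K|.
  by have := enthalpy_norm_le Hd 0 (p al n.+1 K) rm0 (rr al); rewrite enthalpy0 !subr0.
have pu := phase_pressure_le al K nN.
rewrite /source_work; set h := enthalpy _ _ _ in Hp *; set r := rho _ _ _ in r0 rM1 *.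
have -> : h * (volume K * r * slab_mean d N (sI d al) n K * fIK K) -
  h * (volume K * r * s al n.+1 K * fPK K) =
  volume K * (h * r * (slab_mean d N (sI d al) n K * fIK K - s al n.+1 K * fPK K)) by ring.
apply: ler_wpM2l; first exact: ltW.
apply: (le_trans (ler_norm _)); rewrite !normrM (gtr0_norm r0).
apply: ler_pM; rewrite ?mulr_ge0//; first exact: ltW.
  rewrite [rM / rm]mulrC -mulrA [rM * _]mulrC mulrA; apply: ler_pM => //; first exact: ltW.
  by apply: (le_trans Hp); apply: ler_wpM2l; [rewrite invr_ge0 ltW|].
apply: diff_nonneg_le; [exact: mulr_ge0|exact: mulr_ge0| |].
  by apply: (@le_trans _ _ (fIK K)); [rewrite ler_piMl|rewrite lerDr].
by apply: (@le_trans _ _ (fPK K)); [rewrite ler_piMl|rewrite lerDl].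
Qed.

(** Young's inequality, keeping a small multiple of the L2 norm of the global
    pressure. *)
Lemma total_source_work (k : R) : 0 < k ->
  \sum_K source_work liq K + \sum_K source_work gas K <=
  2 * k * \sum_(K : cv m) volume K * u K ^+ 2 + 8 * k * pc d 0 ^+ 2 * \sum_(K : cv m) volume K +
  2 * (rM / rm) ^+ 2 / k * \sum_(K : cv m) volume K * (fPK K ^+ 2 + fIK K ^+ 2).
Proof.
move=> k0; rewrite !mulr_sumr -!big_split/=; apply: ler_sum => K _.
have [M M0 OM] := Omega_cube Hd.
have v0 := volume_gt0 Hd Hm M0 OM K.
apply: (le_trans (lerD (source_work_le liq K) (source_work_le gas K))).
set c0 := rM / rm; set q := pc d 0.
have h1 := young (`|u K| + 2 * q) (2 * c0 * (fPK K + fIK K)) k0.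
have h2 := sqrD_le2 `|u K| (2 * q); rewrite real_normK ?num_real// in h2.
have h3 := sqrD_le2 (fPK K) (fIK K).
have h4 := ler_wpM2l (ltW k0) h2.
have ck : 0 <= c0 ^+ 2 / k by rewrite divr_ge0 ?sqr_ge0// ltW.
have h5 := ler_wpM2l ck h3.
have E : (4 * k)^-1 * (2 * c0 * (fPK K + fIK K)) ^+ 2 = c0 ^+ 2 / k * (fPK K + fIK K) ^+ 2.
  by field; rewrite gt_eqF.
rewrite E in h1.
have h6 : 2 * (c0 * (`|u K| + 2 * q) * (fPK K + fIK K)) <=
  2 * k * u K ^+ 2 + 8 * k * q ^+ 2 + 2 * c0 ^+ 2 / k * (fPK K ^+ 2 + fIK K ^+ 2).
  by move: h1 h4 h5; set X := c0 ^+ 2 / k; rewrite -[2 * c0 ^+ 2 / k]mulrA -/X; lra.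
have := ler_wpM2l (ltW v0) h6; lra.
Qed.

Local Notation Diss := (\sum_K \sum_(x | is_nb d K x) tau K x * dissipation d p s n.+1 K x).

Definition energy (i : nat) : R :=
  \sum_K volume K * phiK d K * cell_energy d p s i K.

Variable (Cp : R).
Hypotheses (Cp0 : 0 < Cp) (poinc : forall w : cv m -> R, \sum_K volume K * w K ^+ 2 <=
  Cp * \sum_K \sum_(x | is_nb d K x) tau K x * (w K - nb_val w 0 x) ^+ 2).

(** Small enough for the two phases together to use a quarter of the
    dissipation. *)
Definition gravity_young : R := (8 * (mx * Ce + 1))^-1.
(** Small enough for the sources to use an eighth of the dissipation. *)
Definition source_young : R := (16 * (Cp * Ce + 1))^-1.

(** The mass balances are multiplied by the enthalpies and summed. Diffusion
    yields half of the dissipation. Gravity and the sources use three eighths of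
    it, because the pressure jumps weighted by the larger mobilities and the jumps
    of the global pressure are bounded by the dissipation (edge_control), the
    latter controlling the pressures through the Poincare inequality. *)
Lemma energy_step :
  (energy n.+1 - energy n) / dt + 8^-1 * Diss <=
  (2 * gravity_young)^-1 * (rM * enorm (grav d)) ^+ 2 *
    (\sum_(K : cv m) \sum_(x | is_nb d K x) nb_area K x * nb_dist K x) +
  8 * source_young * pc d 0 ^+ 2 * \sum_(K : cv m) volume K +
  2 * (rM / rm) ^+ 2 / source_young * \sum_(K : cv m) volume K * (fPK K ^+ 2 + fIK K ^+ 2).
Proof.
have [M M0 OM] := Omega_cube Hd.
have dt0 := dt_gt0 Hd N; have Ce0 := edge_const_gt0; have mx0 := max_mob_ge0.
have mC : 0 <= mx * Ce by rewrite mulr_ge0// ltW.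
have CC : 0 <= Cp * Ce by rewrite mulr_ge0// ltW.
have k0 : 0 < gravity_young by rewrite invr_gt0; lra.
have k'0 : 0 < source_young by rewrite invr_gt0; lra.
have t0 K x : is_nb d K x -> 0 <= tau K x by exact: tau_ge0.
have D0 : 0 <= Diss.
  by apply: sumr_ge0 => K _; apply: sumr_ge0 => x nx; rewrite mulr_ge0 ?t0 ?dissipation_ge0.
have time : (energy n.+1 - energy n) / dt <=
   \sum_K volume K * phiK d K / dt * (H liq K * (rho d liq (p liq n.+1 K) * s liq n.+1 K -
     rho d liq (p liq n K) * s liq n K)) +
   \sum_K volume K * phiK d K / dt * (H gas K * (rho d gas (p gas n.+1 K) * s gas n.+1 K -
     rho d gas (p gas n K) * s gas n K)).
  rewrite -sumrB mulr_suml -big_split/=; apply: ler_sum => K _.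
  rewrite -mulrBr -mulrDr mulrAC; apply: ler_wpM2l.
    apply: ltW; apply: divr_gt0 => //; apply: mulr_gt0; last exact: (phiK_gt0 Hd Hm).
    exact: (volume_gt0 Hd Hm M0 OM).
  exact: (cell_energy_increment Hd Hm sol nN K).
have ql := mass_balance_work liq; have qg := mass_balance_work gas.
have dl := diffusion_energy Hd Hm p s n liq; have dg := diffusion_energy Hd Hm p s n gas.
have gl := gravity_energy Hd Hm p s rm0 rr n liq k0.
have gg := gravity_energy Hd Hm p s rm0 rr n gas k0.
have src := total_source_work k'0.
have dd : \sum_K \sum_(x | is_nb d K x)
    tau K x * (upwind_mob d p s liq n.+1 K x * delta_p p liq n.+1 K x ^+ 2) +
  \sum_K \sum_(x | is_nb d K x)
    tau K x * (upwind_mob d p s gas n.+1 K x * delta_p p gas n.+1 K x ^+ 2) = Diss.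
  rewrite -big_split; apply: eq_bigr => K _; rewrite -big_split; apply: eq_bigr => x _.
  by rewrite /= -mulrDr.
pose AD := \sum_(K : cv m) \sum_(x | is_nb d K x) nb_area K x * nb_dist K x.
pose W := (4 * gravity_young)^-1 * (rM * enorm (grav d)) ^+ 2.
have grav_al al : (forall K x, is_nb d K x ->
    max_mob_edge d s al n.+1 K x * delta_p p al n.+1 K x ^+ 2 <=
    Ce * dissipation d p s n.+1 K x) ->
  \sum_K \sum_(x | is_nb d K x)
    (tau K x * (gravity_young * (mx * (max_mob_edge d s al n.+1 K x * delta_p p al n.+1 K x ^+ 2)))
     + W * (nb_area K x * nb_dist K x)) <= 8^-1 * Diss + W * AD.
  move=> h; rewrite !mulr_sumr -big_split; apply: ler_sum => K _.
  rewrite !mulr_sumr -big_split; apply: ler_sum => x nx /=; rewrite lerD2r.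
  have h8 : 0 <= dissipation d p s n.+1 K x by exact: dissipation_ge0.
  have := ler_wpM2l (mulr_ge0 (t0 K x nx) (mulr_ge0 (ltW k0) mx0)) (h K x nx).
  set T := tau K x; set E := dissipation _ _ _ _ _ _ in h8 *.
  set Z := max_mob_edge _ _ _ _ _ _ * _.
  have h9 : gravity_young * (mx * Ce) <= 8^-1.
    rewrite /gravity_young invfM -mulrA -[leRHS]mulr1; apply: ler_wpM2l; first by lra.
    by rewrite mulrC ler_pdivrMr; lra.
  have h10 := ler_wpM2r (mulr_ge0 (t0 K x nx) h8) h9.
  move=> h11; rewrite -/T -/E in h10; lra.
have ec K x : is_nb d K x -> _ := fun _ => scheme_edge_control Hd Hm sol K x m0_gt0 m0P nN.
have gl' := le_trans gl (grav_al liq (fun K x nx => let: And4 a _ _ _ := ec K x nx in a)).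
have gg' := le_trans gg (grav_al gas (fun K x nx => let: And4 _ a _ _ := ec K x nx in a)).
have uD : 2 * source_young * \sum_(K : cv m) volume K * u K ^+ 2 <= 8^-1 * Diss.
  have h : \sum_(K : cv m) volume K * u K ^+ 2 <= Cp * (Ce * Diss).
    apply: (le_trans (poinc _)); apply: ler_wpM2l; first exact: ltW.
    rewrite mulr_sumr; apply: ler_sum => K _; rewrite mulr_sumr; apply: ler_sum => x nx.
    rewrite global_pressure_jump sqrrN.
    have [_ _ h _] := ec K x nx.
    by rewrite [leRHS]mulrCA; exact: (ler_wpM2l (t0 K x nx) h).
  have h12 : 2 * source_young * (Cp * Ce) <= 8^-1.
    rewrite /source_young invfM.
    have h13 : (Cp * Ce + 1)^-1 * (Cp * Ce) <= 1 by rewrite mulrC ler_pdivrMr; lra.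
    by lra.
  have := ler_wpM2l (mulr_ge0 (ler0n _ 2) (ltW k'0)) h.
  have := ler_wpM2r D0 h12; lra.
have WE : (2 * gravity_young)^-1 * (rM * enorm (grav d)) ^+ 2 = 2 * W.
  by rewrite /W; field; rewrite gt_eqF.
rewrite WE -/AD; move: time ql qg dl dg gl' gg' src dd uD.
set D := Diss.
lra.
Qed.

End one_step.
End step_bound.

(** * The dissipation bound and the estimates *)

Section energy_bounds.
Context (R : realType) (l : nat) (d : model_data R l) (m : mesh R l).
Hypothesis (Hd : standing_assumptions d) (Hm : admissible d m).
Variables (N : nat) (p s : phase -> nat -> cv m -> R).
Hypothesis (sol : is_solution d N p s).
Variables (rm rM phi1 : R).
Hypotheses (rm0 : 0 < rm) (rr : forall al z, rm <= rho d al z <= rM).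
Hypotheses (phi1P : forall K : cv m, phiK d K <= phi1).
Implicit Types (K : cv m) (n : nat) (al : phase).

Let vol_ge0 K : 0 <= volume K.
Proof. by have [M M0 OM] := Omega_cube Hd; exact: ltW (volume_gt0 Hd Hm M0 OM K). Qed.

Let pc0_ge0 : 0 <= pc d 0.
Proof. by apply: (pc_ge0 Hd); rewrite lexx ler01. Qed.

Lemma energy_ge n : (n <= N.+1)%N ->
  - (phi1 * pc d 0 * \sum_(K : cv m) volume K) <= energy d p s n.
Proof.
move=> nN; rewrite mulr_sumr -sumrN; apply: ler_sum => K _.
have v0 := vol_ge0 K; have f0 := ltW (phiK_gt0 Hd Hm K).
have /andP[_ c1] := cap_energy_range Hd (sat_unit Hd Hm sol liq K nN).
have h : - pc d 0 <= cell_energy d p s n K.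
  rewrite /cell_energy.
  have hl := mulr_ge0 (sat_ge0 Hd Hm sol liq K nN) (enthalpy_energy_ge0 Hd liq (p liq n K)).
  have hg := mulr_ge0 (sat_ge0 Hd Hm sol gas K nN) (enthalpy_energy_ge0 Hd gas (p gas n K)).
  by lra.
have h1 := ler_wpM2l (mulr_ge0 v0 f0) h.
have h2 := ler_wpM2l (mulr_ge0 v0 pc0_ge0) (phi1P K).
apply: le_trans h1.
by rewrite mulrN lerN2; move: h2; rewrite mulrAC; lra.
Qed.

Lemma initial_energy_le :
  energy d p s 0 <= phi1 * ((rM / rm + 1) * (\sum_(K : cv m) volume K *
    (2 + p liq 0%N K ^+ 2 + p gas 0%N K ^+ 2))).
Proof.
rewrite !mulr_sumr; apply: ler_sum => K _.
have v0 := vol_ge0 K; have f0 := ltW (phiK_gt0 Hd Hm K).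
have c0 : 0 <= rM / rm.
  have /andP[h1 h2] := rr liq 0.
  by rewrite divr_ge0 ?(ltW rm0)// (le_trans (ltW rm0))// (le_trans h1).
have work al : s al 0%N K * (rho d al (p al 0%N K) * enthalpy d al (p al 0%N K) - p al 0%N K) <=
    (rM / rm + 1) * (1 + p al 0%N K ^+ 2).
  have /andP[s0 s1] := sat_unit Hd Hm sol al K (leq0n N.+1).
  set q := p al 0%N K.
  have e0 := enthalpy_energy_ge0 Hd al q.
  apply: (@le_trans _ _ (rho d al q * enthalpy d al q - q)); first by rewrite ler_piMl.
  apply: (le_trans (ler_norm _)); apply: (le_trans (ler_normB _ _)).
  apply: (@le_trans _ _ ((rM / rm + 1) * `|q|)).
    rewrite mulrDl mul1r lerD2r normrM -mulrA.
    have r0 := rho_gt0 Hd al q; have /andP[_ rM1] := rr al q.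
    rewrite gtr0_norm//; apply: ler_pM => //; first exact: ltW.
    by have := enthalpy_norm_le Hd 0 q rm0 (rr al); rewrite enthalpy0 !subr0.
  apply: ler_wpM2l; first by lra.
  have := sqr_ge0 (`|q| - 1); have := sqr_ge0 `|q|; rewrite sqrrB real_normK ?num_real//.
  by lra.
have /andP[c1 _] := cap_energy_range Hd (sat_unit Hd Hm sol liq K (leq0n N.+1)).
have h : cell_energy d p s 0 K <= (rM / rm + 1) * (2 + p liq 0%N K ^+ 2 + p gas 0%N K ^+ 2).
  by rewrite /cell_energy; have := work liq; have := work gas; lra.
have q0 : 0 <= (rM / rm + 1) * (2 + p liq 0%N K ^+ 2 + p gas 0%N K ^+ 2).
  apply: mulr_ge0; first by lra.
  by have := sqr_ge0 (p liq 0%N K); have := sqr_ge0 (p gas 0%N K); lra.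
have h1 := ler_wpM2l (mulr_ge0 v0 f0) h.
have h2 := ler_wpM2l (mulr_ge0 v0 q0) (phi1P K).
apply: (le_trans h1); move: h2.
set Z := (_ + 1) * _.
have -> : (rM / rm + 1) * (volume K * (2 + p liq 0%N K ^+ 2 + p gas 0%N K ^+ 2)) = volume K * Z.
  by rewrite /Z mulrCA.
by rewrite mulrAC [phi1 * _]mulrC.
Qed.

End energy_bounds.

Section dissipation_bound.
Context (R : realType) (l : nat) (d : model_data R l).
Hypothesis (Hd : standing_assumptions d).

(** Interior faces are handled by mesh regularity, exterior ones by their total
    area and the diameter of Omega. *)
Lemma sum_area_dist_bound (xi : R) : 0 < xi -> exists2 C : R, 0 <= C &
  forall m : mesh R l, admissible d m -> mesh_regular m xi ->
  \sum_(K : cv m) \sum_(x | is_nb d K x) nb_area K x * nb_dist K x <= C.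
Proof.
move=> xi0; have [M M0 OM] := Omega_cube Hd; have [A A0 HA] := exterior_area_bound Hd.
set D := Num.sqrt (l%:R * ((2 * M) * (2 * M))).
have D0 : 0 <= D by exact: sqrtr_ge0.
exists (xi * (2 * M) ^+ l + D * A).
  apply: addr_ge0; last exact: mulr_ge0.
  by apply: mulr_ge0; [exact: ltW|apply: exprn_ge0; rewrite mulr_ge0// ltW].
move=> m Hm reg.
under eq_bigr do rewrite sum_nb_split.
rewrite big_split; apply: lerD.
  have := sum_area_dist_le reg (f := fun=> 1) (fun=> ler01).
  under [X in X <= _ -> _]eq_bigr do under eq_bigr do rewrite mulr1.
  under [X in _ <= _ * X -> _]eq_bigr do rewrite mulr1.
  move=> h; apply: (le_trans h); apply: ler_wpM2l; first exact: ltW.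
  exact: (sum_volume_le Hd Hm M0 OM).
apply: (@le_trans _ _ (\sum_K \sum_(e | is_nb d K (inr e)) D * nb_area (ext_cell e) (inr e))).
  apply: ler_sum => K _; apply: ler_sum => e nKe.
  rewrite -(is_nb_ext nKe) mulrC; apply: ler_wpM2r; first exact: nb_area_ge0.
  by rewrite (is_nb_ext nKe); exact: (nb_dist_ext_le Hd Hm).
apply: (le_trans (sum_ext_le _ _)).
  by move=> e; rewrite mulr_ge0// nb_area_ge0.
by rewrite -mulr_sumr; apply: ler_wpM2l => //; exact: HA.
Qed.

(** The energy steps telescope. The energy is bounded from below, and initially
    by the L2 norm of the initial pressures; the L2 norms of the discrete sources
    are bounded by those of the data. *)
Lemma dissipation_bound (xi : R) : 0 < xi -> exists2 C : R, 0 < C &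
  forall (m : mesh R l) (N : nat) (p s : phase -> nat -> cv m -> R),
    admissible d m -> mesh_regular m xi -> is_solution d N p s ->
    \sum_(n < N) dt d N * \sum_(K : cv m) \sum_(x | is_nb d K x)
      tau K x * dissipation d p s n.+1 K x <= C.
Proof.
move=> xi0.
have [M M0 OM] := Omega_cube Hd; have [AD AD0 HAD] := sum_area_dist_bound xi0.
have [Cp Cp0 HP] := poincare_L2 Hd xi0.
have [m0 m0_gt0 m0P] := mob_total Hd.
have [rm [rM [rm0 rr]]] := rho_range Hd.
have [phi0 [phi1 [phi00 phi10 phiP]]] := phi_range Hd.
have T0 := T_end_gt0 Hd.
pose V : R := (2 * M) ^+ l.
have V0 : 0 <= V by apply: exprn_ge0; rewrite mulr_ge0// ltW.
pose IP al := \int[lebesgue_rV l]_x ((p0 d al \_ (Omega d)) x) ^+ 2.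
pose If (f : R * 'rV[R]_l -> R) := \int[space_time R l]_z ((f \_ (Q_T d)) z) ^+ 2.
have If0 f : 0 <= If f by apply: Rintegral_ge0 => z _; exact: sqr_ge0.
have IP0 al : 0 <= IP al by apply: Rintegral_ge0 => z _; exact: sqr_ge0.
pose kg := gravity_young d m0; pose ks := source_young d m0 Cp.
pose W := (2 * kg)^-1 * (rM * enorm (grav d)) ^+ 2.
pose c2 := 8 * ks * pc d 0 ^+ 2.
pose c3 := 2 * (rM / rm) ^+ 2 / ks.
have mx0 := max_mob_ge0 Hd; have Ce0 := edge_const_gt0 Hd m0_gt0.
have kg0 : 0 <= kg.
  by rewrite invr_ge0 mulr_ge0// addr_ge0// mulr_ge0// ltW.
have ks0 : 0 <= ks.
  by rewrite invr_ge0 mulr_ge0// addr_ge0// mulr_ge0// ltW.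
have W0 : 0 <= W by rewrite /W; apply: mulr_ge0; [rewrite invr_ge0 mulr_ge0|exact: sqr_ge0].
have c20 : 0 <= c2 by rewrite /c2; apply: mulr_ge0; [rewrite mulr_ge0|exact: sqr_ge0].
have c30 : 0 <= c3 by rewrite /c3; apply: divr_ge0 => //; apply: mulr_ge0 => //; exact: sqr_ge0.
have pc00 : 0 <= pc d 0 by apply: (pc_ge0 Hd); rewrite lexx ler01.
have c00 : 0 <= rM / rm.
  have /andP[h1 h2] := rr liq 0.
  by rewrite divr_ge0 ?(ltW rm0)// (le_trans (ltW rm0))// (le_trans h1).
pose E0 := phi1 * ((rM / rm + 1) * (2 * V + IP liq + IP gas)).
pose EN := phi1 * pc d 0 * V.
pose C := 8 * (E0 + EN + T_end d * (W * AD + c2 * V) + c3 * (If (fP d) + If (fI d))).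
have E00 : 0 <= E0.
  apply: mulr_ge0; first exact: ltW.
  apply: mulr_ge0; first by lra.
  by have := IP0 liq; have := IP0 gas; lra.
have EN0 : 0 <= EN by apply: mulr_ge0 => //; apply: mulr_ge0 => //; exact: ltW.
have C0 : 0 <= C.
  apply: mulr_ge0 => //; apply: addr_ge0; last first.
    by apply: mulr_ge0 => //; apply: addr_ge0.
  apply: addr_ge0; first exact: addr_ge0.
  by apply: mulr_ge0; [exact: ltW|apply: addr_ge0; exact: mulr_ge0].
exists (C + 1) => [|m N p s Hm reg sol]; first by lra.
have phiK1 (K : cv m) : phiK d K <= phi1 by have /andP[] := phiK_range Hd Hm M0 OM phi00 phiP K.
have dt0 := dt_gt0 Hd N.
pose Diss n := \sum_(K : cv m) \sum_(x | is_nb d K x) tau K x * dissipation d p s n.+1 K x.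
pose S2 n := \sum_(K : cv m) volume K *
   (slab_mean d N (fP d) n K ^+ 2 + slab_mean d N (fI d) n K ^+ 2).
have Vle := sum_volume_le Hd Hm M0 OM.
have step n : (n <= N)%N ->
    energy d p s n.+1 - energy d p s n + 8^-1 * (dt d N * Diss n) <=
    dt d N * (W * AD + c2 * V) + c3 * (dt d N * S2 n).
  move=> nN; have := energy_step Hd Hm sol rm0 rr m0_gt0 m0P nN Cp0 (HP m Hm reg).
  rewrite -/kg -/ks -/W -/c2 -/c3 -/(S2 n) -/(Diss n) => h.
  have h1 := ler_wpM2l W0 (HAD m Hm reg); have h2 := ler_wpM2l c20 Vle.
  have h3 : (energy d p s n.+1 - energy d p s n) / dt d N + 8^-1 * Diss n <=
     W * AD + c2 * V + c3 * S2 n by rewrite -/V in h2; lra.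
  have := ler_wpM2l (ltW dt0) h3.
  have -> : dt d N * ((energy d p s n.+1 - energy d p s n) / dt d N + 8^-1 * Diss n) =
    energy d p s n.+1 - energy d p s n + 8^-1 * (dt d N * Diss n).
    by field; rewrite gt_eqF.
  lra.
have sumstep : energy d p s N - energy d p s 0 + 8^-1 * (\sum_(n < N) dt d N * Diss n) <=
    N%:R * (dt d N * (W * AD + c2 * V)) + c3 * \sum_(n < N) dt d N * S2 n.
  rewrite -(telescope_sumr (energy d p s) (leq0n N)) big_mkord !mulr_sumr -big_split/=.
  have -> : N%:R * (dt d N * (W * AD + c2 * V)) = \sum_(n < N) dt d N * (W * AD + c2 * V).
    by rewrite sumr_const card_ord mulr_natl.
  by rewrite -big_split/=; apply: ler_sum => n _; apply: step; exact: ltnW.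
have TN : N%:R * (dt d N * (W * AD + c2 * V)) <= T_end d * (W * AD + c2 * V).
  rewrite mulrA; apply: ler_wpM2r; first by apply: addr_ge0; exact: mulr_ge0.
  by rewrite -(tn_end d N) /tn; apply: ler_wpM2r; [exact: ltW|rewrite ler_nat].
have S2le : \sum_(n < N) dt d N * S2 n <= If (fP d) + If (fI d).
  apply: le_trans (lerD (sum_slab_mean_sqr Hd Hm M0 OM N (fP_L2 Hd))
    (sum_slab_mean_sqr Hd Hm M0 OM N (fI_L2 Hd))).
  rewrite -big_split/=; apply: ler_sum => n _; rewrite -mulrDr -big_split/=.
  apply: ler_wpM2l; first exact: ltW.
  by apply: ler_sum => K _; rewrite mulrDr.
have S2c := ler_wpM2l c30 S2le.
have E0le : energy d p s 0 <= E0.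
  apply: (le_trans (initial_energy_le Hd Hm sol rm0 rr phiK1)).
  apply: ler_wpM2l; first exact: ltW.
  apply: ler_wpM2l; first by lra.
  have -> : \sum_(K : cv m) volume K * (2 + p liq 0%N K ^+ 2 + p gas 0%N K ^+ 2) =
      2 * \sum_(K : cv m) volume K + \sum_K volume K * p liq 0%N K ^+ 2 +
      \sum_K volume K * p gas 0%N K ^+ 2.
    by rewrite mulr_sumr -!big_split; apply: eq_bigr => K _ /=; ring.
  apply: lerD; last first.
    apply: le_trans (sum_mean_p0_sqr Hd Hm M0 OM gas).
    by apply: ler_sum => K _; rewrite (init_p sol).
  apply: lerD; first by apply: ler_wpM2l.
  apply: le_trans (sum_mean_p0_sqr Hd Hm M0 OM liq).
  by apply: ler_sum => K _; rewrite (init_p sol).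
have ENle : - EN <= energy d p s N.
  apply: le_trans (energy_ge Hd Hm sol phiK1 (leqnSn N)).
  rewrite lerN2; apply: ler_wpM2l => //; apply: mulr_ge0 => //; exact: ltW.
rewrite -/(Diss _); move: sumstep TN S2c E0le ENle; rewrite /C.
set X := \sum_(n < N) dt d N * Diss n; set Y := \sum_(n < N) dt d N * S2 n.
lra.
Qed.

End dissipation_bound.

Theorem corollary1 (R : realType) (l : nat) (hl : (0 < l)%N)
    (d : model_data R l) (xi : R) :
  standing_assumptions d -> 0 < xi ->
  exists2 C : R, 0 < C &
    forall (m : mesh R l) (N : nat) (p s : phase -> nat -> cv m -> R),
      admissible d m -> mesh_regular m xi -> is_solution d N p s ->
      [/\ \sum_(n < N) dt d N * \sum_(K : cv m) \sum_(L | is_nb d K L)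
            tau K L * delta_sl s (calB d) n.+1 K L ^+ 2 <= C,
          \sum_(n < N) dt d N * \sum_(K : cv m) \sum_(L | is_nb d K L)
            tau K L * upwind_mob d p s liq n.+1 K L
              * delta_sl s (pbar d) n.+1 K L ^+ 2 <= C
        & \sum_(n < N) dt d N * \sum_(K : cv m) \sum_(L | is_nb d K L)
            tau K L * upwind_mob d p s gas n.+1 K L
              * delta_sl s (ptilde d) n.+1 K L ^+ 2 <= C].
Proof.
move=> Hd xi0.
have [C C0 HC] := dissipation_bound Hd xi0.
have [m0 m0_gt0 m0P] := mob_total Hd.
have Ce0 := edge_const_gt0 Hd m0_gt0.
exists (edge_const (max_mob d) m0^-1 * C) => [|m N p s Hm reg sol]; first exact: mulr_gt0.
have bound (F : nat -> cv m -> nb m -> R) :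
    (forall n K x, (n < N)%N -> is_nb d K x -> F n K x <=
       edge_const (max_mob d) m0^-1 * dissipation d p s n.+1 K x) ->
    \sum_(n < N) dt d N * \sum_K \sum_(x | is_nb d K x) tau K x * F n K x <=
    edge_const (max_mob d) m0^-1 * C.
  move=> hF; apply: le_trans (ler_wpM2l (ltW Ce0) (HC m N p s Hm reg sol)).
  rewrite mulr_sumr; apply: ler_sum => n _; rewrite mulrCA.
  apply: ler_wpM2l; first exact: ltW (dt_gt0 Hd N).
  rewrite mulr_sumr; apply: ler_sum => K _; rewrite mulr_sumr; apply: ler_sum => x nx.
  by rewrite [leRHS]mulrCA; apply: ler_wpM2l; [exact: (tau_ge0 Hm)|exact: hF].
have ec n K x : (n < N)%N -> _ :=
  fun nN => scheme_edge_control Hd Hm sol K x m0_gt0 m0P (ltnW nN).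
split.
- apply: (bound (fun n K x => delta_sl s (calB d) n.+1 K x ^+ 2)) => n K x nN _.
  by have [_ _ _ [h _ _]] := ec n K x nN.
- under eq_bigr do under eq_bigr do under eq_bigr do rewrite -mulrA.
  apply: (bound (fun n K x => upwind_mob d p s liq n.+1 K x *
    delta_sl s (pbar d) n.+1 K x ^+ 2)) => n K x nN _.
  by have [_ _ _ [_ h _]] := ec n K x nN.
- under eq_bigr do under eq_bigr do under eq_bigr do rewrite -mulrA.
  apply: (bound (fun n K x => upwind_mob d p s gas n.+1 K x *
    delta_sl s (ptilde d) n.+1 K x ^+ 2)) => n K x nN _.
  by have [_ _ _ [_ _ h]] := ec n K x nN.
Qed.
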